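(* Let $\lambda>0$ and let $S^{I}_{d,\lambda}=\{S^{I}_{d,\lambda}(t)\}_{t\in\mathbb{R}}$ be a tempered fractional Lévy process of the first kind (TFLP) driven by $L$. (a) If $0<d\le\frac12$, then there exists a locally $d$-Hölder continuous modification of $S^{I}_{d,\lambda}$ (again denoted $S^{I}_{d,\lambda}$). That is, for $T>0$, $$\mathbb{P}\Bigg[\omega:\ \sup_{0<|s-t|<k_T(\omega),\,|s|\le T,\,|t|\le T}\Big(\frac{|S^{I}_{d,\lambda}(t)-S^{I}_{d,\lambda}(s)|}{|s-t|^{d}}\Big)\le C\Bigg]=1,$$ where $k_T(\omega)$ is an almost surely positive random variable and $C>0$. (b) If $-\frac12<d<0$ and $L$ has symmetric finite-dimensional distributions, then $S^{I}_{d,\lambda}$ has discontinuous and unbounded sample paths with positive probability.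
   Context: Driving Lévy process. $L=\{L(t)\}_{t\in\mathbb{R}}$ is the two-sided Lévy process $L(t)=L_1(t)\mathbf 1_{[0,\infty)}(t)-L_2((-t)-)\mathbf 1_{(-\infty,0)}(t)$, where $L_1,L_2$ are independent copies of a Lévy process on $[0,\infty)$. It is centered ($\mathbb{E}[L(1)]=0$), has no Brownian component, and $\mathbb{E}[e^{i\theta L(t)}]=e^{t\psi(\theta)}$ for $t\ge 0$, with $\psi(\theta)=\int_{\mathbb{R}}(e^{i\theta x}-1-i\theta x)\,\nu(dx)$, where the Lévy measure $\nu$ satisfies $\nu(\{0\})=0$, $\int_{\mathbb{R}}(|x|^2\wedge 1)\,\nu(dx)<\infty$ and $\int_{|x|>1}x^2\,\nu(dx)<\infty$; hence $\mathbb{E}[L(1)^2]<\infty$. For deterministic $f\in L^2(\mathbb{R})$, $\int_{\mathbb{R}} f\,dL$ is the usual Wiener-type integral in $L^2(\Omega)$. Notation. $(x)_+=x\mathbf 1_{\{x>0\}}$, and $(x)_+^p$ is $x^p$ for $x>0$ and $0$ for $x\le 0$. TFLP. For $d>-\frac12$, $\lambda>0$, $$S^{I}_{d,\lambda}(t)=\frac{1}{\Gamma(1+d)}\int_{\mathbb{R}}\Big[e^{-\lambda(t-x)_+}(t-x)_+^{d}-e^{-\lambda(-x)_+}(-x)_+^{d}\Big]dL(x),\quad t\in\mathbb{R}.$$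
   Formalization: In (a) the constant C is an a.s. finite random variable C(ω), possibly depending on T, since a deterministic C fails when the jumps of L are unbounded; in (b) L is assumed non-degenerate (ν ≠ 0), since otherwise S vanishes. *)

(* Defs.v *)
From HB Require Import structures.
From mathcomp Require Import all_boot all_order all_algebra.
From mathcomp Require Import all_classical all_reals all_analysis.
From mathcomp Require Import complex.

Set Implicit Arguments.
Unset Strict Implicit.
Unset Printing Implicit Defensive.

Import Order.TTheory GRing.Theory Num.Theory.
Import numFieldNormedType.Exports.

Local Open Scope classical_set_scope.
Local Open Scope ring_scope.

(* A process indexed by real times is a map X : R -> Omega -> R; X t is the
   random variable at time t and X ^~ w is the sample path at w. *)
Section processes.
Context {disp : measure_display} {Omega : measurableType disp} {R : realType}.
Variable P : probability Omega R.
Implicit Types (X Y S : R -> Omega -> R) (D : set R).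

Definition mutually_independent (n : nat) (Z : 'I_n -> Omega -> R) : Prop :=
  forall B : 'I_n -> set R, (forall i, measurable (B i)) ->
    P (\bigcap_i (Z i @^-1` B i)) = (\prod_(i < n) P (Z i @^-1` B i))%E.

Definition sigma_process D X : set (set Omega) :=
  <<s [set E | exists t B, [/\ D t, measurable B & E = X t @^-1` B]] >>.

Definition independent_processes D X Y : Prop :=
  forall E F, sigma_process D X E -> sigma_process D Y F ->
    P (E `&` F) = (P E * P F)%E.

Definition same_fdd D X Y : Prop :=
  forall (n : nat) (t : 'I_n -> R), (forall i, D (t i)) ->
    forall B : set (n.-tuple (measurableTypeR R)), measurable B ->
      P ((fun w => [tuple X (t i) w | i < n]) @^-1` B) =
      P ((fun w => [tuple Y (t i) w | i < n]) @^-1` B).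

Definition symmetric_fdd X : Prop :=
  same_fdd setT X (fun t w => - X t w).

Definition is_modification S' S : Prop :=
  forall t, measurable_fun setT (S' t) /\ {ae P, forall w, S' t w = S t w}.

(* Only the times t >= 0 matter.  Stochastic continuity is not listed: it
   follows from stationary increments and cadlag paths. *)
Record levy_process X : Prop := {
  levy_measurable : forall t, 0 <= t -> measurable_fun setT (X t);
  levy_start : {ae P, forall w, X 0 w = 0};
  levy_indep : forall (n : nat) (t : nat -> R), 0 <= t 0%N ->
    {homo t : i j / (i <= j)%N >-> i <= j} ->
    mutually_independent (fun (i : 'I_n) w => X (t i.+1) w - X (t i) w);
  levy_stationary : forall s t, 0 <= s -> 0 <= t ->
    forall B : set R, measurable B ->
      P ((fun w => X (s + t) w - X s w) @^-1` B) = P (X t @^-1` B);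
  levy_right_continuous : forall w t, 0 <= t ->
    X s w @[s --> t^'+] --> X t w;
  levy_left_limit : forall w t, 0 < t -> cvg (X s w @[s --> t^'-])
}.

Definition two_sided X Y : R -> Omega -> R := fun t w =>
  if 0 <= t then X t w else - lim (Y s w @[s --> (- t)^'-]).

(* E[exp(i theta Z)] and, below, the complex exponential, through their real
   and imaginary parts. *)
Definition char_fun (Z : Omega -> R) (theta : R) : R[i] :=
  Complex (\int[P]_w cos (theta * Z w)) (\int[P]_w sin (theta * Z w)).

Definition cexp (z : R[i]) : R[i] :=
  Complex (expR (complex.Re z) * cos (complex.Im z))
          (expR (complex.Re z) * sin (complex.Im z)).

Definition levy_measure (nu : {measure set (measurableTypeR R) -> \bar R}) :
    Prop :=
  [/\ nu [set 0] = 0%E,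
      (\int[nu]_x (Num.min (`|x| ^+ 2) 1)%:E < +oo)%E &
      (\int[nu]_(x in [set x | (1 < `|x|)%R]) (x ^+ 2)%:E < +oo)%E].

(* Real and imaginary parts of
   \int (exp(i theta x) - 1 - i theta x) nu(dx). *)
Definition levy_exponent (nu : {measure set (measurableTypeR R) -> \bar R})
    (theta : R) : R[i] :=
  Complex (\int[nu]_x (cos (theta * x) - 1))
          (\int[nu]_x (sin (theta * x) - theta * x)).

Definition driving_levy (nu : {measure set (measurableTypeR R) -> \bar R})
    (L : R -> Omega -> R) : Prop :=
  levy_measure nu /\
  exists L1 L2 : R -> Omega -> R,
    [/\ levy_process L1 /\ levy_process L2,
        same_fdd `[0, +oo[ L1 L2,
        independent_processes `[0, +oo[ L1 L2,
        L = two_sided L1 L2 &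
        ('E_P[L 1%R] = 0)%E /\
        forall t theta, 0 <= t ->
          char_fun (L t) theta = cexp (t%:C%C * levy_exponent nu theta)].

(* The triple ((a, s), t) stands for a times the indicator of ]s, t], s <= t. *)
Definition step := seq (R * R * R).

Definition wf_step (phi : step) : bool := all (fun p => p.1.2 <= p.2) phi.

Definition step_fun (phi : step) (x : R) : R :=
  \sum_(p <- phi) p.1.1 * \1_(`]p.1.2, p.2]) x.

Definition step_integral L (phi : step) (w : Omega) : R :=
  \sum_(p <- phi) p.1.1 * (L p.2 w - L p.1.2 w).

Definition square_integrable (f : R -> R) : Prop :=
  measurable_fun setT f /\
  (\int[@lebesgue_measure R]_x (f x ^+ 2)%:E < +oo)%E.

(* I is (a version of) the integral of f against L: an L^2(Omega) limit of
   integrals of step functions converging to f in L^2(R).  By the isometry for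
   step functions it is unique up to almost sure equality. *)
Definition is_wiener_integral L (f : R -> R) (I : Omega -> R) : Prop :=
  [/\ square_integrable f,
      measurable_fun setT I &
      exists phi : nat -> step,
        [/\ forall n, wf_step (phi n),
            (\int[@lebesgue_measure R]_x ((f x - step_fun (phi n) x) ^+ 2)%:E
              @[n --> \oo] --> 0)%E &
            ('E_P[fun w => ((I w - step_integral L (phi n) w) ^+ 2)%R]
              @[n --> \oo] --> 0)%E]].

Definition Gamma (a : R) : R :=
  \int[@lebesgue_measure R]_(u in `]0, +oo[) (u `^ (a - 1) * expR (- u)).

Definition pos_part (x : R) : R := Num.max x 0.

(* powR is not used alone since 0 `^ 0 = 1. *)
Definition pos_pow (x p : R) : R := if 0 < x then x `^ p else 0.

Definition tflp_kernel (d lambda t x : R) : R :=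
  expR (- lambda * pos_part (t - x)) * pos_pow (t - x) d -
  expR (- lambda * pos_part (- x)) * pos_pow (- x) d.

(* The integrals are defined up to null sets, so this is a property of S that
   is stable under modifications. *)
Definition is_tflp L (d lambda : R) S : Prop :=
  forall t, exists2 I, is_wiener_integral L (tflp_kernel d lambda t) I &
    S t = (fun w => (Gamma (1 + d))^-1 * I w).

Definition holder_quotients (f : R -> R) (d T k : R) : set (\bar R) :=
  [set y | exists s t, [/\ 0 < `|s - t| < k, `|s| <= T, `|t| <= T &
    y = (`|f t - f s| / `|s - t| `^ d)%:E]].

(* The constant C is random, as in the usual notion of local Hoelder continuity
   of sample paths.  It cannot be deterministic: a jump of L of size J at time
   x makes t |-> S t w - S x w equivalent to J (t - x)_+^d / Gamma (1 + d) as
   t decreases to x, and the jumps of L on a bounded interval need not be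
   bounded in w. *)
Definition locally_holder (d : R) S : Prop :=
  forall T : R, 0 < T ->
  exists kT C : {RV P >-> R},
    let E := [set w | (ereal_sup (holder_quotients (S ^~ w) d T (kT w))
                       <= (C w)%:E)%E] in
    [/\ {ae P, forall w, 0 < kT w}, forall w, 0 < C w,
        measurable E & P E = 1%E].

Definition holds_with_positive_probability (Q : Omega -> Prop) : Prop :=
  exists E : set Omega, [/\ measurable E, (0 < P E)%E & forall w, E w -> Q w].

(* Unboundedness is local, i.e. on some compact time interval; it implies
   unboundedness over the whole line. *)
Definition discontinuous_unbounded (f : R -> R) : Prop :=
  ~ continuous f /\
  exists2 T : R, 0 < T & ~ [bounded f t | t in `[- T, T]].

End processes.

(* Main.v *)
(* (a) With g(u) = exp(- lambda u) u^d and g' its derivative, integration by parts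
   suggests S t = c * int (g'(t - x) - g'(- x)) L(x) dx, a pathwise integral since g' is
   integrable. It equals the Wiener integral almost surely: L(x) has the same
   covariance as sqrt v * (1_{z <= x} - 1_{z <= 0}) in L^2(dz), the integral of that
   deterministic field against the same kernel is sqrt v times the TFLP kernel, and
   the L^2 distance to a step integral depends on the covariance only.
   For |s|, |t| <= T the increment of g' splits into two singular pieces of mass
   O(|t - s|^d), seen by a bounded portion of the path, and a tail O(|t - s|^d)
   seen by the weighted norm of the path, which is finite almost surely.

   (b) Comparing the moments of 1 - cos(theta L(h)) for small h gives
   P(|L(h)| > eps) >= c h. On a fine grid, some increment over a cell where the
   step kernel exceeds M is larger than eps with probability bounded below; by
   symmetry and independence the sign of the first such increment can be flipped, so
   with at least half of that probability |S| exceeds M eps at a grid time. The kernel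
   explodes, so M is arbitrary and the supremum of |S| over the grids is infinite
   with positive probability. *)
Require Import Defs.
From HB Require Import structures.
From mathcomp Require Import all_boot all_order all_algebra.
From mathcomp Require Import all_classical all_reals all_analysis.
From mathcomp Require Import complex measurable_realfun.
From mathcomp Require Import ring lra.

Set Implicit Arguments.
Unset Strict Implicit.
Unset Printing Implicit Defensive.

Import Order.TTheory GRing.Theory Num.Theory.
Import numFieldNormedType.Exports.

Local Open Scope classical_set_scope.
Local Open Scope ring_scope.

(** * Elementary bounds for sine, cosine and the exponential *)

Section trigonometric_bounds.
Context {R : realType}.
Implicit Types x y a b : R.

(** Three obstacles shape the proof. The second moment of [L] is given only through its
    characteristic function and the Levy measure, so square integrability and the linear growth of
    the variance have to be derived. A Wiener integral is a mere L^2 limit of step integrals and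
    says nothing about paths: in (b) all estimates are made for step integrals on finite grids, and
    they survive the limit because their lower bound (1 - exp(- c / 2)) / 4 depends neither on the
    level M nor on the grid. The part of a step integral that does not involve the chosen increment
    is not controlled at all; the sign flip works whatever its size. In (a), [two_sided] takes left
    limits at negative times, which is awkward for joint measurability in time and w; as a Levy
    process has no jump at a fixed time, [L] is replaced by the modification that reads [L2]
    itself. *)

Lemma MVT0 (f df : R -> R) x : (forall z : R, is_derive z 1 f (df z)) ->
  exists2 c, `|c| <= `|x| & f x - f 0 = df c * x.
Proof.
move=> fd; have fc : continuous f.
  by move=> z; apply/differentiable_continuous/derivable1_diffP/(@ex_derive _ _ _ _ _ _ _ (fd z)).
have [x0|/ltW x0] := leP 0 x.
  have [c /[!in_itv]/= /andP[c0 cx] ->] := MVT_segment x0 (fun z _ => fd z) (continuous_subspaceT fc).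
  by exists c; rewrite ?subr0// !ger0_norm.
have [c /[!in_itv]/= /andP[c0 cx] e] := MVT_segment x0 (fun z _ => fd z) (continuous_subspaceT fc).
exists c; first by rewrite !ler0_norm// lerN2.
by rewrite -[LHS]opprB e sub0r mulrN opprK.
Qed.

Lemma norm_sin_le x : `|sin x| <= `|x|.
Proof.
have [c _] := MVT0 x (@is_derive_sin R); rewrite sin0 subr0 => ->.
by rewrite normrM ler_piMl// cos_max.
Qed.

Lemma one_sub_cosE x : 1 - cos x = 2 * sin (x / 2) ^+ 2.
Proof.
rewrite [in LHS](_ : x = (x / 2) *+ 2); last by rewrite -mulr_natr divfK.
by rewrite cos_mulr2n sin2cos2 -mulr_natl; ring.
Qed.

Lemma one_sub_cos_ge0 x : 0 <= 1 - cos x.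
Proof. by rewrite subr_ge0 cos_le1. Qed.

Lemma one_sub_cos_le x : 1 - cos x <= x ^+ 2 / 2.
Proof.
rewrite one_sub_cosE -(real_normK (num_real (sin _))).
have := norm_sin_le (x / 2); rewrite -(@ler_pXn2r _ 2) ?nnegrE//.
by rewrite !real_normK ?num_real// => h; lra.
Qed.

(** A quadratic bound rather than the cubic one, to match the second moment of the Levy measure. By
    the mean value theorem the ratio to x is [cos c - 1], and |1 - cos c| <= |c| <= |x|. *)
Lemma sub_sin_le x : `|sin x - x| <= x ^+ 2.
Proof.
have fd (z : R) : is_derive z 1 (fun z => sin z - z) (cos z - 1).
  exact: is_deriveB.
have [c cx] := MVT0 x fd; rewrite sin0 !subr0 => ->.
have -> : x ^+ 2 = `|x| * `|x| by rewrite -expr2 real_normK ?num_real.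
rewrite normrM.
rewrite ler_wpM2r// distrC ger0_norm ?one_sub_cos_ge0//.
have [d dc] := MVT0 c (@is_derive_cos R); rewrite cos0 -opprB => /eqP.
rewrite eqr_oppLR mulNr opprK => /eqP ->.
apply: le_trans cx; rewrite (le_trans (ler_norm _))// normrM ler_piMl//.
exact: sin_max.
Qed.

(** Here 1 - cos x = 2 sin(x/2)^2 and sin(x/2) = (x/2) cos c with |c| <= 1/2. Then 1 - cos c <= 1/8,
    so cos c >= 7/8 and cos(c)^2 >= 1/2. *)
Lemma one_sub_cos_ge x : `|x| <= 1 -> x ^+ 2 / 4 <= 1 - cos x.
Proof.
move=> x1; rewrite one_sub_cosE.
have [c cx] := MVT0 (x / 2) (@is_derive_sin R); rewrite sin0 subr0 => ->.
have c2 : c ^+ 2 <= 1 / 4.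
  rewrite -(real_normK (num_real c)).
  have cx' : `|c| <= 1 / 2.
    by rewrite (le_trans cx)// normrM (@ger0_norm _ 2^-1)// ler_pM2r.
  have := ler_pM (normr_ge0 _) (normr_ge0 _) cx' cx'; rewrite -expr2.
  by move=> /le_trans; apply; lra.
have h := one_sub_cos_le c.
have cc : 7 / 8 <= cos c by lra.
rewrite exprMn; have -> : x ^+ 2 / 4 = 2 * (1 / 2 * (x / 2) ^+ 2) by field.
rewrite ler_pM2l// ler_wpM2r ?sqr_ge0//.
nra.
Qed.

(** The left side is the real part of 1 - exp(- a + i b), the form in which the characteristic
    function of an increment enters. *)
Lemma one_sub_expRN_cos_le a b : 0 <= a ->
  1 - expR (- a) * cos b <= a + b ^+ 2 / 2.
Proof.
move=> a0; have -> : 1 - expR (- a) * cos b =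
   (1 - expR (- a)) + expR (- a) * (1 - cos b) by ring.
apply: lerD; first by have := expR_ge1Dx (- a); lra.
rewrite (le_trans _ (one_sub_cos_le b))// ler_piMl ?one_sub_cos_ge0//.
by rewrite expR_le1 oppr_le0.
Qed.

(** After multiplication by [expR a >= 1 + a], the claim follows from (1 - a + a^2)(1 + a) = 1 + a^3
    >= 1. *)
Lemma expRN_le a : 0 <= a -> expR (- a) <= 1 - a + a ^+ 2.
Proof.
move=> a0; rewrite expRN -(ler_pM2r (expR_gt0 a)) mulVf ?gt_eqF ?expR_gt0//.
apply: (@le_trans _ _ ((1 - a + a ^+ 2) * (1 + a))).
  have -> : (1 - a + a ^+ 2) * (1 + a) = 1 + a ^+ 3 by ring.
  by rewrite lerDl exprn_ge0.
rewrite ler_wpM2l ?expR_ge1Dx//.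
by have := sqr_ge0 (a - 1/2); nra.
Qed.

End trigonometric_bounds.

(** * Square-integrable functions and their second moments *)

Section square_integrable_functions.
Local Open Scope ereal_scope.
Context d (T : measurableType d) (R : realType) (mu : {measure set T -> \bar R}).
Implicit Types f g : T -> R.

Definition L2fun f :=
  measurable_fun setT f /\ \int[mu]_x (f x ^+ 2)%:E < +oo.

Lemma L2_sqr_integrable f : L2fun f ->
  mu.-integrable setT (fun x => (f x ^+ 2)%:E).
Proof.
move=> [mf f2]; apply/integrableP; split.
  by apply/measurable_EFinP; exact: measurable_funX.
by under eq_integral do rewrite gee0_abs ?lee_fin ?sqr_ge0//.
Qed.

Lemma L2_mul_integrable f g : L2fun f -> L2fun g ->
  mu.-integrable setT (fun x => (f x * g x)%:E).
Proof.
move=> Lf Lg.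
apply: (@le_integrable _ _ _ mu setT measurableT _
  (fun x => (f x ^+ 2)%:E + (g x ^+ 2)%:E)).
- by apply/measurable_EFinP; apply: measurable_funM; [case: Lf|case: Lg].
- move=> x _; rewrite -EFinD /= !lee_fin [leRHS]ger0_norm ?addr_ge0 ?sqr_ge0// ler_norml.
  apply/andP; split.
    by have := sqr_ge0 (f x + g x)%R; have := sqr_ge0 (f x); have := sqr_ge0 (g x); nra.
  by have := sqr_ge0 (f x - g x)%R; have := sqr_ge0 (f x); have := sqr_ge0 (g x); nra.
- by apply: integrableD => //; exact: L2_sqr_integrable.
Qed.

Lemma L2Z (k : R) f : L2fun f -> L2fun (fun x => k * f x)%R.
Proof.
move=> Lf; split; first by apply: measurable_funM => //; case: Lf.
have := integrableZl measurableT (k ^+ 2) (L2_sqr_integrable Lf).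
move=> /integrableP[_]; apply: le_lt_trans.
apply: ge0_le_integral => //.
- by move=> x _; rewrite lee_fin sqr_ge0.
- apply/measurable_EFinP/measurable_funX/measurable_funM => //; by case: Lf.
- apply: measurableT_comp => //; apply/measurable_EFinP/measurable_funM => //.
  by apply: measurable_funX; case: Lf.
- by move=> x _; rewrite -EFinM lee_fin exprMn ler_norm.
Qed.

Lemma L2D f g : L2fun f -> L2fun g -> L2fun (fun x => f x + g x)%R.
Proof.
move=> Lf Lg; split; first by apply: measurable_funD; [case: Lf|case: Lg].
have h : mu.-integrable setT (fun x => 2%:E * ((f x ^+ 2)%:E + (g x ^+ 2)%:E)).
  by apply: integrableZl => //; apply: integrableD => //; exact: L2_sqr_integrable.
move: (h) => /integrableP[mh]; apply: le_lt_trans.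
apply: ge0_le_integral => //.
- by move=> x _; rewrite lee_fin sqr_ge0.
- by apply/measurable_EFinP/measurable_funX/measurable_funD; [case: Lf|case: Lg].
- exact: measurableT_comp.
- move=> x _; rewrite -EFinD -EFinM lee_fin (le_trans _ (ler_norm _))//.
  by have := sqr_ge0 (f x - g x)%R; nra.
Qed.

Lemma L2N f : L2fun f -> L2fun (fun x => - f x)%R.
Proof.
by move=> /(L2Z (-1)); congr L2fun; apply/funext => x; rewrite mulN1r.
Qed.

Lemma L2B f g : L2fun f -> L2fun g -> L2fun (fun x => f x - g x)%R.
Proof. by move=> Lf /L2N; exact: L2D. Qed.

Lemma L20 : L2fun (fun=> 0%R).
Proof.
split; first exact: measurable_cst.
by rewrite integral0_eq// => x _; rewrite expr0n.
Qed.

Lemma L2_sum I (s : seq I) (F : I -> T -> R) : (forall i, L2fun (F i)) ->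
  L2fun (fun x => \sum_(i <- s) F i x)%R.
Proof.
move=> LF; elim: s => [|i s IH].
  by under eq_fun do rewrite big_nil; exact: L20.
by under eq_fun do rewrite big_cons; exact: L2D.
Qed.

(** The norm of a linear combination is a function of the Gram matrix; two families with equal Gram
    matrices are compared through this formula. *)
Lemma integral_sqr_sum I (s : seq I) (c : I -> R) (F : I -> T -> R) :
  (forall i, L2fun (F i)) ->
  \int[mu]_x ((\sum_(i <- s) c i * F i x) ^+ 2)%:E =
  (\sum_(i <- s) \sum_(j <- s) c i * c j * \int[mu]_x (F i x * F j x))%R%:E.
Proof.
move=> LF.
under eq_integral do rewrite expr2 mulr_suml -sumEFin.
rewrite integral_sum//=; last first.
  move=> i; under eq_fun do rewrite mulrC.
  apply: L2_mul_integrable; last exact/L2Z.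
  by apply: L2_sum => j; exact/L2Z.
rewrite -sumEFin; apply: eq_bigr => i _.
under eq_integral do rewrite mulr_sumr -sumEFin.
rewrite integral_sum//=; last first.
  by move=> j; apply: L2_mul_integrable; exact/L2Z.
rewrite -sumEFin; apply: eq_bigr => j _.
under eq_integral do rewrite mulrACA EFinM.
rewrite integralZl//; last exact: L2_mul_integrable.
rewrite [RHS]EFinM /Rintegral fineK//; apply: integrable_fin_num => //.
exact: L2_mul_integrable.
Qed.

End square_integrable_functions.

Section measurability_of_trigonometric_functions.
Context {R : realType}.

Lemma measurable_cos : measurable_fun setT (@cos R).
Proof. by apply: continuous_measurable_fun; exact: continuous_cos. Qed.

Lemma measurable_sin : measurable_fun setT (@sin R).
Proof. by apply: continuous_measurable_fun; exact: continuous_sin. Qed.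

End measurability_of_trigonometric_functions.

Lemma measurable_norm_gt d (T : measurableType d) (R : realType) (f : T -> R) (e : R) :
  measurable_fun setT f -> measurable [set w | e < `|f w|].
Proof.
move=> mf; rewrite -[X in measurable X]setTI (_ : [set w | _] = (fun w => `|f w|) @^-1` `]e, +oo[%classic).
  by apply: (measurableT_comp _ mf) => //; exact: measurable_itv.
by apply/seteqP; split=> x /=; rewrite in_itv/= andbT.
Qed.

Lemma measurable_ge d (T : measurableType d) (R : realType) (f : T -> R) (e : R) :
  measurable_fun setT f -> measurable [set w | e <= f w].
Proof.
move=> mf; rewrite -[X in measurable X]setTI (_ : [set w | _] = f @^-1` `[e, +oo[%classic).
  by apply: mf => //; exact: measurable_itv.
by apply/seteqP; split=> x /=; rewrite in_itv/= andbT.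
Qed.

Lemma measurable_ler_nat d (T : measurableType d) (R : realType) (f g : T -> R) :
  measurable_fun setT f -> measurable_fun setT g ->
  measurable_fun setT (fun x => (f x <= g x)%R%:R : R).
Proof.
move=> mf mg; rewrite (_ : (fun x => _) = (fun x => if f x <= g x then 1 else 0)); last first.
  by apply/funext => x; case: ifP.
by apply: measurable_fun_ifT => //; exact: measurable_fun_ler.
Qed.

Section probability_L2.
Local Open Scope ereal_scope.
Context d (T : measurableType d) (R : realType) (P : probability T R).

Lemma L2_cst (r : R) : L2fun P (fun=> r).
Proof.
split; first exact: measurable_cst.
rewrite (_ : (fun x : T => (r ^+ 2)%:E) = cst (r ^+ 2)%:E)//.
by rewrite integral_cst// [X in _ * X](_ : _ = 1) ?mule1 ?ltry//; exact: probability_setT.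
Qed.

Lemma L2_integrable (f : T -> R) : L2fun P f -> P.-integrable setT (fun w => (f w)%:E).
Proof.
move=> Lf; have := L2_mul_integrable Lf (L2_cst 1).
by under eq_fun do rewrite mulr1.
Qed.

End probability_L2.

Section second_moment.
Local Open Scope ereal_scope.
Context d (T : measurableType d) (R : realType) (P : probability T R).
Implicit Types X : T -> R.

(* [1 - cos y >= y^2 / 4] for [|y| <= 1]; the truncation at [n.+1] is removed by monotone convergence. *)
Lemma second_moment_le X (K : R) : measurable_fun setT X ->
  (forall n, \int[P]_w (1 - cos (n.+1%:R^-1 * X w))%:E
     <= (K * n.+1%:R^-1 ^+ 2)%:E) ->
  \int[P]_w (X w ^+ 2)%:E <= (4 * K)%:E.
Proof.
move=> mX hK.
pose f n w := (X w ^+ 2 * \1_(X @^-1` [set y | (`|y| <= n.+1%:R)%R]) w)%:E.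
have mB n : measurable (X @^-1` [set y | (`|y| <= n.+1%:R)%R]).
  rewrite -[X in measurable X]setTI; apply: mX => //.
  rewrite [X in measurable X](_ : _ = `[(- n.+1%:R)%R, n.+1%:R%R]%classic).
    exact: measurable_itv.
  by apply/seteqP; split=> y /=; rewrite in_itv/= ler_norml.
have mf n : measurable_fun setT (f n).
  by apply/measurable_EFinP/measurable_funM => //; exact: measurable_funX.
have f0 n x : setT x -> 0 <= f n x.
  by move=> _; rewrite lee_fin mulr_ge0// sqr_ge0.
have ndf x : setT x -> {homo f ^~ x : n m / (n <= m)%N >-> n <= m}.
  move=> _ n m nm; rewrite lee_fin ler_wpM2l ?sqr_ge0// !indicE.
  case: (boolP (x \in _)) => [|_] //; rewrite !inE/= => xn.
  by rewrite mem_set//= (le_trans xn)// ler_nat.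
have fn n : \int[P]_w f n w <= (4 * K)%:E.
  have n0 : (n.+1%:R : R) != 0%R by rewrite pnatr_eq0.
  apply: (@le_trans _ _ (\int[P]_w ((4 * n.+1%:R ^+ 2)%:E * (1 - cos (n.+1%:R^-1 * X w))%:E))).
    apply: ge0_le_integral => //.
    - by move=> w; exact: f0.
    - apply/measurable_EFinP/measurable_funM => //; apply: measurable_funB => //.
      apply: measurableT_comp => //; first exact: measurable_cos.
      exact: measurable_funM.
    - move=> w _; rewrite -EFinM lee_fin indicE.
      case: (boolP (w \in _)) => [|_]; last first.
        by rewrite mulr0 !mulr_ge0 ?sqr_ge0 ?one_sub_cos_ge0.
      rewrite inE/= mulr1 => xn.
      have /one_sub_cos_ge : (`|n.+1%:R^-1 * X w| <= 1)%R.
        by rewrite normrM (@ger0_norm _ n.+1%:R^-1) ?invr_ge0// ler_pdivrMl ?mulr1 ?ltr0n.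
      rewrite exprMn exprVn => h.
      rewrite -mulrA -ler_pdivrMl//; rewrite mulrC.
      have -> : (X w ^+ 2 / 4 = n.+1%:R ^+ 2 * (n.+1%:R ^- 2 * X w ^+ 2 / 4))%R by field.
      by rewrite ler_wpM2l// sqr_ge0.
  have c0 w : setT w -> 0 <= (1 - cos (n.+1%:R^-1 * X w))%:E.
    by move=> _; rewrite lee_fin one_sub_cos_ge0.
  have mc : measurable_fun setT (fun w => (1 - cos (n.+1%:R^-1 * X w))%:E).
    apply/measurable_EFinP; apply: measurable_funB => //.
    apply: measurableT_comp => //; first exact: measurable_cos.
    exact: measurable_funM.
  have n4 : (0 <= 4 * n.+1%:R ^+ 2 :> R)%R by rewrite mulr_ge0// sqr_ge0.
  rewrite ge0_integralZl_EFin//.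
  apply: le_trans.
    by apply: lee_pmul (hK n); rewrite ?lee_fin ?mulr_ge0 ?sqr_ge0// integral_ge0// => w _; rewrite lee_fin one_sub_cos_ge0.
  by rewrite -EFinM lee_fin le_eqVlt; apply/orP; left; apply/eqP; field.
have := cvg_monotone_convergence (mu := P) measurableT mf f0 ndf.
under eq_integral => w _.
  have -> : limn (f ^~ w) = (X w ^+ 2)%:E.
    apply/cvg_lim => //; apply: cvg_near_cst.
    have [N hN] : exists N, (`|X w| <= N.+1%:R)%R.
      by exists (Num.truncn `|X w|); rewrite ltW// truncnS_gt.
    exists N => // n /= Nn; rewrite /f indicE mem_set ?mulr1//=.
    by rewrite (le_trans hN)// ler_nat ltnS.
  over.
by move=> h; apply: (cvge_le _ h); exact: nearW.
Qed.

End second_moment.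

(** * Independence of two maps *)

Section independence.
Local Open Scope ereal_scope.
Context d1 d2 d (T : measurableType d) (T1 : measurableType d1)
  (T2 : measurableType d2) (R : realType) (P : probability T R).

Definition independent_maps (X : T -> T1) (Y : T -> T2) :=
  forall A B, measurable A -> measurable B ->
    P (X @^-1` A `&` Y @^-1` B) = P (X @^-1` A) * P (Y @^-1` B).

Lemma independent_maps_law (X : {mfun T >-> T1}) (Y : {mfun T >-> T2}) (XY : {mfun T >-> (T1 * T2)%type}) :
  (XY : T -> _) = (fun w => (X w, Y w)) -> independent_maps X Y ->
  forall E, measurable E ->
  (distribution P X \x distribution P Y) E = distribution P XY E.
Proof.
move=> XYE ind E mE.
apply: product_measure_unique => // A B mA mB.
by transitivity (P (XY @^-1` (A `*` B))) => //; rewrite XYE; exact: ind.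
Qed.

(** The law of an independent pair is the product of its marginals, so a component may be replaced
    by another one with the same law. It is applied to an increment and its opposite. *)
Lemma independent_maps_same_law (X X' : T -> T1) (Y : T -> T2) :
  measurable_fun setT X -> measurable_fun setT X' -> measurable_fun setT Y ->
  independent_maps X Y -> independent_maps X' Y ->
  (forall A, measurable A -> P (X @^-1` A) = P (X' @^-1` A)) ->
  forall E, measurable E ->
  P [set w | E (X w, Y w)] = P [set w | E (X' w, Y w)].
Proof.
move=> mX mX' mY ind ind' XX' E mE.
have mXY : measurable_fun setT (fun w => (X w, Y w)) by exact/measurable_fun_pair.
have mXY' : measurable_fun setT (fun w => (X' w, Y w)) by exact/measurable_fun_pair.
pose fX : {mfun T >-> T1} := mfun_Sub (mem_set mX).
pose fX' : {mfun T >-> T1} := mfun_Sub (mem_set mX').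
pose fY : {mfun T >-> T2} := mfun_Sub (mem_set mY).
pose fXY : {mfun T >-> (T1 * T2)%type} := mfun_Sub (mem_set mXY).
pose fXY' : {mfun T >-> (T1 * T2)%type} := mfun_Sub (mem_set mXY').
transitivity (distribution P fXY E) => //.
transitivity (distribution P fXY' E) => //.
rewrite -(@independent_maps_law fX fY)// -(@independent_maps_law fX' fY)//.
apply: product_measure_unique => // A B mA mB.
transitivity (distribution P fX' A * distribution P fY B).
  exact: product_measure1E.
by congr (_ * _); apply/esym; exact: XX'.
Qed.

End independence.

Section independent_product.
Local Open Scope ereal_scope.
Context d (T : measurableType d) (R : realType) (P : probability T R).

(** Fubini for the product of the two laws: the inner integral in the centred variable already
    vanishes. *)
Lemma independent_mul0 (X Y : T -> R) :
  L2fun P X -> L2fun P Y -> \int[P]_w (Y w)%:E = 0 ->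
  independent_maps P X Y ->
  \int[P]_w (X w * Y w)%:E = 0.
Proof.
move=> LX LY Y0 ind.
have mX : measurable_fun setT X by case: LX.
have mY : measurable_fun setT Y by case: LY.
have mXY : measurable_fun setT (fun w => (X w, Y w)) by exact/measurable_fun_pair.
pose fX : {mfun T >-> R} := mfun_Sub (mem_set mX).
pose fY : {mfun T >-> R} := mfun_Sub (mem_set mY).
pose fXY : {mfun T >-> (R * R)%type} := mfun_Sub (mem_set mXY).
have law := @independent_maps_law _ _ _ _ _ _ _ _ fX fY fXY erefl ind.
pose g (z : R * R) := (z.1 * z.2)%:E.
have mg : measurable_fun setT g.
  apply/measurable_EFinP; apply: measurable_funM; [exact: measurable_fst|exact: measurable_snd].
have ig : P.-integrable setT (g \o fXY) by exact: L2_mul_integrable.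
transitivity (\int[distribution P fXY]_z g z).
  by rewrite integral_distribution.
have ig' : (distribution P fX \x distribution P fY).-integrable setT g.
  have /integrableP[_ h] := integrable_pushforward (phi := fXY) mXY mg ig measurableT.
  apply/integrableP; split => //.
  rewrite (eq_measure_integral (distribution P fXY))// => E mE _.
  exact: law.
transitivity (\int[distribution P fX \x distribution P fY]_z g z).
  by apply: eq_measure_integral => E mE _; exact/esym/law.
rewrite -integral12_prod_meas1//; apply: integral0_eq => x _.
rewrite /fubini_F /g/=; under eq_integral do rewrite EFinM.
have iY : P.-integrable setT (EFin \o Y).
  exact: L2_integrable.
have mE : measurable_fun setT (@EFin R) by exact/measurable_EFinP.
rewrite integralZl//; last first.
  exact: (integrable_pushforward (phi := fY) mY mE iY measurableT).
rewrite integral_distribution//.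
by rewrite [X in _ * X]Y0 mule0.
Qed.

End independent_product.

(** * Characteristic exponents *)

Section integral_tools.
Local Open Scope ereal_scope.
Context d (T : measurableType d) (R : realType) (mu : {measure set T -> \bar R}).

Lemma Rintegral_fineK (f : T -> R) : mu.-integrable setT (fun x => (f x)%:E) ->
  (\int[mu]_x f x)%R%:E = \int[mu]_x (f x)%:E.
Proof. by move=> fi; rewrite /Rintegral fineK//; exact: integrable_fin_num. Qed.

Lemma ge0_integrable (f : T -> R) (K : R) : measurable_fun setT f ->
  (forall x, 0 <= f x)%R -> \int[mu]_x (f x)%:E <= K%:E ->
  mu.-integrable setT (fun x => (f x)%:E).
Proof.
move=> mf f0 fK; apply/integrableP; split; first exact/measurable_EFinP.
under eq_integral do rewrite gee0_abs ?lee_fin//.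
exact: le_lt_trans fK (ltry _).
Qed.

Lemma le_integrable_EFin (f g : T -> R) : measurable_fun setT f ->
  (forall x, `|f x| <= g x)%R -> mu.-integrable setT (fun x => (g x)%:E) ->
  mu.-integrable setT (fun x => (f x)%:E).
Proof.
move=> mf fg; apply: le_integrable => //; first exact/measurable_EFinP.
by move=> x _; rewrite lee_fin (le_trans (fg x))// ler_norm.
Qed.

Lemma ge0_le_integral_EFin (f g : T -> R) : measurable_fun setT f -> measurable_fun setT g ->
  (forall x, 0 <= f x)%R -> (forall x, f x <= g x)%R ->
  \int[mu]_x (f x)%:E <= \int[mu]_x (g x)%:E.
Proof.
move=> mf mg f0 fg; apply: ge0_le_integral => //; try exact/measurable_EFinP.
- by move=> x _; rewrite lee_fin.
- by move=> x _; rewrite lee_fin.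
Qed.

Lemma ge0_integral_linear (a b : R) (f g : T -> R) : (0 <= a)%R -> (0 <= b)%R ->
  measurable_fun setT f -> measurable_fun setT g ->
  (forall x, 0 <= f x)%R -> (forall x, 0 <= g x)%R ->
  \int[mu]_x (a * f x + b * g x)%:E = a%:E * \int[mu]_x (f x)%:E + b%:E * \int[mu]_x (g x)%:E.
Proof.
move=> a0 b0 mf mg f0 g0.
have Z (c : R) (h : T -> R) : (0 <= c)%R -> measurable_fun setT h -> (forall x, 0 <= h x)%R ->
    \int[mu]_x (c * h x)%:E = c%:E * \int[mu]_x (h x)%:E.
  move=> c0 mh h0; under eq_integral do rewrite EFinM.
  by rewrite ge0_integralZl_EFin//; [move=> x _; rewrite lee_fin|exact/measurable_EFinP].
under eq_integral do rewrite EFinD.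
rewrite ge0_integralD// ?Z//.
- by move=> x _; rewrite lee_fin mulr_ge0.
- by apply/measurable_EFinP; exact: measurable_funM.
- by move=> x _; rewrite lee_fin mulr_ge0.
- by apply/measurable_EFinP; exact: measurable_funM.
Qed.

Lemma sqr_integral_le0 (f : T -> R) : measurable_fun setT f ->
  \int[mu]_x (f x ^+ 2)%:E <= 0 -> {ae mu, forall x, f x = 0%R}.
Proof.
move=> mf f0; have : \int[mu]_x `|(f x ^+ 2)%:E| = 0.
  under eq_integral do rewrite gee0_abs ?lee_fin ?sqr_ge0//.
  by apply/eqP; rewrite eq_le f0 integral_ge0// => x _; rewrite lee_fin sqr_ge0.
move/(ae_eq_integral_abs _ measurableT ((measurable_EFinP _ _).2 (measurable_funX 2 mf))).
by apply: filterS => x /(_ I) /= [] /eqP; rewrite sqrf_eq0 => /eqP.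
Qed.

End integral_tools.

(** Pointwise, X^2 is at most min(X^2, 1) plus X^2 restricted to |X| > 1. *)
Lemma truncated_sqr_integrable d (T : measurableType d) {R : realType} (nu : {measure set T -> \bar R})
    (X : T -> R) : measurable_fun setT X ->
  (\int[nu]_x (Num.min (`|X x| ^+ 2) 1)%:E < +oo)%E ->
  (\int[nu]_(x in [set x | (1 < `|X x|)%R]) (X x ^+ 2)%:E < +oo)%E ->
  nu.-integrable setT (fun x => (X x ^+ 2)%:E).
Proof.
move=> mX n1 n2.
have m1 : measurable_fun setT (fun x => Num.min (`|X x| ^+ 2) 1).
  by apply: measurable_minr => //; apply: measurable_funX; exact: measurableT_comp.
have mB : measurable [set x : T | 1 < `|X x|] by exact: measurable_norm_gt.
apply/integrableP; split; first by apply/measurable_EFinP; exact: measurable_funX.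
under eq_integral do rewrite gee0_abs ?lee_fin ?sqr_ge0//.
apply: (@le_lt_trans _ _ (\int[nu]_x ((Num.min (`|X x| ^+ 2) 1)%:E + ((X x ^+ 2) * \1_[set x | 1 < `|X x|] x)%:E)))%E.
  apply: ge0_le_integral => //.
  - by move=> x _; rewrite lee_fin sqr_ge0.
  - by apply/measurable_EFinP; exact: measurable_funX.
  - apply: emeasurable_funD; first exact/measurable_EFinP.
    by apply/measurable_EFinP/measurable_funM => //; exact: measurable_funX.
  - move=> x _; rewrite -EFinD lee_fin indicE.
    have [x1|x1] := ltP 1 `|X x|.
      by rewrite mem_set// mulr1 lerDr le_min exprn_ge0//= ler01.
    rewrite memNset/= ?mulr0 ?addr0; last by apply/negP; rewrite -leNgt.
    rewrite real_normK ?num_real// le_min lexx/=.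
    by rewrite -(real_normK (num_real (X x))) expr_le1.
rewrite ge0_integralD//; last 3 first.
- exact/measurable_EFinP.
- by move=> x _; rewrite lee_fin mulr_ge0// sqr_ge0.
- by apply/measurable_EFinP/measurable_funM => //; exact: measurable_funX.
- rewrite lte_add_pinfty//; move: n2; rewrite integral_mkcond.
  congr (_ < _)%E; apply: eq_integral => x _; rewrite /patch indicE.
  by case: ifPn => _; rewrite ?mulr1 ?mulr0.
Qed.

(** The square of 1 - cos is a combination of values of 1 - cos, so its integral can be read off a
    characteristic function at theta and 2 theta. Being of order x^4 near 0, it is hardly affected
    by small values of x. *)
Lemma sqr_one_sub_cosE {R : realType} (theta x : R) : (1 - cos (theta * x)) ^+ 2 =
  2 * (1 - cos (theta * x)) - 1 / 2 * (1 - cos (2 * theta * x)).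
Proof.
have -> : 2 * theta * x = (theta * x) *+ 2 by rewrite -[RHS]mulr_natl; ring.
by rewrite cos_mulr2n -mulr_natl; field.
Qed.

Section levy_exponent_bounds.
Context d (T : measurableType d) {R : realType} (nu : {measure set T -> \bar R}).
Variable X : T -> R.
Hypothesis mX : measurable_fun setT X.
Hypothesis X2 : nu.-integrable setT (fun x => (X x ^+ 2)%:E).

Let s : R := \int[nu]_x (X x ^+ 2).
Let re (theta : R) : R := \int[nu]_x (cos (theta * X x) - 1).
Let im (theta : R) : R := \int[nu]_x (sin (theta * X x) - theta * X x).

Let mcos theta : measurable_fun setT (fun x => cos (theta * X x)).
Proof. by apply: measurableT_comp; [exact: measurable_cos|exact: measurable_funM]. Qed.

Let msin theta : measurable_fun setT (fun x => sin (theta * X x)).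
Proof. by apply: measurableT_comp; [exact: measurable_sin|exact: measurable_funM]. Qed.

Lemma integrable_one_sub_cos theta :
  nu.-integrable setT (fun x => (1 - cos (theta * X x))%:E).
Proof.
apply: (@le_integrable_EFin _ _ _ _ _ (fun x => theta ^+ 2 / 2 * X x ^+ 2)).
- exact: measurable_funB.
- move=> x; rewrite ger0_norm ?one_sub_cos_ge0// (le_trans (one_sub_cos_le _))//.
  by rewrite exprMn mulrAC.
- under eq_fun do rewrite EFinM.
  by apply: integrableZl => //; exact: X2.
Qed.

Lemma levy_exponent_reE theta : (- re theta)%:E = (\int[nu]_x (1 - cos (theta * X x))%:E)%E.
Proof.
rewrite /re.
have e : (fun x => (cos (theta * X x) - 1)%:E) = (fun x => - (1 - cos (theta * X x))%:E)%E.
  by apply/funext => x; rewrite -EFinN opprB.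
rewrite EFinN Rintegral_fineK e; last by apply: integrableN; exact: integrable_one_sub_cos.
rewrite integralN ?oppeK//.
by apply: integrable_add_def => //; exact: integrable_one_sub_cos.
Qed.

Lemma levy_variance_ge0 : 0 <= s.
Proof. by apply: Rintegral_ge0 => x _; exact: sqr_ge0. Qed.

Lemma levy_exponent_re_ge0 theta : 0 <= - re theta.
Proof.
by rewrite -lee_fin levy_exponent_reE integral_ge0// => x _; rewrite lee_fin one_sub_cos_ge0.
Qed.

Lemma levy_exponent_re_le theta : - re theta <= theta ^+ 2 * s / 2.
Proof.
rewrite -lee_fin levy_exponent_reE mulrAC EFinM Rintegral_fineK; last exact: X2.
rewrite -integralZl//.
under [leRHS]eq_integral do rewrite -EFinM.
apply: ge0_le_integral_EFin.
- exact: measurable_funB.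
- by apply: measurable_funM => //; exact: measurable_funX.
- by move=> x; exact: one_sub_cos_ge0.
- by move=> x; rewrite (le_trans (one_sub_cos_le _))// exprMn mulrAC.
Qed.

Lemma integrable_sin_sub theta :
  nu.-integrable setT (fun x => (sin (theta * X x) - theta * X x)%:E).
Proof.
apply: (@le_integrable_EFin _ _ _ _ _ (fun x => theta ^+ 2 * X x ^+ 2)).
- by apply: measurable_funB => //; exact: measurable_funM.
- by move=> x; rewrite (le_trans (sub_sin_le _))// exprMn.
- under eq_fun do rewrite EFinM.
  by apply: integrableZl => //; exact: X2.
Qed.

Lemma levy_exponent_im_le theta : `|im theta| <= theta ^+ 2 * s.
Proof.
apply: le_trans.
  by apply: le_normr_Rintegral => //; exact: integrable_sin_sub.
rewrite -lee_fin Rintegral_fineK; last first.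
  exact: (integrable_abse (integrable_sin_sub theta)).
rewrite EFinM Rintegral_fineK; last exact: X2.
rewrite -integralZl//.
under [leRHS]eq_integral do rewrite -EFinM.
apply: ge0_le_integral_EFin => //.
- apply: measurableT_comp => //; apply: measurable_funB => //; exact: measurable_funM.
- by apply: measurable_funM => //; exact: measurable_funX.
- by move=> x; rewrite (le_trans (sub_sin_le _))// exprMn.
Qed.

(** The left side is the limit, as h decreases to 0, of E[(1 - cos(theta L(h)))^2] / h. *)
Lemma levy_exponent_re2 theta :
  (- 2 * re theta + re (2 * theta) / 2)%:E = (\int[nu]_x ((1 - cos (theta * X x)) ^+ 2)%:E)%E.
Proof.
under eq_integral do rewrite sqr_one_sub_cosE EFinB !EFinM.
have i1 := integrable_one_sub_cos theta; have i2 := integrable_one_sub_cos (2 * theta).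
rewrite integralB//; [|exact: integrableZl|exact: integrableZl].
rewrite !integralZl// -!levy_exponent_reE -!EFinM -EFinB.
by congr EFin; field.
Qed.

(** Otherwise 1 - cos(theta X) vanishes almost everywhere for every theta. Taking theta = 1/(n+1),
    the bound 1 - cos y >= y^2/4 for |y| <= 1 makes 0 < |X| <= n+1 negligible; with X = 0 these sets
    exhaust the space, against [nu setT != 0]. *)
Lemma exists_levy_exponent_gt0 : nu (X @^-1` [set 0]) = 0%E -> nu setT != 0%E ->
  exists theta, 0 < - 2 * re theta + re (2 * theta) / 2.
Proof.
move=> nuX0 nu0; apply: contrapT => /forallNP H.
pose F n : set T := X @^-1` [set x | x != 0 /\ `|x| <= n.+1%:R].
have mFn n : measurable (F n).
  rewrite -[F n]setTI; apply: mX => //.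
  rewrite (_ : [set x : R | _] = ~` [set 0] `&` [set x : R | `|x| <= n.+1%:R]); last first.
    by apply/seteqP; split=> x /= -[/eqP ? ?]; split=> //; exact/eqP.
  apply: measurableI; first exact: measurableC.
  rewrite (_ : [set _ | _] = `[(- n.+1%:R), n.+1%:R]%classic); first exact: measurable_itv.
  by apply/seteqP; split=> x /=; rewrite in_itv/= ler_norml.
have F0 n : nu (F n) = 0%E.
  have mc : measurable_fun setT (fun x => 1 - cos (n.+1%:R^-1 * X x)) by exact: measurable_funB.
  have [|N [mN N0 sN]] := sqr_integral_le0 (mu := nu) mc.
    by rewrite -levy_exponent_re2 lee_fin leNgt; exact/negP.
  apply: (subset_measure0 _ mN _ N0) => // x [x0 xn].
  apply: sN => /= c1.
  have : `|n.+1%:R^-1 * X x| <= 1.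
    by rewrite normrM ger0_norm ?invr_ge0// ler_pdivrMl ?mulr1 ?ltr0n.
  move=> /one_sub_cos_ge; rewrite c1 leNgt => /negP; apply.
  by rewrite divr_gt0// exprn_even_gt0//= mulf_neq0// invr_eq0 pnatr_eq0.
move/eqP: nu0; apply.
have -> : [set: T] = X @^-1` [set 0] `|` \bigcup_n F n.
  apply/seteqP; split=> // x _; have [x0|x0] := eqVneq (X x) 0; [by left|right].
  by exists (Num.truncn `|X x|) => //; split=> //; rewrite ltW// truncnS_gt.
apply/eqP; rewrite -measure_le0.
have mU : measurable (\bigcup_n F n) by exact: bigcup_measurable.
have m0 : measurable (X @^-1` [set 0]) by rewrite -[X in measurable X]setTI; exact: mX.
rewrite (le_trans (measureU2 _ _ _))//.
rewrite [X in (X + _)%E](_ : _ = 0%E)// add0e.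
rewrite (le_trans (generalized_Boole_inequality nu mFn mU))//.
by rewrite eseries0.
Qed.

End levy_exponent_bounds.

Section infinitely_divisible_moments.
Context d (T : measurableType d) (R : realType) (P : probability T R).
Context d' (T' : measurableType d') (nu : {measure set T' -> \bar R}) (j : T' -> R).
Hypothesis mj : measurable_fun setT j.
Hypothesis j2 : nu.-integrable setT (fun x => (j x ^+ 2)%:E).

Let s : R := \int[nu]_x (j x ^+ 2).
Let re (theta : R) : R := \int[nu]_x (cos (theta * j x) - 1).
Let im (theta : R) : R := \int[nu]_x (sin (theta * j x) - theta * j x).

(** The characteristic function of X is exp(h psi), split into real and imaginary parts. The map [j]
    gives the jump sizes; it is the identity of the real line in the application. *)
Definition has_levy_exponent (h : R) (X : T -> R) := forall theta,
  \int[P]_w cos (theta * X w) = expR (h * re theta) * cos (h * im theta) /\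
  \int[P]_w sin (theta * X w) = expR (h * re theta) * sin (h * im theta).

Variables (h : R) (X : T -> R).
Hypothesis h0 : 0 <= h.
Hypothesis mX : measurable_fun setT X.
Hypothesis charX : has_levy_exponent h X.

Let mcos theta : measurable_fun setT (fun w => cos (theta * X w)).
Proof. by apply: measurableT_comp; [exact: measurable_cos|exact: measurable_funM]. Qed.

Let msin theta : measurable_fun setT (fun w => sin (theta * X w)).
Proof. by apply: measurableT_comp; [exact: measurable_sin|exact: measurable_funM]. Qed.

Lemma bounded_integrable (f : T -> R) (K : R) : measurable_fun setT f ->
  (forall w, `|f w| <= K) -> P.-integrable setT (fun w => (f w)%:E).
Proof.
move=> mf fK; apply: (@le_integrable_EFin _ _ _ _ _ (fun=> K)) => //.
exact: L2_integrable (L2_cst P K).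
Qed.

Let icos theta : P.-integrable setT (fun w => (cos (theta * X w))%:E).
Proof. by apply: (@bounded_integrable _ 1) => // w; exact: cos_max. Qed.

Let isin theta : P.-integrable setT (fun w => (sin (theta * X w))%:E).
Proof. by apply: (@bounded_integrable _ 1) => // w; exact: sin_max. Qed.

Lemma probability_integral_cst (K : R) : (\int[P]_w K%:E = K%:E)%E.
Proof.
by rewrite integral_cst// [X in (_ * X)%E](_ : _ = 1%E) ?mule1//; exact: probability_setT.
Qed.

Lemma expectation_one_sub_cos theta : (\int[P]_w (1 - cos (theta * X w))%:E =
  (1 - expR (h * re theta) * cos (h * im theta))%:E)%E.
Proof.
under eq_integral do rewrite EFinB.
rewrite integralB//; last exact: L2_integrable (L2_cst P 1).
by rewrite probability_integral_cst EFinB -(charX theta).1 Rintegral_fineK.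
Qed.

(** The squared imaginary part of the exponent contributes theta^4; [|theta| <= 1] turns it into
    theta^2, the form that [second_moment_le] takes as input. *)
Lemma expectation_one_sub_cos_le theta : `|theta| <= 1 ->
  (\int[P]_w (1 - cos (theta * X w))%:E <=
   ((h * s / 2 + h ^+ 2 * s ^+ 2 / 2) * theta ^+ 2)%:E)%E.
Proof.
move=> th1; rewrite expectation_one_sub_cos lee_fin.
have -> : h * re theta = - (h * - re theta) by rewrite mulrN opprK.
have re0 := levy_exponent_re_ge0 mj j2 theta.
apply: (le_trans (one_sub_expRN_cos_le _ _)); first exact: mulr_ge0.
rewrite mulrDl; apply: lerD.
  rewrite -mulrA -mulrA ler_wpM2l// (le_trans (levy_exponent_re_le mj j2 theta))//.
  by rewrite -/s; lra.
have := levy_exponent_im_le mj j2 theta; rewrite -/s -/(im theta) => imle.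
rewrite exprMn -(real_normK (num_real (im theta))).
have s0 : 0 <= s by exact: levy_variance_ge0.
have : `|im theta| ^+ 2 <= (theta ^+ 2 * s) ^+ 2.
  by rewrite ler_pXn2r// nnegrE mulr_ge0// sqr_ge0.
have th2 : theta ^+ 2 <= 1 by rewrite -(real_normK (num_real theta)) expr_le1.
move=> k; have : (theta ^+ 2 * s) ^+ 2 <= theta ^+ 2 * s ^+ 2.
  rewrite exprMn ler_wpM2r ?sqr_ge0// expr2 ler_piMl ?sqr_ge0//.
move=> /(le_trans k) k'.
have := ler_wpM2l (sqr_ge0 h) k'.
by move=> ?; lra.
Qed.

(** The bound is of order h as h decreases to 0, which is the order that the tail estimate has to
    beat. *)
Lemma charfun_second_moment_le :
  (\int[P]_w (X w ^+ 2)%:E <= (4 * (h * s / 2 + h ^+ 2 * s ^+ 2 / 2))%:E)%E.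
Proof.
apply: second_moment_le => // n; apply: expectation_one_sub_cos_le.
by rewrite ger0_norm ?invr_ge0// invf_le1 ?ltr0n// ler1n.
Qed.

Lemma charfun_L2 : L2fun P X.
Proof. by split => //; exact: le_lt_trans charfun_second_moment_le (ltry _). Qed.

(** E[sin(theta X)] differs from theta E[X] by at most theta^2 E[X^2], and is itself at most theta^2
    h s since the imaginary part of the exponent is quadratic in theta. Dividing by theta and
    letting it tend to 0 leaves E[X] = 0. *)
Lemma charfun_mean0 : (\int[P]_w (X w)%:E = 0)%E.
Proof.
have LX := charfun_L2.
have iX := L2_integrable LX.
have iX2 := L2_sqr_integrable LX.
pose V := \int[P]_w (X w ^+ 2).
rewrite -Rintegral_fineK//; congr EFin; set m := (X in X = _).
have s0 : 0 <= s by exact: levy_variance_ge0.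
have V0 : 0 <= V by apply: Rintegral_ge0 => w _; exact: sqr_ge0.
have key theta : 0 < theta -> `|m| <= theta * (V + h * s).
  move=> th0.
  have e1 : `|theta * m - \int[P]_w sin (theta * X w)| <= theta ^+ 2 * V.
    have iZ : P.-integrable setT (fun w => (theta * X w)%:E).
      by under eq_fun do rewrite EFinM; exact: integrableZl.
    rewrite -RintegralZl// -RintegralB//; last exact: isin.
    have iZ2 : P.-integrable setT (fun w => (theta ^+ 2 * X w ^+ 2)%:E).
      by under eq_fun do rewrite EFinM; exact: integrableZl.
    have id : P.-integrable setT (fun w => (theta * X w - sin (theta * X w))%:E).
      by under eq_fun do rewrite EFinB; exact: integrableB.
    apply: (le_trans (le_normr_Rintegral measurableT id)).
    rewrite -RintegralZl//; apply: le_Rintegral => //.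
    - exact: (integrable_abse id).
    - by move=> w _; rewrite distrC (le_trans (sub_sin_le _))// exprMn.
  have e2 : `|\int[P]_w sin (theta * X w)| <= theta ^+ 2 * (h * s).
    rewrite (charX theta).2 normrM ger0_norm ?expR_ge0//.
    apply: (@le_trans _ _ (1 * `|sin (h * im theta)|)).
      by rewrite ler_wpM2r// expR_le1 -oppr_ge0 -mulrN mulr_ge0// levy_exponent_re_ge0.
    rewrite mul1r (le_trans (norm_sin_le _))// normrM ger0_norm//.
    rewrite mulrCA ler_wpM2l//; exact: levy_exponent_im_le.
  rewrite -(ler_pM2l th0) mulrA -expr2 mulrDr -{1}(gtr0_norm th0) -normrM.
  apply: le_trans (lerD e1 e2).
  by rewrite -{1}(subrK (\int[P]_w sin (theta * X w)) (theta * m)) ler_normD.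
apply/eqP; rewrite -normr_le0; apply/ler_addgt0Pr => e e0; rewrite add0r.
have K0 : 0 < V + h * s + 1 by rewrite ltr_wpDl// addr_ge0// mulr_ge0.
rewrite (le_trans (key (e / (V + h * s + 1)) _))// ?divr_gt0//.
by rewrite mulrAC ler_pdivrMr// ler_wpM2l ?(ltW e0)// lerDl.
Qed.

(** E[(1 - cos(theta X))^2] is computed exactly from the characteristic function, where its leading
    term is linear in h, and bounded above by splitting at |X| = eps. *)
Lemma charfun_tail_ge theta eps : 0 < eps ->
  h * (- 2 * re theta + re (2 * theta) / 2)
    - h ^+ 2 * (2 * re theta ^+ 2 + im (2 * theta) ^+ 2 / 4)
    - theta ^+ 4 * eps ^+ 2 * (h * s / 2 + h ^+ 2 * s ^+ 2 / 2)
  <= 4 * fine (P [set w | eps < `|X w|]).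
Proof.
move=> eps0.
pose A := [set w | eps < `|X w|].
have mA : measurable A by exact: measurable_norm_gt.
have m1 : measurable_fun setT (fun w => (1 - cos (theta * X w)) ^+ 2).
  by apply: measurable_funX; exact: measurable_funB.
have LX := charfun_L2.
have lower : (\int[P]_w ((1 - cos (theta * X w)) ^+ 2)%:E =
   (3 / 2 - 2 * (expR (h * re theta) * cos (h * im theta)) +
    1 / 2 * (expR (h * re (2 * theta)) * cos (h * im (2 * theta))))%:E)%E.
  under eq_integral do rewrite sqr_one_sub_cosE EFinB !EFinM.
  have i1 th : P.-integrable setT (fun w => (1 - cos (th * X w))%:E).
    apply: (@bounded_integrable _ 2); first exact: measurable_funB.
    move=> w; rewrite ger0_norm ?one_sub_cos_ge0//.
    by have := cos_geN1 (th * X w); lra.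
  rewrite integralB//; [|exact: integrableZl|exact: integrableZl].
  rewrite !integralZl// !expectation_one_sub_cos -!EFinM -EFinB.
  by congr EFin; field.
have K4 : 0 <= theta ^+ 4 * eps ^+ 2 / 4.
  by rewrite divr_ge0// mulr_ge0// ?sqr_ge0// exprn_even_ge0.
(* Where |X| > eps the square is at most 4. Elsewhere it is at most (theta X)^4 / 4, and one factor
   X^2 is replaced by eps^2. *)
have upper : (\int[P]_w ((1 - cos (theta * X w)) ^+ 2)%:E <=
   4%:E * P A + (theta ^+ 4 * eps ^+ 2 / 4)%:E * \int[P]_w (X w ^+ 2)%:E)%E.
  rewrite -(setIT A) -integral_indic// -ge0_integral_linear//; last 2 first.
  - exact: measurable_funX.
  - by move=> w; exact: sqr_ge0.
  apply: ge0_le_integral_EFin => //.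
    apply: measurable_funD; apply: measurable_funM => //; exact: measurable_funX.
  move=> w; rewrite indicE.
  have c0 := one_sub_cos_ge0 (theta * X w).
  have [ew|ew] := ltP eps `|X w|.
    rewrite mem_set// mulr1.
    have c1 := cos_geN1 (theta * X w).
    have : (1 - cos (theta * X w)) ^+ 2 <= 4 by nra.
    by move=> /le_trans; apply; rewrite lerDl mulr_ge0 ?sqr_ge0.
  rewrite memNset/= ?mulr0 ?add0r; last by apply/negP; rewrite -leNgt.
  have c1 := one_sub_cos_le (theta * X w).
  have : (1 - cos (theta * X w)) ^+ 2 <= ((theta * X w) ^+ 2 / 2) ^+ 2.
    by rewrite ler_pXn2r// nnegrE// divr_ge0// sqr_ge0.
  move=> /le_trans; apply.
  have -> : ((theta * X w) ^+ 2 / 2) ^+ 2 = theta ^+ 4 / 4 * (X w ^+ 2 * X w ^+ 2) by field.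
  have -> : theta ^+ 4 * eps ^+ 2 / 4 * X w ^+ 2 = theta ^+ 4 / 4 * (eps ^+ 2 * X w ^+ 2) by field.
  rewrite ler_wpM2l ?divr_ge0// ?exprn_even_ge0// ler_wpM2r ?sqr_ge0//.
  by rewrite -(real_normK (num_real (X w))) ler_pXn2r// nnegrE// ltW.
have PA : P A = (fine (P A))%:E.
  by rewrite fineK//; exact: fin_num_measure.
rewrite lower PA in upper.
have : (3 / 2 - 2 * (expR (h * re theta) * cos (h * im theta)) +
    1 / 2 * (expR (h * re (2 * theta)) * cos (h * im (2 * theta))) <=
  4 * fine (P A) + (theta ^+ 4 * eps ^+ 2 / 4) * (4 * (h * s / 2 + h ^+ 2 * s ^+ 2 / 2))).
  rewrite -lee_fin; apply: (le_trans upper); rewrite [leRHS]EFinD; apply: leeD.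
    by rewrite EFinM.
  rewrite [leRHS]EFinM; apply: lee_wpmul2l charfun_second_moment_le.
  by rewrite lee_fin.
have a0 := levy_exponent_re_ge0 mj j2 theta.
have b0 := levy_exponent_re_ge0 mj j2 (2 * theta).
(* The two characteristic values enter with opposite signs, hence an upper bound at theta and a
   lower bound at 2 theta, both up to order h^2. *)
have e1 : expR (h * re theta) * cos (h * im theta) <= 1 + h * re theta + (h * re theta) ^+ 2.
  apply: (@le_trans _ _ (expR (h * re theta))); first by rewrite ler_piMr ?expR_ge0// cos_le1.
  have := @expRN_le _ (h * - re theta); rewrite mulr_ge0// => /(_ isT).
  by rewrite mulrN opprK sqrrN.
have e2 : 1 - expR (h * re (2 * theta)) * cos (h * im (2 * theta)) <=
   - (h * re (2 * theta)) + (h * im (2 * theta)) ^+ 2 / 2.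
  have := @one_sub_expRN_cos_le _ (h * - re (2 * theta)) (h * im (2 * theta)).
  by rewrite mulr_ge0// => /(_ isT); rewrite mulrN opprK.
rewrite -/A => up.
rewrite !exprMn in e1 e2.
lra.
Qed.

End infinitely_divisible_moments.

(** * Large increments and sign flips *)

Section levy_tail.
Context d (T : measurableType d) (R : realType) (P : probability T R).
Context d' (T' : measurableType d') (nu : {measure set T' -> \bar R}) (j : T' -> R).
Hypothesis mj : measurable_fun setT j.
Hypothesis j2 : nu.-integrable setT (fun x => (j x ^+ 2)%:E).

(** With theta such that the leading coefficient m is positive, [eps] is taken so small that the
    variance term costs at most m h / 4, and [h0] so small that the terms of order h^2 cost at most
    another m h / 4. The remaining m h / 2 is a lower bound for 4 P(|X| > eps). *)
Lemma levy_tail_linear : nu (j @^-1` [set 0]) = 0%E -> nu setT != 0%E ->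
  exists eps c h0 : R, [/\ 0 < eps, 0 < c, 0 < h0 &
    forall h X, 0 <= h <= h0 -> measurable_fun setT X -> has_levy_exponent P nu j h X ->
      c * h <= fine (P [set w | eps < `|X w|])].
Proof.
move=> nu0 nuT; have [theta m0] := exists_levy_exponent_gt0 mj j2 nu0 nuT.
set m := (X in 0 < X) in m0.
have s0 : 0 <= \int[nu]_x (j x ^+ 2) := levy_variance_ge0 nu j.
set s := (X in 0 <= X) in s0.
pose K := 2 * (\int[nu]_x (cos (theta * j x) - 1)) ^+ 2
   + (\int[nu]_x (sin (2 * theta * j x) - 2 * theta * j x)) ^+ 2 / 4.
have K0 : 0 <= K by apply: addr_ge0; [rewrite mulr_ge0 ?sqr_ge0|rewrite divr_ge0 ?sqr_ge0].
pose a := theta ^+ 4.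
have a0 : 0 <= a by exact: exprn_even_ge0.
(* This gives both eps <= 1 and 2 a s eps <= m, and makes sense when [a * s] vanishes. *)
pose eps := m / (m + 2 * (a * s)).
have D0 : 0 < m + 2 * (a * s) by rewrite ltr_pwDl// mulr_ge0// mulr_ge0.
have eps0 : 0 < eps by rewrite divr_gt0.
have epsD : eps * (m + 2 * (a * s)) = m by rewrite divfK// gt_eqF.
have eps1 : eps <= 1.
  by rewrite ler_pdivrMr// mul1r lerDl mulr_ge0// mulr_ge0.
pose h0 := m / (4 * (K + a * s ^+ 2 + 1)).
have E0 : 0 < 4 * (K + a * s ^+ 2 + 1).
  by rewrite mulr_gt0// ltr_wpDl// addr_ge0// mulr_ge0// sqr_ge0.
have h0_gt0 : 0 < h0 by rewrite divr_gt0.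
have h0D : h0 * (4 * (K + a * s ^+ 2 + 1)) = m by rewrite divfK// gt_eqF.
exists eps, (m / 16), h0; split=> //; first by rewrite divr_gt0.
move=> h X /andP[h_ge0 hh0] mX charX.
have := charfun_tail_ge mj j2 h_ge0 mX charX theta eps0.
rewrite -/m -/s -/a -/K.
set p := fine _ => tail.
have e2 : eps ^+ 2 <= eps by rewrite expr2 ler_piMl// ltW.
have e3 : a * eps ^+ 2 * s <= m / 2.
  have : a * s * eps ^+ 2 <= a * s * eps by rewrite ler_wpM2l// mulr_ge0.
  have : 0 <= eps * m by rewrite mulr_ge0// ltW.
  by nra.
have e4 : a * eps ^+ 2 * s ^+ 2 <= a * s ^+ 2.
  rewrite -mulrA ler_wpM2l// ler_piMl ?sqr_ge0// (le_trans e2)//.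
have h4 : h * (K + a * s ^+ 2) <= m / 4.
  have : h * (K + a * s ^+ 2) <= h0 * (K + a * s ^+ 2).
    by rewrite ler_wpM2r// addr_ge0// mulr_ge0// sqr_ge0.
  by move=> /le_trans; apply; nra.
have h5 : h ^+ 2 * K + a * eps ^+ 2 * (h ^+ 2 * s ^+ 2 / 2) <= h * (m / 4).
  have -> : h ^+ 2 * K + a * eps ^+ 2 * (h ^+ 2 * s ^+ 2 / 2) =
     h * (h * (K + a * eps ^+ 2 * s ^+ 2 / 2)) by field.
  rewrite ler_wpM2l// (le_trans _ h4)// ler_wpM2l// lerD2l.
  have : 0 <= a * s ^+ 2 by rewrite mulr_ge0// sqr_ge0.
  by lra.
have h6 : a * eps ^+ 2 * (h * s / 2) <= h * (m / 4).
  have -> : a * eps ^+ 2 * (h * s / 2) = h * (a * eps ^+ 2 * s / 2) by field.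
  by rewrite ler_wpM2l//; lra.
by nra.
Qed.

End levy_tail.

Section driving_levy_facts.
Context d (T : measurableType d) (R : realType) (P : probability T R).
Variables (nu : {measure set (measurableTypeR R) -> \bar R}) (L1 L2 : R -> T -> R).

Lemma levy_measure_sqr_integrable : levy_measure nu ->
  nu.-integrable setT (fun x : R => (x ^+ 2)%:E).
Proof. by case=> _ n1 n2; exact: (@truncated_sqr_integrable _ _ _ nu (fun x => x)). Qed.

Lemma driving_levy_exponent :
  (forall t theta, 0 <= t ->
    char_fun P (two_sided L1 L2 t) theta = cexp (t%:C%C * levy_exponent nu theta)) ->
  forall t, 0 <= t -> has_levy_exponent P nu (fun x => x) t (L1 t).
Proof.
move=> H t t0 theta; have := H t theta t0.
rewrite /two_sided t0 /char_fun /cexp /levy_exponent /=.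
rewrite !mul0r subr0 addr0.
by case=> -> ->.
Qed.

End driving_levy_facts.

Section sign_flip.
Local Open Scope ereal_scope.
Context d (T : measurableType d) (R : realType) (P : probability T R).

(** Dynkin's pi-lambda argument: the events independent of U are closed under complements and
    disjoint countable unions. *)
Lemma independent_generated (U : T -> R) (G : set (set T)) :
  measurable_fun setT U -> G `<=` measurable -> setI_closed G -> G setT ->
  (forall A F, measurable A -> G F -> P (U @^-1` A `&` F) = P (U @^-1` A) * P F) ->
  forall A F, measurable A -> <<s G >> F -> P (U @^-1` A `&` F) = P (U @^-1` A) * P F.
Proof.
move=> mU Gm GI GT ind A F mA.
have sGm : <<s G >> `<=` @measurable _ T.
  exact: (smallest_sub (@sigma_algebra_measurable _ T)).
have mUA : measurable (U @^-1` A) by rewrite -[X in measurable X]setTI; exact: mU.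
apply: (@dynkin_induction _ (g_sigma_algebraType G) G
  (fun F => P (U @^-1` A `&` F) = P (U @^-1` A) * P F)) => //.
- by rewrite setIT probability_setT mule1.
- by move=> F' GF'; exact: ind.
- move=> S /sGm mS PS.
  rewrite probability_setC// muleBr//; last first.
    exact: fin_num_measure.
  rewrite mule1 -PS -setDE; apply/eqP.
  rewrite -measureD//; last exact: (le_lt_trans (probability_le1 _ _) (ltry 1)).
- move=> E mE tE PE.
  rewrite setI_bigcupr measure_bigcup//; last 2 first.
  + by move=> i _; apply: measurableI => //; apply: sGm; exact: mE.
  + apply: trivIset_setIl; exact: tE.
  rewrite measure_bigcup//; last by move=> i _; apply: sGm; exact: mE.
  have PU : P (U @^-1` A) = (fine (P (U @^-1` A)))%:E by rewrite fineK//; exact: fin_num_measure.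
  rewrite [in RHS]PU -nneseriesZl//.
  by apply: eq_eseriesr => i _; rewrite -PU; exact: PE.
Qed.

(** U may be replaced by - U without changing its joint law with [G0] and [B]. If |phi U + B| and |-
    phi U + B| were both at most M, their difference would give phi |U| <= M, whereas phi |U| > phi
    eps >= M. So on the event considered one of the two exceeds M, and both have the same
    probability of doing so. *)
Lemma sign_flip_half (U B : T -> R) (G : set (set T)) (G0 : set T) (phi eps M : R) :
  measurable_fun setT U -> G `<=` measurable -> setI_closed G -> G setT ->
  (forall A F, measurable A -> G F -> P (U @^-1` A `&` F) = P (U @^-1` A) * P F) ->
  (forall A, measurable A -> P (U @^-1` A) = P ((fun w => - U w)%R @^-1` A)) ->
  measurable_fun setT (B : g_sigma_algebraType G -> R) -> <<s G >> G0 ->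
  (0 < phi)%R -> (M <= phi * eps)%R ->
  P (G0 `&` [set w | (eps < `|U w|)%R]) <=
  2%:E * P (G0 `&` [set w | (eps < `|U w|)%R] `&` [set w | (M < `|phi * U w + B w|)%R]).
Proof.
move=> mU Gm GI GT indG sym mB G0G phi0 Mphi.
have ind := independent_generated mU Gm GI GT indG.
have sGm : <<s G >> `<=` @measurable _ T.
  exact: (smallest_sub (@sigma_algebra_measurable _ T)).
(* The identity, seen as a random element of the coarser measurable space generated by G: paired
   with U, it carries [B] and [G0] at once. *)
pose Y : T -> g_sigma_algebraType G := fun w => w.
have mY : measurable_fun setT Y.
  by move=> _ F mF; rewrite setTI; exact: sGm.
have mNU : measurable_fun setT (fun w => - U w)%R by exact: measurableT_comp.
pose E : set (R * g_sigma_algebraType G) :=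
  [set z | [/\ G0 z.2, (eps < `|z.1|)%R & (M < `|phi * z.1 + B z.2|)%R]].
have mB' : measurable_fun setT (fun w => B w) by move=> _ A mA; rewrite setTI -[X in measurable X]setTI; apply: sGm; exact: mB.
have mE : measurable E.
  have -> : E = ((@snd R (g_sigma_algebraType G)) @^-1` G0 `&` [set z | (eps < `|z.1|)%R])
     `&` [set z | (M < `|phi * z.1 + B z.2|)%R].
    by apply/seteqP; split=> z /=; [case|case=> -[]].
  apply: measurableI; first apply: measurableI.
  - by rewrite -[X in measurable X]setTI; apply: measurable_snd.
  - by apply: measurable_norm_gt; exact: measurable_fst.
  - apply: measurable_norm_gt; apply: measurable_funD.
      by apply: measurable_funM => //; exact: measurable_fst.
    exact: (measurableT_comp mB measurable_snd).
have PE : P [set w | E (U w, Y w)] = P [set w | E (- U w, Y w)%R].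
  apply: independent_maps_same_law => //.
    have mopp : measurable_fun setT (-%R : R -> R) by exact: oppr_measurable.
    move=> A F mA mF; have mNA : measurable ((-%R : R -> R) @^-1` A).
      by rewrite -[X in measurable X]setTI; exact: mopp.
    by have := ind _ F mNA mF.
have mA : measurable [set w | (eps < `|U w|)%R] by exact: measurable_norm_gt.
have mG0 := sGm _ G0G.
have m1 : measurable (G0 `&` [set w | (eps < `|U w|)%R] `&` [set w | (M < `|phi * U w + B w|)%R]).
  apply: measurableI; first exact: measurableI.
  by apply: measurable_norm_gt; apply: measurable_funD => //; exact: measurable_funM.
have m2 : measurable (G0 `&` [set w | (eps < `|U w|)%R] `&` [set w | (M < `|phi * - U w + B w|)%R]).
  apply: measurableI; first exact: measurableI.
  by apply: measurable_norm_gt; apply: measurable_funD => //; exact: measurable_funM.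
have e1 : [set w | E (U w, Y w)] = G0 `&` [set w | (eps < `|U w|)%R] `&` [set w | (M < `|phi * U w + B w|)%R].
  by apply/seteqP; split=> z /=; [case|case=> -[]].
have e2 : [set w | E (- U w, Y w)%R] = G0 `&` [set w | (eps < `|U w|)%R] `&` [set w | (M < `|phi * - U w + B w|)%R].
  by apply/seteqP; split=> z /=; [case; rewrite normrN|case=> -[]; rewrite -(normrN (U z))].
rewrite mule_natl mule2n; rewrite -{2}e1 PE e2.
apply: (le_trans _ (measureU2 _ m1 m2)).
apply: le_measure; rewrite ?inE//; [exact: measurableI|exact: measurableU|].
move=> w [Gw ew].
have [b|b] := ltP M `|phi * U w + B w|%R; [by left|right].
split=> //=; rewrite ltNge; apply/negP => b'.
have : (`|2 * (phi * U w)| <= 2 * M)%R.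
  have -> : (2 * (phi * U w) = (phi * U w + B w) - (phi * - U w + B w))%R by ring.
  by rewrite (le_trans (ler_normB _ _))//; lra.
rewrite !normrM (@ger0_norm _ 2)// ler_pM2l// gtr0_norm//.
rewrite leNgt => /negP; apply; apply: (le_lt_trans Mphi).
by rewrite ltr_pM2l.
Qed.

End sign_flip.

Lemma cvg_divn2 (R : realType) (b : R) : b / n.+2%:R @[n --> \oo] --> 0.
Proof.
rewrite -(mulr0 b); apply: cvgM; first exact: cvg_cst.
have := @cvg_harmonic R; rewrite -(cvg_shiftS) /=.
by under eq_fun do rewrite /harmonic.
Qed.

Section generated_by_process.
Context d (T : measurableType d) (R : realType).
Implicit Types (X : R -> T -> R) (D : set R).

(** The generators of [sigma_process], named so that measurability with respect to the process
    becomes measurability from a [g_sigma_algebraType]. *)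
Definition process_events D X : set (set T) :=
  [set E | exists t B, [/\ D t, measurable B & E = X t @^-1` B]].

Lemma process_measurable D X t : D t ->
  measurable_fun setT (X t : g_sigma_algebraType (process_events D X) -> R).
Proof.
move=> Dt _ B mB; rewrite setTI; apply: sub_sigma_algebra.
by exists t, B.
Qed.

(** At negative times [two_sided] is a left limit of [L2]. Along the sequence p - p/(n+2), which
    stays nonnegative, this limit is measurable for the sigma-algebra of [L2], hence independent of
    [L1]. *)
Lemma left_limit_measurable X p : 0 < p ->
  (forall w, cvg (X s w @[s --> p^'-])) ->
  measurable_fun setT (fun w : g_sigma_algebraType (process_events `[0, +oo[ X) =>
    lim (X s w @[s --> p^'-])).
Proof.
move=> p0 Xp.
pose u n : R := p - p * n.+2%:R^-1.
have u0 n : 0 <= u n.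
  by rewrite /u subr_ge0 ler_piMr ?(ltW p0)// invf_le1 ?ltr0n// ler1n.
have up n : u n < p.
  by rewrite /u ltrBlDr ltrDl mulr_gt0// invr_gt0 ltr0n.
have ucvg : u n @[n --> \oo] --> p.
  by rewrite -[X in _ --> X]subr0; apply: cvgB; [exact: cvg_cst|exact: cvg_divn2].
apply: (@measurable_fun_cvg _ (g_sigma_algebraType (process_events `[0, +oo[ X)) R setT
  (fun n w => X (u n) w)).
  by move=> n; apply: process_measurable; rewrite /= in_itv/= andbT.
move=> w _; have /cvg_at_leftP := Xp w; apply.
by split.
Qed.

End generated_by_process.

(** * Independent increments along a grid *)

Section grid_increments.
Context d (T : measurableType d) (R : realType) (P : probability T R).
Variables (L1 L2 : R -> T -> R).
Hypothesis hL1 : levy_process P L1.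
Hypothesis hL2 : levy_process P L2.
Hypothesis hind : independent_processes P `[0, +oo[ L1 L2.
Variables (n : nat) (t : nat -> R).
Hypothesis t0 : 0 <= t 0%N.
Hypothesis tmono : {homo t : i j / (i <= j)%N >-> i <= j}.

Definition increment (i : nat) (w : T) : R := L1 (t i.+1) w - L1 (t i) w.

(** A pi-system generating the information carried by [L2] and by all increments but the k-th, on
    which only [setT] is imposed. *)
Definition off_events (k : 'I_n) : set (set T) :=
  [set F | exists (E : set T) (B : 'I_n -> set R),
    [/\ sigma_process `[0, +oo[ L2 E, (forall i, measurable (B i)) &
      F = \bigcap_(i : 'I_n) (increment i @^-1` (if i == k then setT else B i)) `&` E]].

Let t_ge0 i : 0 <= t i.
Proof. by rewrite (le_trans t0)// tmono. Qed.

Lemma increment_measurable i : measurable_fun setT (increment i).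
Proof. by apply: measurable_funB; apply: levy_measurable hL1 _ _. Qed.

Lemma sigma_process_sub D X : (forall s, D s -> measurable_fun setT (X s)) ->
  @sigma_process _ T R D X `<=` measurable.
Proof.
move=> mX; apply: smallest_sub; first exact: sigma_algebra_measurable.
by move=> _ [s [B [Ds mB ->]]]; rewrite -[X in measurable X]setTI; exact: mX.
Qed.

Lemma L2_events_measurable : sigma_process `[0, +oo[ L2 `<=` measurable.
Proof.
apply: sigma_process_sub => s; rewrite /= in_itv/= andbT.
exact: levy_measurable hL2 _.
Qed.

Lemma bigcap_increment_measurable (B : 'I_n -> set R) : (forall i, measurable (B i)) ->
  measurable (\bigcap_(i : 'I_n) (increment i @^-1` B i)).
Proof.
move=> mB; apply: fin_bigcap_measurable => // i _.
by rewrite -[X in measurable X]setTI; exact: increment_measurable.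
Qed.

Lemma increments_independent (B : 'I_n -> set R) E : (forall i, measurable (B i)) ->
  sigma_process `[0, +oo[ L2 E ->
  P (\bigcap_(i : 'I_n) (increment i @^-1` B i) `&` E) = (\prod_(i < n) P (increment i @^-1` B i) * P E)%E.
Proof.
move=> mB mE; rewrite hind//; first congr (_ * _)%E.
  exact: (levy_indep hL1 t0 tmono).
have : measurable (\bigcap_(i : 'I_n) (increment i @^-1` B i) : set (g_sigma_algebraType (process_events `[0, +oo[ L1))).
  apply: fin_bigcap_measurable => // i _.
  rewrite -[X in measurable X]setTI; apply: measurable_funB => //;
    by apply: process_measurable; rewrite /= in_itv/= andbT.
by [].
Qed.

Lemma off_events_measurable k : off_events k `<=` measurable.
Proof.
move=> _ [E [B [mE mB ->]]]; apply: measurableI; last exact: L2_events_measurable.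
apply: bigcap_increment_measurable => i; by case: ifP.
Qed.

Lemma off_eventsI k : setI_closed (off_events k).
Proof.
move=> _ _ [E [B [mE mB ->]]] [E' [B' [mE' mB' ->]]].
exists (E `&` E'), (fun i => B i `&` B' i); split.
- have mE1 : measurable (E : set (g_sigma_algebraType (process_events `[0, +oo[ L2))) by [].
  have mE2 : measurable (E' : set (g_sigma_algebraType (process_events `[0, +oo[ L2))) by [].
  exact: (measurableI _ _ mE1 mE2).
- by move=> i; exact: measurableI.
- rewrite setIACA -bigcapI; congr (_ `&` _); apply: eq_bigcapr => i _.
  by case: ifP => _; rewrite ?preimage_setT ?setIT ?preimage_setI.
Qed.

Lemma sigma_processT D X : @sigma_process _ T R D X setT.
Proof.
by have := @measurableT _ (g_sigma_algebraType (process_events D X)).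
Qed.

Lemma off_eventsT k : off_events k setT.
Proof.
exists setT, (fun=> setT); split=> //; first exact: sigma_processT.
rewrite setIT; apply/esym/seteqP; split=> // w _ i _ /=.
by case: ifP.
Qed.

Lemma off_events_independent k A F : measurable A -> off_events k F ->
  (P (increment k @^-1` A `&` F) = P (increment k @^-1` A) * P F)%E.
Proof.
move=> mA [E [B [mE mB ->]]].
have -> : increment k @^-1` A `&` (\bigcap_(i : 'I_n) (increment i @^-1` (if i == k then setT else B i)) `&` E)
  = \bigcap_(i : 'I_n) (increment i @^-1` (if i == k then A else B i)) `&` E.
  rewrite setIA; congr (_ `&` _); apply/seteqP; split=> w /=.
    by move=> [wA wB] i _; have := wB i I; rewrite /=; case: ifP => // /eqP ->.
  move=> wB; split; first by have := wB k I; rewrite /= eqxx.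
  by move=> i _; have := wB i I; rewrite /=; case: ifP.
rewrite !increments_independent//; try by move=> i; case: ifP.
rewrite (bigD1 k)//= eqxx [in RHS](bigD1 k)//= eqxx preimage_setT probability_setT mul1e.
rewrite -muleA; congr (_ * (_ * _))%E.
by apply: eq_bigr => i /negPf ->.
Qed.

Lemma off_increment_measurable k (i : 'I_n) : i != k ->
  measurable_fun setT (increment i : g_sigma_algebraType (off_events k) -> R).
Proof.
move=> ik _ B mB; rewrite setTI; apply: sub_sigma_algebra.
exists setT, (fun j => if j == i then B else setT); split.
- exact: sigma_processT.
- by move=> j; case: ifP.
rewrite setIT; apply/seteqP; split=> w /=.
  by move=> wB j _ /=; case: ifP => // _; case: ifP => // /eqP ->.
by move=> /(_ i I) /=; rewrite (negPf ik) eqxx.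
Qed.

Lemma off_L2_measurable k (f : T -> R) :
  measurable_fun setT (f : g_sigma_algebraType (process_events `[0, +oo[ L2) -> R) ->
  measurable_fun setT (f : g_sigma_algebraType (off_events k) -> R).
Proof.
move=> mf _ B mB; apply: sub_sigma_algebra.
exists (f @^-1` B), (fun=> setT); split=> //.
  by rewrite -[X in sigma_process _ _ X]setTI; exact: mf.
rewrite setTI [X in X `&` _](_ : _ = setT) ?setTI//.
by apply/seteqP; split=> // w _ i _ /=; case: ifP.
Qed.

(** A cell is good when some [S i] is affine in its increment with a slope [phi] such that
    [M <= phi * eps]; the index i may change with the cell, and the offset [B] is arbitrary apart
    from its measurability. *)
Variable (good : pred 'I_n).
Variables (q : nat) (S : 'I_q -> T -> R) (eps c M : R).
Hypothesis mS : forall i, measurable_fun setT (S i).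
Hypothesis tail : forall k : 'I_n, good k ->
  c * (t k.+1 - t k) <= fine (P [set w | eps < `|increment k w|]).
Hypothesis sym : forall k : 'I_n, forall A, measurable A ->
  P (increment k @^-1` A) = P ((fun w => - increment k w) @^-1` A).
Hypothesis decomp : forall k : 'I_n, good k ->
  exists (i : 'I_q) (phi : R) (B : T -> R), [/\ 0 < phi, M <= phi * eps,
    measurable_fun setT (B : g_sigma_algebraType (off_events k) -> R) &
    forall w, S i w = phi * increment k w + B w].

Let big_jump (k : 'I_n) := [set w | eps < `|increment k w|].

Let mbig k : measurable (big_jump k).
Proof. exact: measurable_norm_gt (increment_measurable k). Qed.

(** Written in the shape of [off_events k], which makes it independent of the k-th increment. *)
Let no_jump_before (k : 'I_n) := \bigcap_(i : 'I_n)
  (increment i @^-1` (if i == k then setT else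
     if good i && (i < k)%N then [set y | `|y| <= eps] else setT)).

Let mle : measurable [set y : R | `|y| <= eps].
Proof.
rewrite (_ : [set _ | _] = `[- eps, eps]%classic); first exact: measurable_itv.
by apply/seteqP; split=> x /=; rewrite in_itv/= ler_norml.
Qed.

Let no_jump_before_off k : off_events k (no_jump_before k).
Proof.
exists setT, (fun i => if good i && (i < k)%N then [set y | `|y| <= eps] else setT).
split; first exact: sigma_processT.
  by move=> i; case: ifP.
by rewrite setIT.
Qed.

Let exceed := \bigcup_(i in [set: 'I_q]) [set w | M < `|S i w|].

Let mexceed : measurable exceed.
Proof. by apply: fin_bigcup_measurable => // i _; exact: measurable_norm_gt. Qed.

(** The event is split according to the first good cell with a big increment. Being first is a
    condition on earlier increments only, so the sign of the increment in that cell can still be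
    flipped; the pieces are disjoint, so the factor 2 is paid once. *)
Lemma jump_exceed_le : (P (\bigcup_(k in [set k | good k]) big_jump k) <= 2%:E * P exceed)%E.
Proof.
pose J k := no_jump_before k `&` big_jump k.
have mJ k : measurable (J k).
  by apply: measurableI => //; exact: off_events_measurable (no_jump_before_off k).
have fin : finite_set [set k | good k] by exact: finite_finset.
apply: (@le_trans _ _ (\sum_(k \in [set k | good k]) P (J k)))%E.
  apply: content_sub_fsum => //.
    by apply: fin_bigcup_measurable.
  move=> w [k0 gk0 wk0].
  have ex : exists m, [exists k : 'I_n, (val k == m) && good k && (eps < `|increment k w|)].
    by exists (val k0); apply/existsP; exists k0; rewrite eqxx gk0.
  case: (ex_minnP ex) => m /existsP[k /andP[/andP[/eqP km gk] wk]] mmin.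
  exists k => //; split=> // i _ /=; case: ifP => // _; case: ifP => // /andP[gi ik].
  rewrite /= leNgt; apply/negP => wi.
  have := mmin i; rewrite leqNgt -km ik; move=> /(_ _)/negP; apply => //.
  by apply/existsP; exists i; rewrite eqxx gi.
apply: (@le_trans _ _ (\sum_(k \in [set k | good k]) 2%:E * P (J k `&` exceed)))%E.
  apply: lee_fsum => // k gk.
  have [i [phi [B [phi0 Mphi mB SE]]]] := decomp gk.
  have hn : <<s off_events k >> (no_jump_before k) by exact: sub_sigma_algebra.
  have h : (P (J k) <= 2%:E * P (J k `&` [set w | (M < `|phi * increment k w + B w|)%R]))%E :=
    (@sign_flip_half _ T R P (increment k) B (off_events k) (no_jump_before k) phi eps M
    (increment_measurable k) (@off_events_measurable k) (@off_eventsI k) (off_eventsT k)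
    (@off_events_independent k) (@sym k) mB hn phi0 Mphi).
  apply: (le_trans h).
  apply: lee_pmul => //; apply: le_measure; rewrite ?inE.
  - apply: measurableI => //.
    have -> : [set w | M < `|phi * increment k w + B w|] = [set w | M < `|S i w|].
      by apply/seteqP; split=> w /=; rewrite SE.
    exact: measurable_norm_gt.
  - exact: measurableI.
  - by move=> w [Jw Mw]; split=> //; exists i => //=; rewrite SE.
rewrite -ge0_mule_fsumr//; apply: lee_pmul => //.
  by apply: fsume_ge0.
rewrite -measure_fin_bigcup//.
- apply: le_measure; rewrite ?inE//.
    by apply: fin_bigcup_measurable => // k _; exact: measurableI.
  by move=> w [k gk []].
- apply/trivIsetP => i k /= gi gk.
  wlog ik : i k gi gk / (i < k)%N.
    move=> H ik; have [lt|lt|e] := ltngtP i k; first exact: H.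
      by rewrite setIC; apply: H => //; rewrite eq_sym.
    by move/negP: ik; case; apply/eqP/val_inj.
  move=> _; rewrite -subset0 => w [[[_ wi] _] [[wk _] _]].
  have := wk i I; rewrite /= gi ik/= ifF; last by apply/negbTE; rewrite neq_ltn ik.
  by rewrite /= leNgt => /negP; apply; exact: wi.
- by move=> k _; exact: measurableI.
Qed.

(** By independence the absence of big increments has probability at most the product of the factors
    1 - c (t k.+1 - t k) over the good cells, and 1 - x <= exp(- x). *)
Lemma some_jump_ge : 1 - expR (- (c * \sum_(k < n | good k) (t k.+1 - t k)))
  <= fine (P (\bigcup_(k in [set k | good k]) big_jump k)).
Proof.
pose Bk (k : 'I_n) := if good k then [set y : R | `|y| <= eps] else setT.
have mBk k : measurable (Bk k) by rewrite /Bk; case: ifP.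
have mU : measurable (\bigcup_(k in [set k | good k]) big_jump k).
  by apply: fin_bigcup_measurable => //; exact: finite_finset.
have E : ~` (\bigcup_(k in [set k | good k]) big_jump k) = \bigcap_(k : 'I_n) (increment k @^-1` Bk k).
  rewrite setC_bigcup; apply/seteqP; split=> w /= H k.
    by move=> _; rewrite /Bk /=; case: ifPn => //= gk; have := H k gk; rewrite /big_jump /= => /negP; rewrite -leNgt.
  move=> gk; have := H k I; rewrite /= /Bk gk/= leNgt => /negP; exact.
have := probability_setC P mU; rewrite E.
have := increments_independent mBk (@sigma_processT `[0, +oo[%classic L2).
rewrite setIT probability_setT mule1 => ->.
set U := \bigcup_(_ in _) _ => PU.
have fU : P U = (fine (P U))%:E by rewrite fineK//; exact: fin_num_measure.
have fP (k : 'I_n) : P (increment k @^-1` Bk k) = (fine (P (increment k @^-1` Bk k)))%:E.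
  rewrite fineK//; apply: fin_num_measure.
  by rewrite -[X in measurable X]setTI; exact: increment_measurable.
move: PU; rewrite fU; under eq_bigr do rewrite fP.
rewrite prodEFin -EFinB => -[] PU.
rewrite lerBlDr addrC -lerBlDr -PU.
rewrite mulr_sumr -sumrN expR_sum [leRHS]big_mkcond/=.
apply: ler_prod => k _; rewrite fine_ge0//= /Bk; case: ifPn => gk.
  apply: (@le_trans _ _ (1 - c * (t k.+1 - t k))); last exact: expR_ge1Dx.
  have -> : increment k @^-1` [set y | `|y| <= eps] = ~` big_jump k.
    by apply/seteqP; split=> w /=; rewrite /big_jump/= leNgt => /negP.
  rewrite probability_setC// -[P (big_jump k)]fineK ?fin_num_measure//=.
  by rewrite lerD2l lerN2; exact: tail.
by rewrite preimage_setT probability_setT.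
Qed.

Lemma exceed_ge : (1 - expR (- (c * \sum_(k < n | good k) (t k.+1 - t k)))) / 2 <=
  fine (P (\bigcup_(i in [set: 'I_q]) [set w | M < `|S i w|])).
Proof.
have h1 := some_jump_ge; have h2 := jump_exceed_le.
rewrite ler_pdivrMr// (le_trans h1)// -lee_fin EFinM muleC fineK ?fin_num_measure//.
  by rewrite fineK ?fin_num_measure//.
by apply: fin_bigcup_measurable => //; exact: finite_finset.
Qed.

End grid_increments.

(** The points are sorted, with repetitions, and the sequence stays at the last point afterwards, so
    that it is monotone on all indices. Some cells may be empty. *)
Lemma exists_grid (R : realType) (A : seq R) : 0 \in A -> (forall a, a \in A -> 0 <= a) ->
  exists (n : nat) (t : nat -> R), [/\ t 0%N = 0, {homo t : i j / (i <= j)%N >-> i <= j},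
    forall a, a \in A -> exists2 k, (k <= n)%N & t k = a & forall k, t k \in A].
Proof.
move=> A0 Age; pose s := sort <=%R A.
have sA a : (a \in s) = (a \in A) by rewrite mem_sort.
have s0 : (0 < size s)%N by rewrite size_sort; case: A A0 {Age s sA}.
pose t k := nth 0 s (minn k (size s).-1).
have ts k : t k \in A by rewrite -sA mem_nth// (leq_ltn_trans (geq_minr _ _))// ltn_predL.
have tmono : {homo t : i j / (i <= j)%N >-> i <= j}.
  move=> i j ij; apply: (@sorted_leq_nth _ <=%R le_trans lexx 0 s).
  - exact: (sort_sorted (@le_total _ R)).
  - by rewrite inE (leq_ltn_trans (geq_minr _ _))// ltn_predL.
  - by rewrite inE (leq_ltn_trans (geq_minr _ _))// ltn_predL.
  - by rewrite leq_min geq_minr andbT (leq_trans (geq_minl _ _)).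
have tA a : a \in A -> exists2 k, (k <= size s)%N & t k = a.
  rewrite -sA => sa; exists (index a s); first by rewrite ltnW// index_mem.
  rewrite /t (minn_idPl _) ?nth_index// -ltnS prednK// index_mem//.
exists (size s), t; split=> //.
have [k _ tk] := tA _ A0.
by apply/eqP; rewrite eq_le Age// andbT -[leRHS]tk tmono.
Qed.

Lemma grid_cell (R : realType) (t : nat -> R) (m : nat) (y : R) :
  t 0%N < y -> y <= t m -> exists2 k, (k < m)%N & t k < y <= t k.+1.
Proof.
move=> t0y ytm; have ex : exists k, y <= t k by exists m.
case: (ex_minnP ex) => -[|k] yk kmin; first by move: yk; rewrite leNgt t0y.
exists k; first by rewrite kmin.
by rewrite yk andbT ltNge; apply/negP => /kmin; rewrite ltnn.
Qed.

(** * Step functions and step integrals along a grid *)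

Section step_functions.
Context {R : realType}.
Implicit Types phi : @step R.

(** As a combination of half-line indicators, one for each endpoint, the step function has the shape
    of [step_integral], where the values of the process take their place. *)
Lemma step_funE phi x : wf_step phi -> step_fun phi x =
  \sum_(p <- phi) p.1.1 * ((x <= p.2)%R%:R - (x <= p.1.2)%R%:R).
Proof.
move=> /allP wf; rewrite /step_fun [LHS]big_seq [RHS]big_seq.
apply: eq_bigr => p /wf p12; congr (_ * _).
rewrite indicE; have -> : (x \in `]p.1.2, p.2]%classic) = (p.1.2 < x <= p.2).
  by apply/idP/idP => [/set_mem|h]; rewrite ?inE /= in_itv.
have [xp|px] := leP x p.1.2; first by rewrite (le_trans xp p12) subrr.
by rewrite /= subr0.
Qed.

Lemma measurable_step_fun phi : measurable_fun setT (step_fun phi).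
Proof.
rewrite /step_fun; elim: phi => [|p phi IH].
  by under eq_fun do rewrite big_nil; exact: measurable_cst.
under eq_fun do rewrite big_cons.
by apply: measurable_funD => //; apply: measurable_funM.
Qed.

End step_functions.

Section step_decomposition.
Context d (T : measurableType d) (R : realType) (P : probability T R).
Variables (L1 L2 : R -> T -> R).
Hypothesis hL1 : levy_process P L1.
Hypothesis hL2 : levy_process P L2.
Variables (n : nat) (t : nat -> R).
Hypothesis t0 : t 0%N = 0.
Hypothesis tmono : {homo t : i j / (i <= j)%N >-> i <= j}.

(** [L1 0] is only almost surely 0. Subtracting it makes the value at a grid point equal to a sum of
    grid increments everywhere, as measurability with respect to [off_events] demands. *)
Definition recentered (p : R) (w : T) : R :=
  if 0 <= p then L1 p w - L1 0 w else two_sided L1 L2 p w.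

Definition on_grid (p : R) := p < 0 \/ exists2 m, (m <= n)%N & t m = p.

(** The value at a grid point [t m] is the sum of the increments of index below m; the k-th occurs
    in it exactly when [t k.+1 <= t m], and is then subtracted. *)
Lemma recentered_off (k : 'I_n) p : t k < t k.+1 -> on_grid p ->
  measurable_fun setT ((fun w => recentered p w - (t k.+1 <= p)%R%:R * increment L1 t k w)
    : g_sigma_algebraType (off_events L1 L2 t k) -> R).
Proof.
move=> tk [p0|[m mn tm]].
  have -> : (t k.+1 <= p) = false.
    by apply/negbTE; rewrite -ltNge (lt_le_trans p0)// -t0 tmono.
  under eq_fun do rewrite mul0r subr0 /recentered /two_sided leNgt p0/=.
  apply: off_L2_measurable.
  apply: measurable_funN; apply: left_limit_measurable; first by rewrite oppr_gt0.
  by move=> w; apply: levy_left_limit hL2 _ _ _; rewrite oppr_gt0.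
have p0 : 0 <= p by rewrite -tm -t0 tmono.
(* The cell has to be nonempty: for m <= k, t m <= t k < t k.+1. *)
have tkm : (t k.+1 <= p) = (k < m)%N.
  rewrite -tm; apply/idP/idP => [|km]; last exact: tmono.
  by apply: contraTT; rewrite -leqNgt -ltNge => mk; rewrite (le_lt_trans _ tk)// tmono.
have E w : recentered p w - (t k.+1 <= p)%R%:R * increment L1 t k w =
    \sum_(i < n) (if (i != k) && (i < m)%N then increment L1 t i w else 0).
  have e : L1 (t m) w - L1 0 w = \sum_(i < m) (L1 (t i.+1) w - L1 (t i) w).
    rewrite -(big_mkord xpredT (fun i => L1 (t i.+1) w - L1 (t i) w)).
    by rewrite (telescope_sumr (fun i => L1 (t i) w))// t0.
  rewrite /recentered p0 tkm -tm e.
  rewrite (big_ord_widen_cond n (fun=> true) (fun i => L1 (t i.+1) w - L1 (t i) w) mn)/=.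
  rewrite big_mkcond/= (bigD1 k)//= [RHS](bigD1 k)//= eqxx/= add0r.
  rewrite addrAC [X in X + _](_ : _ = 0) ?add0r.
    by apply: eq_bigr => i ->; case: ifP.
  by case: ifP => _; rewrite ?mul1r ?mul0r subrr.
under eq_fun do rewrite E.
apply: (@measurable_sum _ (g_sigma_algebraType (off_events L1 L2 t k)) R setT 'I_n (index_enum 'I_n)
  (fun i w => if (i != k) && (i < m)%N then increment L1 t i w else 0)) => i.
have [ik|_] := boolP (i != k); last exact: measurable_cst.
by case: (i < m)%N; [exact: off_increment_measurable|exact: measurable_cst].
Qed.

Definition recentered_integral (phi : step) (w : T) : R :=
  \sum_(p <- phi) p.1.1 * (recentered p.2 w - recentered p.1.2 w).

Lemma recentered_integral_ae (phi : step) :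
  {ae P, forall w, step_integral (two_sided L1 L2) phi w = recentered_integral phi w}.
Proof.
apply: filterS (levy_start hL1) => w L0.
rewrite /step_integral /recentered_integral; apply: eq_bigr => p _.
have E x : two_sided L1 L2 x w = recentered x w.
  by rewrite /recentered /two_sided; case: ifP; rewrite ?L0 ?subr0.
by rewrite !E.
Qed.

(** The slope is the value of the step function at the right endpoint of the cell, hence on the
    whole half-open cell, as no endpoint of [phi] lies inside it. *)
Lemma recentered_integral_decomp (phi : step) (k : 'I_n) : wf_step phi ->
  t k < t k.+1 ->
  (forall p, p \in phi -> on_grid p.1.2 /\ on_grid p.2) ->
  exists B : T -> R,
    measurable_fun setT (B : g_sigma_algebraType (off_events L1 L2 t k) -> R) /\
    forall w, recentered_integral phi w = step_fun phi (t k.+1) * increment L1 t k w + B w.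
Proof.
move=> wf tk ong.
pose f p w := recentered p w - (t k.+1 <= p)%R%:R * increment L1 t k w.
exists (fun w => \sum_(p <- phi) p.1.1 * (f p.2 w - f p.1.2 w)); split.
  elim: phi ong {wf} => [|p phi IH] ong.
    by under eq_fun do rewrite big_nil; exact: measurable_cst.
  under eq_fun do rewrite big_cons.
  have [g1 g2] := ong p (mem_head _ _).
  apply: measurable_funD; last by apply: IH => q qphi; apply: ong; rewrite inE qphi orbT.
  by apply: measurable_funM => //; apply: measurable_funB; exact: recentered_off.
move=> w; rewrite (step_funE _ wf) mulr_suml -big_split/=; apply: eq_bigr => p _.
by rewrite /f; ring.
Qed.

Lemma recentered_measurable p : measurable_fun setT (recentered p).
Proof.
rewrite /recentered; have [p0|p0] := leP 0 p.
  by apply: measurable_funB; apply: levy_measurable hL1 _ _.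
rewrite /two_sided leNgt p0/=; apply: measurable_funN.
have p0' : 0 < - p by rewrite oppr_gt0.
have ml := @left_limit_measurable _ T R L2 (- p) p0' (fun w => @levy_left_limit _ _ _ _ _ hL2 w (- p) p0').
move=> _ B mB; apply: (L2_events_measurable hL2); exact: ml.
Qed.

Lemma recentered_integral_measurable phi : measurable_fun setT (recentered_integral phi).
Proof.
rewrite /recentered_integral; elim: phi => [|p phi IH].
  by under eq_fun do rewrite big_nil; exact: measurable_cst.
under eq_fun do rewrite big_cons.
apply: measurable_funD => //; apply: measurable_funM => //.
by apply: measurable_funB; exact: recentered_measurable.
Qed.

End step_decomposition.

Lemma fsbig_ord_pred (R : Type) (idx : R) (op : Monoid.com_law idx) n (p : pred 'I_n)
    (F : 'I_n -> R) :
  \big[op/idx]_(k \in [set k | p k]) F k = \big[op/idx]_(k < n | p k) F k.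
Proof.
have fin : finite_set [set k | p k] by exact: finite_finset.
rewrite (fsbig_finite _ _ fin)/= -[RHS]big_filter; apply: perm_big; apply: uniq_perm.
- exact: finmap.fset_uniq.
- by rewrite filter_uniq// index_enum_uniq.
- move=> k; rewrite mem_filter mem_index_enum andbT in_fset_set//.
  by apply/idP/idP => [/set_mem//|pk]; exact/mem_set.
Qed.

Lemma cvge_lt_near (R : realType) (u : nat -> \bar R) (e : R) : 0 < e ->
  (u n @[n --> \oo] --> 0)%E -> \forall n \near \oo, (u n < e%:E)%E.
Proof. by move=> e0 u0; have := u0 _ (open_ereal_lt' (_ : (0 < e%:E)%E)); apply; rewrite lte_fin. Qed.

Lemma measure_ge1_le d (T : measurableType d) (R : realType) (mu : {measure set T -> \bar R})
    (g : T -> R) : measurable_fun setT g -> (forall x, 0 <= g x) ->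
  (mu [set x | (1 <= g x)%R] <= \int[mu]_x (g x)%:E)%E.
Proof.
move=> mg g0.
have mA : measurable [set x | 1 <= g x] by exact: measurable_ge.
rewrite -[X in mu X]setIT -integral_indic//.
apply: ge0_le_integral_EFin => // x; rewrite indicE.
by case: (boolP (x \in _)) => //; rewrite inE.
Qed.

(** * Large values of step integrals and Wiener integrals *)

Section local_unboundedness.
Context d (T : measurableType d) (R : realType) (P : probability T R).
Variables (L1 L2 : R -> T -> R).
Hypothesis hL1 : levy_process P L1.
Hypothesis hL2 : levy_process P L2.
Hypothesis hind : independent_processes P `[0, +oo[ L1 L2.
Let L := two_sided L1 L2.
Hypothesis hsym : symmetric_fdd P L.
Variables (eps c h0 : R).
Hypothesis eps0 : 0 < eps.
Hypothesis c0 : 0 < c.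
Hypothesis h0_gt0 : 0 < h0.
Hypothesis tail : forall h, 0 <= h <= h0 -> c * h <= fine (P [set w | eps < `|L1 h w|]).

Lemma increment_symmetric s t A : 0 <= s -> 0 <= t -> measurable A ->
  P ((fun w => L1 t w - L1 s w) @^-1` A) = P ((fun w => - (L1 t w - L1 s w)) @^-1` A).
Proof.
move=> s0 t0 mA.
pose tt (i : 'I_2) := if val i == 0%N then t else s.
pose B : set (2.-tuple (measurableTypeR R)) := [set z | A (tnth z ord0 - tnth z ord_max)].
have mB : measurable B.
  rewrite -[X in measurable X]setTI.
  have : measurable_fun setT (fun z : 2.-tuple (measurableTypeR R) => tnth z ord0 - tnth z ord_max : R).
    apply: measurable_funB; [exact: (measurable_tnth ord0)|exact: (measurable_tnth ord_max)].
  by apply.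
have := hsym (t := tt) (fun _ => I) mB.
rewrite /L /two_sided.
have -> : (fun w => [tuple (if 0 <= tt i then L1 (tt i) w else - lim (L2 s w @[s --> (- tt i)^'-])) | i < 2]) @^-1` B
   = (fun w => L1 t w - L1 s w) @^-1` A.
  by apply/seteqP; split=> w; rewrite /preimage/B/= !tnth_mktuple /tt/= s0 t0.
move=> ->; congr (P _); apply/seteqP; split=> w; rewrite /preimage/B/= !tnth_mktuple /tt/= s0 t0;
  by rewrite opprB opprK addrC.
Qed.

Lemma increment_tail s t : 0 <= s -> s <= t -> t - s <= h0 ->
  c * (t - s) <= fine (P [set w | eps < `|L1 t w - L1 s w|]).
Proof.
move=> s0 st th0; have mB : measurable [set y : R | eps < `|y|] by exact: measurable_norm_gt.
have ts0 : 0 <= t - s by rewrite subr_ge0.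
have := levy_stationary hL1 s0 ts0 mB.
rewrite [s + _]addrC subrK => E.
by rewrite [X in P X](_ : _ = (fun w => L1 t w - L1 s w) @^-1` [set y | eps < `|y|])// E tail// ts0.
Qed.

(** Good cells of total length 1/2 contain a big increment with probability at least 1 - exp(- c /
    2). The sign flip takes one half of it, the passage from step integrals to Wiener integrals
    another half. *)
Let kappa := (1 - expR (- (c / 2))) / 4.

Lemma kappa_gt0 : 0 < kappa.
Proof. by rewrite divr_gt0// subr_gt0 expR_lt1 oppr_lt0 divr_gt0. Qed.

(** The good cells fill at least half of ]0, 1]: outside them the sum of squares in the closeness
    hypothesis is at least 1, so by Markov's inequality this happens on a set of measure at most
    1/2. *)
Lemma step_exceed (q : nat) (f : 'I_q -> R -> R) (phi : 'I_q -> step) (M : R) :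
  0 < M -> (forall i, measurable_fun setT (f i)) -> (forall i, wf_step (phi i)) ->
  (forall y, 0 < y <= 1 -> exists i, M + 1 <= f i y) ->
  (\int[@lebesgue_measure R]_x (\sum_(i < q) (f i x - step_fun (phi i) x) ^+ 2)%:E <= (1 / 2)%:E)%E ->
  2 * kappa <= fine (P (\bigcup_(i in [set: 'I_q])
    [set w | M * eps < `|recentered_integral L1 L2 (phi i) w|])).
Proof.
move=> M0 mf wf fM close.
have [N N0 Nh0] : exists2 N : nat, (0 < N)%N & N%:R^-1 <= h0.
  exists (Num.truncn h0^-1).+1 => //.
  by rewrite invf_ple ?posrE ?ltr0n// ltW// truncnS_gt.
have N0R : 0 < N%:R :> R by rewrite ltr0n.
pose pts := flatten [seq flatten [seq [:: p.1.2; p.2] | p <- phi i] | i <- enum 'I_q].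
(* The multiples of 1/N keep the cells of [0, 1] within the range [h0] of the tail estimate; the
   endpoints make all step functions constant on each cell. *)
pose A := 0 :: [seq k%:R / N%:R | k <- iota 0 N.+1] ++ [seq a <- pts | 0 <= a].
have A0 : 0 \in A by rewrite mem_head.
have Age a : a \in A -> 0 <= a.
  rewrite inE => /orP[/eqP ->//|]; rewrite mem_cat => /orP[/mapP[k _ ->]|].
    by rewrite divr_ge0.
  by rewrite mem_filter => /andP[].
have [n [t [t0 tmono tA tinA]]] := exists_grid A0 Age.
have t0' : 0 <= t 0%N by rewrite t0.
have ong i p : p \in phi i -> on_grid n t p.1.2 /\ on_grid n t p.2.
  move=> pphi; have H a : a \in [:: p.1.2; p.2] -> on_grid n t a.
    move=> ap; have [a0|a0] := ltP a 0; [by left|right].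
    apply: tA; rewrite inE mem_cat mem_filter a0/=; apply/orP; right; apply/orP; right.
    apply/flattenP; eexists; first by apply/mapP; exists i; rewrite ?mem_enum.
    by apply/flattenP; eexists; [apply/mapP; exists p; [exact: pphi|reflexivity]|exact: ap].
  by split; apply: H; rewrite !inE eqxx ?orbT.
pose good (k : 'I_n) := [&& t k < t k.+1, t k.+1 <= 1 & [exists i, M < step_fun (phi i) (t k.+1)]].
(* In a cell longer than 1/N, the first multiple of 1/N above [t k] would be a grid point strictly
   inside. *)
have mesh (k : 'I_n) : t k.+1 <= 1 -> t k.+1 - t k <= h0.
  move=> tk1; apply: le_trans Nh0; rewrite leNgt; apply/negP => H.
  have tk0 : 0 <= t k by rewrite -t0 tmono.
  pose j := (Num.truncn (N%:R * t k)).+1.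
  have j1 : t k < j%:R / N%:R by rewrite ltr_pdivlMr// mulrC truncnS_gt.
  have j2 : j%:R / N%:R <= t k + N%:R^-1.
    rewrite ler_pdivrMr// mulrDl mulVf ?gt_eqF// -natr1 lerD2r mulrC.
    by rewrite truncn_le// mulr_ge0.
  have j3 : j%:R / N%:R < t k.+1 by rewrite (le_lt_trans j2)// -ltrBrDl.
  have jN : (j <= N)%N.
    rewrite -(ler_nat R) -[leRHS]mul1r -ler_pdivrMr// (le_trans (ltW j3))//.
  have [m _ tm] : exists2 m, (m <= n)%N & t m = j%:R / N%:R.
    apply: tA; rewrite inE mem_cat; apply/orP; right; apply/orP; left.
    by apply/mapP; exists j => //; rewrite mem_iota.
  have [mk|km] := leqP m k.
    by move: j1; rewrite -tm ltNge tmono.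
  by move: j3; rewrite -tm ltNge tmono.
have tge k : 0 <= t k by rewrite -t0 tmono.
have tail' (k : 'I_n) : good k -> c * (t k.+1 - t k) <= fine (P [set w | eps < `|increment L1 t k w|]).
  by move=> /and3P[tk tk1 _]; apply: increment_tail => //; [exact: ltW|exact: mesh].
have decomp (k : 'I_n) : good k -> exists (i : 'I_q) (ph : R) (B : T -> R), [/\ 0 < ph, M * eps <= ph * eps,
    measurable_fun setT (B : g_sigma_algebraType (off_events L1 L2 t k) -> R) &
    forall w, recentered_integral L1 L2 (phi i) w = ph * increment L1 t k w + B w].
  move=> /and3P[tk _ /existsP[i Mi]].
  have [B [mB BE]] := recentered_integral_decomp L1 hL2 t0 tmono (wf i) tk (ong i).
  exists i, (step_fun (phi i) (t k.+1)), B; split=> //.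
  - exact: lt_trans Mi.
  - by rewrite ler_wpM2r// ltW.
have := exceed_ge hL1 hL2 hind t0' tmono
  (fun i => recentered_integral_measurable hL1 hL2 (phi i)) tail'
  (fun k A mA => increment_symmetric (tge _) (tge _) mA) decomp.
apply: le_trans.
have good_length : 1 / 2 <= \sum_(k < n | good k) (t k.+1 - t k).
  pose psi x := \sum_(i < q) (f i x - step_fun (phi i) x) ^+ 2.
  have mpsi : measurable_fun setT psi.
    apply: measurable_sum => i; apply: measurable_funX; apply: measurable_funB => //.
    exact: measurable_step_fun.
  have psi0 x : 0 <= psi x by apply: sumr_ge0 => i _; exact: sqr_ge0.
  have bad_le := le_trans (measure_ge1_le (@lebesgue_measure R) mpsi psi0) close.
  have mbad : measurable [set x | 1 <= psi x] by exact: measurable_ge.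
  pose cell (k : 'I_n) : set (measurableTypeR R) := `]t k, t k.+1]%classic.
  have fin : finite_set [set k | good k] by exact: finite_finset.
  have mcells : measurable (\bigcup_(k in [set k | good k]) cell k).
    by apply: fin_bigcup_measurable => // k _; exact: measurable_itv.
  have cover : `]0, 1]%classic `<=` [set x | 1 <= psi x] `|` \bigcup_(k in [set k | good k]) cell k.
    move=> y; rewrite /= in_itv/= => /andP[y0 y1].
    have [m mn tm] : exists2 m, (m <= n)%N & t m = 1.
      apply: tA; rewrite inE mem_cat; apply/orP; right; apply/orP; left.
      by apply/mapP; exists N; rewrite ?divff ?gt_eqF// mem_iota/= add0n.
    have y1' : y <= t m by rewrite tm.
    have y0' : t 0%N < y by rewrite t0.
    have [k km /andP[tky ytk]] := grid_cell y0' y1'.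
    have kn : (k < n)%N by exact: leq_trans mn.
    have tk1 : t k.+1 <= 1 by rewrite -tm tmono.
    (* No grid point lies strictly inside the cell, so y and its right endpoint are on the same side
       of every endpoint of the step function. *)
    have sE i : step_fun (phi i) y = step_fun (phi i) (t k.+1).
      rewrite !step_funE// big_seq [RHS]big_seq; apply: eq_bigr => p pphi.
      have same a : on_grid n t a -> (y <= a) = (t k.+1 <= a).
        move=> ga; apply/idP/idP => [|/(le_trans ytk)//].
        case: ga => [a0 ya|[j _ <-]].
          by have := lt_le_trans (lt_le_trans y0 ya) (ltW a0); rewrite ltxx.
        have [jk|kj _] := leqP j k; last exact: tmono.
        by move=> ya; have := lt_le_trans tky (le_trans ya (tmono _ _ jk)); rewrite ltxx.
      by have [g1 g2] := ong i p pphi; rewrite !same.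
    have [gk|gk] := boolP (good (Ordinal kn)).
      by right; exists (Ordinal kn) => //=; rewrite /cell /= in_itv/= tky.
    (* In a bad cell all step functions are at most M, while some [f i y >= M + 1]: the square of
       index i alone is at least 1. *)
    left; move: gk; rewrite /good/= (lt_le_trans tky ytk) tk1/= => /existsPn H.
    have [|i fi] := fM y; first by rewrite y0.
    have r0 : 0 <= \sum_(i' < q | i' != i) (f i' y - step_fun (phi i') y) ^+ 2.
      by apply: sumr_ge0 => i' _; exact: sqr_ge0.
    have := H i; rewrite -leNgt -sE => Hi.
    by rewrite /psi (bigD1 i)//=; nra.
  have l1 : (@lebesgue_measure R `]0%R, 1%R]%classic = 1)%E.
    by rewrite lebesgue_measure_itv/= lte_fin ltr01 oppr0 adde0.
  have : (1 <= (1 / 2)%:E + \sum_(k \in [set k | good k]) (t k.+1 - t k)%:E)%E.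
    pose U : set (measurableTypeR R) := [set x | 1 <= psi x] `|` \bigcup_(k in [set k | good k]) cell k.
    rewrite -l1; apply: (@le_trans _ _ (@lebesgue_measure R U)).
      apply: le_measure; rewrite ?inE; [exact: measurable_itv|exact: measurableU|exact: cover].
    have mbad' : measurable ([set x | 1 <= psi x] : set (measurableTypeR R)) by exact: mbad.
    have h := measureU2 (@lebesgue_measure R) mbad' mcells.
    apply: (le_trans h); apply: leeD => //.
    apply: (le_trans (content_sub_fsum _ fin _ mcells (@subset_refl _ _))).
      by move=> k _; exact: measurable_itv.
    apply: lee_fsum => // k /and3P[tk _ _].
    rewrite le_eqVlt; apply/orP; left; apply/eqP.
    transitivity (@lebesgue_measure R `]t k, t k.+1]%classic) => //.
    by rewrite lebesgue_measure_itv/= lte_fin tk.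
  rewrite fsumEFin// -EFinD lee_fin.
  by rewrite fsbig_ord_pred => H; lra.
have -> : 2 * kappa = (1 - expR (- (c / 2))) / 2 by rewrite /kappa; field.
rewrite ler_pM2r// lerD2l lerN2 ler_expR lerN2 ler_pM2l//.
by move: good_length; rewrite div1r.
Qed.

Lemma two_sided_measurable p : measurable_fun setT (L p).
Proof.
have := recentered_measurable hL1 hL2 p; rewrite /recentered /L /two_sided.
have [p0|//] := leP 0 p => _.
exact: levy_measurable hL1 _ _.
Qed.

Lemma step_integral_measurable (phi : step) : measurable_fun setT (step_integral L phi).
Proof.
rewrite /step_integral; apply: measurable_sum => p; apply: measurable_funM => //.
by apply: measurable_funB; exact: two_sided_measurable.
Qed.

(** One index n serves all the finitely many integrals. Markov's inequality at distance 1 explains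
    the threshold [M * eps - 1]; the exceptional event has probability at most [kappa], half of what
    [step_exceed] provides. *)
Lemma wiener_exceed (q : nat) (f : 'I_q -> R -> R) (I : 'I_q -> T -> R) (M : R) :
  0 < M -> (forall i, is_wiener_integral P L (f i) (I i)) ->
  (forall y, 0 < y <= 1 -> exists i, M + 1 <= f i y) ->
  kappa <= fine (P (\bigcup_(i in [set: 'I_q]) [set w | M * eps - 1 < `|I i w|])).
Proof.
move=> M0 hI fM.
have mf i : measurable_fun setT (f i) by have [[]] := hI i.
have mI i : measurable_fun setT (I i) by have [] := hI i.
have /choice[phi hphi] : forall i, exists phi : nat -> step, [/\ forall n, wf_step (phi n),
    (\int[@lebesgue_measure R]_x ((f i x - step_fun (phi n) x) ^+ 2)%:E @[n --> \oo] --> 0)%E &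
    ('E_P[fun w => ((I i w - step_integral L (phi n) w) ^+ 2)%R] @[n --> \oo] --> 0)%E].
  by move=> i; have [_ _] := hI i.
have q0 : 0 < q.+1%:R :> R by rewrite ltr0n.
(* The tolerances are shared among the q integrals, so that the errors add up to at most 1/2 and
   [kappa]; [q.+1] is a divisor that never vanishes. *)
pose e1 : R := 1 / 2 / q.+1%:R; pose e2 := kappa / q.+1%:R.
have e1_gt0 : 0 < e1 by rewrite !divr_gt0.
have e2_gt0 : 0 < e2 by rewrite divr_gt0// kappa_gt0.
have qle (x : R) : 0 < x -> q%:R * (x / q.+1%:R) <= x.
  by move=> x0; rewrite mulrCA ler_piMr ?(ltW x0)// ler_pdivrMr// mul1r ler_nat.
have [n Hn] : exists n, forall i,
    (\int[@lebesgue_measure R]_x ((f i x - step_fun (phi i n) x) ^+ 2)%:E < e1%:E)%E /\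
    (\int[P]_w ((I i w - step_integral L (phi i n) w) ^+ 2)%:E < e2%:E)%E.
  have : \forall n \near \oo, forall i,
    (\int[@lebesgue_measure R]_x ((f i x - step_fun (phi i n) x) ^+ 2)%:E < e1%:E)%E /\
    (\int[P]_w ((I i w - step_integral L (phi i n) w) ^+ 2)%:E < e2%:E)%E.
    apply: filter_forall => i; have [_ c1 c2] := hphi i.
    apply: filterI; first exact: cvge_lt_near c1.
    by rewrite unlock in c2; exact: cvge_lt_near c2.
  by move=> /filter_ex.
pose Z i w := (I i w - recentered_integral L1 L2 (phi i n) w) ^+ 2.
have mZ i : measurable_fun setT (Z i).
  apply: measurable_funX; apply: measurable_funB => //.
  exact: (recentered_integral_measurable hL1 hL2).
have PZ i : (P [set w | (1 <= Z i w)%R] <= e2%:E)%E.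
  apply: (le_trans (measure_ge1_le P (mZ i) _)); first by move=> w; exact: sqr_ge0.
  apply: ltW; rewrite (le_lt_trans _ (Hn i).2)//.
  rewrite le_eqVlt; apply/orP; left; apply/eqP; apply: ae_eq_integral => //.
  - exact/measurable_EFinP.
  - apply/measurable_EFinP/measurable_funX/measurable_funB => //.
    exact: step_integral_measurable.
  apply: filterS (recentered_integral_ae L2 hL1 (phi i n)) => w E _.
  by rewrite /Z -E.
have := step_exceed M0 mf (fun i => (let: And3 w _ _ := hphi i in w) n) fM _.
have close : (\int[@lebesgue_measure R]_x
    (\sum_(i < q) (f i x - step_fun (phi i n) x) ^+ 2)%:E <= (1 / 2)%:E)%E.
  under eq_integral do rewrite -sumEFin.
  rewrite ge0_integral_sum//; last 2 first.
  - move=> i; apply/measurable_EFinP/measurable_funX/measurable_funB.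
      exact: mf.
    exact: measurable_step_fun.
  - by move=> i x _; rewrite lee_fin sqr_ge0.
  apply: (@le_trans _ _ (\sum_(i < q) e1%:E)%E).
    by apply: lee_sum => i _; exact: ltW (Hn i).1.
  rewrite sumEFin lee_fin sumr_const card_ord -[e1 *+ q]mulr_natl.
  by apply: qle; rewrite divr_gt0.
move=> /(_ close) H.
pose A := \bigcup_(i in [set: 'I_q]) [set w | M * eps - 1 < `|I i w|].
have mA : measurable A.
  by apply: fin_bigcup_measurable => // i _; exact: measurable_norm_gt.
pose B := \bigcup_(i in [set i : 'I_q | xpredT i]) [set w | 1 <= Z i w].
have mZ1 i : measurable [set w | 1 <= Z i w] by exact: measurable_ge.
have mB : measurable B by exact: fin_bigcup_measurable.
set C := \bigcup_(_ in _) _ in H.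
have mC : measurable C.
  apply: fin_bigcup_measurable => // i _; apply: measurable_norm_gt.
  exact: (recentered_integral_measurable hL1 hL2).
have CAB : C `<=` A `|` B.
  move=> w [i _ /= Mw].
  have [Zw|Zw] := leP 1 (Z i w); [by right; exists i|left; exists i => //=].
  have : `|I i w - recentered_integral L1 L2 (phi i n) w| < 1.
    by rewrite -(@ltr_pXn2r _ 2)// ?nnegrE// expr1n real_normK ?num_real.
  have := ler_distD (I i w) 0 (recentered_integral L1 L2 (phi i n) w).
  by rewrite !sub0r !normrN; lra.
have PB : (P B <= kappa%:E)%E.
  have finq : finite_set [set i : 'I_q | xpredT i] by exact: finite_finset.
  apply: (le_trans (content_sub_fsum _ finq _ mB (@subset_refl _ _))) => //.
  rewrite fsbig_ord_pred; apply: (@le_trans _ _ (\sum_(i < q) e2%:E)%E).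
    by apply: lee_sum => i _; exact: PZ.
  rewrite sumEFin lee_fin sumr_const card_ord -[e2 *+ q]mulr_natl.
  by apply: qle; exact: kappa_gt0.
have : (P C <= P A + kappa%:E)%E.
  apply: (@le_trans _ _ (P (A `|` B))).
    by apply: le_measure; rewrite ?inE//; exact: measurableU.
  by rewrite (le_trans (measureU2 _ mA mB))// leeD2l.
rewrite -[P C]fineK ?fin_num_measure// -[P A]fineK ?fin_num_measure// -EFinD lee_fin.
by move=> ?; rewrite -/A; lra.
Qed.

End local_unboundedness.

(** * Improper integrals *)

Section reflection_invariance.
Context {R : realType}.
Let mu := @lebesgue_measure R.

Let reflect (t : R) : measurableTypeR R -> measurableTypeR R := fun x => t - x.

Let mreflect t : measurable_fun setT (reflect t).
Proof. by apply: measurable_funB. Qed.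

Lemma lebesgue_measure_reflect t (A : set R) : measurable A ->
  mu ((fun x => t - x) @^-1` A) = mu A.
Proof.
move=> mA.
pose phi : {mfun measurableTypeR R >-> measurableTypeR R} := mfun_Sub (mem_set (mreflect t)).
apply/esym.
apply: (@lebesgue_measure_unique R (pushforward mu phi)) => // _ [[a b] _ <-].
transitivity (mu ((fun x => t - x) @^-1` `]a, b]%classic)) => //.
have -> : (fun x => t - x) @^-1` `]a, b]%classic = `[t - b, t - a[%classic.
  apply/seteqP; split=> x /=; rewrite !in_itv/= => /andP[h1 h2]; apply/andP; split; lra.
rewrite /mu !lebesgue_measure_itv/= !lte_fin.
have -> : (t - b < t - a) = (a < b) by rewrite ltrD2l ltrN2.
case: ifP => // _; rewrite -!EFinB; congr EFin; ring.
Qed.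

Lemma ge0_integral_reflect t (f : R -> \bar R) : measurable_fun setT f ->
  (forall x, 0 <= f x)%E -> (\int[mu]_x f (t - x)%R = \int[mu]_x f x)%E.
Proof.
move=> mf f0.
pose phi : {mfun measurableTypeR R >-> measurableTypeR R} := mfun_Sub (mem_set (mreflect t)).
have := @ge0_integral_pushforward _ _ _ _ R phi (mreflect t) mu setT f measurableT mf (fun x _ => f0 x).
rewrite preimage_setT => <-; apply: eq_measure_integral => A mA _.
exact/lebesgue_measure_reflect.
Qed.

Lemma integrable_reflect t (f : R -> R) : mu.-integrable setT (EFin \o f) ->
  mu.-integrable setT (fun x => (f (t - x))%:E).
Proof.
move=> /integrableP[mf fi]; apply/integrableP; split.
  exact: (measurableT_comp mf (mreflect t)).
by rewrite (@ge0_integral_reflect t (fun x => `|(f x)%:E|%E))//; exact: measurableT_comp.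
Qed.

Lemma integral_reflect t (f : R -> R) : mu.-integrable setT (EFin \o f) ->
  (\int[mu]_x (f (t - x)%R)%:E = \int[mu]_x (f x)%:E)%E.
Proof.
move=> fi; have /integrableP[mf _] := fi.
pose phi : {mfun measurableTypeR R >-> measurableTypeR R} := mfun_Sub (mem_set (mreflect t)).
have := @integral_pushforward _ _ _ _ R phi (mreflect t) mu setT (EFin \o f) mf
  (integrable_reflect t fi) measurableT.
rewrite preimage_setT => <-; apply: eq_measure_integral => A mA _.
exact/lebesgue_measure_reflect.
Qed.

End reflection_invariance.

Section improper_integrals.
Context {R : realType}.
Let mu := @lebesgue_measure R.
Implicit Types (f F : R -> R) (a b : R).

Section antiderivative.
Variables (f F : R -> R) (b : R).
Hypothesis b0 : 0 < b.
Hypothesis dF : forall x : R, 0 < x -> is_derive x 1 F (f x).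
Hypothesis cf : forall x : R, 0 < x -> {for x, continuous f}.
Hypothesis F0 : F x @[x --> 0^'+] --> F 0.

(** With [n.+2] every cut-off is strictly below b, so the segment to which the fundamental theorem
    applies is nondegenerate. *)
Let u n : R := b / n.+2%:R.

Let u_gt0 n : 0 < u n. Proof. by rewrite divr_gt0. Qed.

Let ub n : u n < b.
Proof. by rewrite ltr_pdivrMr ?ltr0n// ltr_pMr// ltr1n. Qed.

Let cF x : 0 < x -> {for x, continuous F}.
Proof.
move=> x0; apply: differentiable_continuous; apply/derivable1_diffP.
by have [] := dF x0.
Qed.

Let FTCn n : (\int[mu]_(x in `[u n, b]) (f x)%:E = (F b - F (u n))%:E)%E.
Proof.
rewrite EFinB; apply: continuous_FTC2; first exact: ub.
- apply: continuous_in_subspaceT => x /set_mem/=; rewrite in_itv/= => /andP[ux _].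
  by apply: cf; exact: lt_le_trans ux.
- split.
  + by move=> x; rewrite in_itv/= => /andP[ux _]; have [] := dF (lt_trans (u_gt0 n) ux).
  + exact/cvg_at_right_filter/cF.
  + exact/cvg_at_left_filter/cF.
- move=> x; rewrite in_itv/= => /andP[ux _].
  by rewrite derive1E; have [_] := dF (lt_trans (u_gt0 n) ux).
Qed.

Let fn n x := ((f \_ `[u n, b]) x)%:E.

Let mf : measurable_fun `]0, b]%classic f.
Proof.
apply: subspace_continuous_measurable_fun; first exact: measurable_itv.
apply: continuous_in_subspaceT => x /set_mem/=; rewrite in_itv/= => /andP[x0 _].
exact: cf.
Qed.

Let sub n : `[u n, b]%classic `<=` `]0, b]%classic.
Proof.
by move=> x; rewrite /= !in_itv/= => /andP[ux ->]; rewrite (lt_le_trans (u_gt0 n) ux).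
Qed.

Let mfn n : measurable_fun setT (fn n).
Proof.
apply/measurable_EFinP; apply/(measurable_restrictT _ _).1.
  exact: measurable_itv.
exact: measurable_funS (@sub n) mf.
Qed.

Let u_cvg : u n @[n --> \oo] --> 0.
Proof. exact: cvg_divn2. Qed.

Let Fn_cvg : ((F b - F (u n))%:E @[n --> \oo] --> (F b - F 0)%:E)%E.
Proof.
apply: cvg_EFin; first by apply: nearW.
apply: cvgB; first exact: cvg_cst.
by have /cvg_at_rightP := F0; apply; split.
Qed.

Let fn_cvg x : fn n x @[n --> \oo] --> ((f \_ `]0, b]) x)%:E.
Proof.
apply: cvg_near_cst; rewrite /fn !patchE.
have [xb|xb] := boolP (x \in `]0, b]%classic).
  move: xb; rewrite inE/= in_itv/= => /andP[x0 xb].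
  have : \forall n \near \oo, u n < x.
    by have := u_cvg; move=> /(@cvgr_lt _ _ _ _ _ _ ) /(_ _ x0).
  by apply: filterS => n un; rewrite patchE mem_set//= in_itv/= xb (ltW un).
apply: nearW => n; rewrite patchE memNset// => /(@sub n) H.
by move/negP: xb; apply; exact/mem_set.
Qed.

Let int_fn n : (\int[mu]_x fn n x = (F b - F (u n))%:E)%E.
Proof.
rewrite -FTCn [RHS]integral_mkcond; apply: eq_integral => x _.
by rewrite /fn !patchE; case: ifP.
Qed.

Let int_f : (\int[mu]_(x in `]0%R, b]) (f x)%:E = \int[mu]_x ((f \_ `]0, b]) x)%:E)%E.
Proof.
rewrite integral_mkcond; apply: eq_integral => x _.
by rewrite !patchE; case: ifP.
Qed.

(** The integrand may blow up at 0: the fundamental theorem is applied on the segments [[u n, b]],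
    which increase to ]0, b], and monotone convergence concludes. *)
Lemma ge0_improper_FTC : (forall x, 0 < x <= b -> 0 <= f x) ->
  (\int[mu]_(x in `]0%R, b]) (f x)%:E = (F b - F 0)%:E)%E.
Proof.
move=> f0.
have fn0 n x : setT x -> (0 <= fn n x)%E.
  move=> _; rewrite /fn lee_fin patchE; case: ifPn => // /set_mem/=; rewrite in_itv/= => /andP[ux xb].
  by rewrite f0// xb andbT (lt_le_trans _ ux).
have nd x : setT x -> {homo fn ^~ x : n m / (n <= m)%N >-> (n <= m)%E}.
  move=> _ n m nm; rewrite /fn lee_fin !patchE.
  have [xn|xn] := boolP (x \in `[u n, b]%classic); last first.
    by have := fn0 m x I; rewrite /fn lee_fin patchE.
  rewrite mem_set//=; move/set_mem: xn; rewrite /= !in_itv/= => /andP[ux ->]; rewrite andbT.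
  by rewrite (le_trans _ ux)// ler_pM2l// lef_pV2 ?posrE ?ltr0n// ler_nat.
have := cvg_monotone_convergence (mu := mu) measurableT mfn fn0 nd.
under eq_integral do rewrite (cvg_lim _ (@fn_cvg _))//.
under eq_fun do rewrite int_fn.
by move=> H; rewrite int_f; exact: cvg_unique H Fn_cvg.
Qed.

(** The variant by dominated convergence, for integrands that change sign, such as the derivative of
    the tempered power. *)
Lemma improper_FTC : mu.-integrable `]0, b] (EFin \o f) ->
  (\int[mu]_(x in `]0%R, b]) (f x)%:E = (F b - F 0)%:E)%E.
Proof.
move=> fi.
have fi0 : mu.-integrable setT ((EFin \o f) \_ `]0, b]).
  have /integrableP[mEf fioo] := fi.
  apply/integrableP; split; first by apply/(measurable_restrictT _ _).1 => //; exact: measurable_itv.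
  rewrite [ltLHS](_ : _ = (\int[mu]_(x in `]0%R, b]) `|(EFin \o f) x|)%E)//.
  rewrite [RHS]integral_mkcond; apply: eq_integral => x _.
  by rewrite !patchE; case: ifP => //; rewrite abse0.
have fi' := integrable_abse fi0.
have mF : measurable_fun setT (fun x => ((f \_ `]0, b]) x)%:E).
  apply/measurable_EFinP; apply/(measurable_restrictT _ _).1; first exact: measurable_itv.
  exact: mf.
have dom (x : R) n : setT x -> (`|fn n x| <= (abse \o ((EFin \o f) \_ `]0%R, b])) x)%E.
  move=> _; rewrite /fn patchE; case: ifPn => [xn|_]; last by rewrite abse0 abse_ge0.
  by rewrite /= patchE mem_set//; apply: (@sub n); exact/set_mem.
have cae : {ae mu, forall x, setT x -> fn n x @[n --> \oo] --> ((f \_ `]0, b]) x)%:E}.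
  by apply: aeW => x _; exact: fn_cvg.
have dae : {ae mu, forall x n, setT x -> (`|fn n x| <= (abse \o ((EFin \o f) \_ `]0%R, b])) x)%E}.
  by apply: aeW => x n _; exact: dom.
have [_ _] := @dominated_convergence _ _ _ mu setT measurableT fn
  (fun x => ((f \_ `]0, b]) x)%:E) (abse \o ((EFin \o f) \_ `]0, b])) mfn mF cae fi' dae.
under eq_fun do rewrite int_fn.
by move=> H; rewrite int_f; exact: cvg_unique H Fn_cvg.
Qed.

End antiderivative.

Lemma continuous_powR_gt0 p x : 0 < x -> {for x, continuous (fun y : R => y `^ p)}.
Proof.
move=> x0; apply: differentiable_continuous; apply/derivable1_diffP.
by have [] := is_derive1_powR p x0.
Qed.

Lemma integral_powR p b : 0 < p -> 0 < b ->
  (\int[mu]_(x in `]0%R, b]) (x `^ (p - 1))%:E = (b `^ p / p)%:E)%E.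
Proof.
move=> p0 b0.
have -> : b `^ p / p = p^-1 * b `^ p - p^-1 * 0 `^ p.
  by rewrite powR0 ?gt_eqF// mulr0 subr0 mulrC.
apply: (@ge0_improper_FTC (fun x => x `^ (p - 1)) (fun x => p^-1 * x `^ p) b) => //.
- move=> x x0; have H := is_deriveZ p^-1 (is_derive1_powR p x0).
  have -> : x `^ (p - 1) = p^-1 *: (p * x `^ (p - 1)).
    by rewrite /GRing.scale/= mulrA mulVf ?mul1r// gt_eqF.
  exact: H.
- by move=> x x0; exact: continuous_powR_gt0.
- rewrite powR0 ?gt_eqF// mulr0 -[X in _ --> X](mulr0 p^-1); apply: cvgM; first exact: cvg_cst.
  exact: powR_cvg0.
- by move=> x _; exact: powR_ge0.
Qed.

Lemma integral_expRN c : 0 < c ->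
  (\int[mu]_(x in `]0%R, +oo[) (expR (- (c * x)))%:E = (c^-1)%:E)%E.
Proof.
move=> c0.
have dE (x : R) : is_derive x 1 (fun x => - c^-1 * expR (- (c * x))) (expR (- (c * x))).
  have h : is_derive x 1 (fun x => - (c * x)) (- c).
    by apply: is_derive_eq; rewrite scaler1.
  have H := is_deriveZ (- c^-1) (@is_derive1_comp R expR (fun x => - (c * x)) x _ _ (is_derive_expR (- (c * x))) h).
  have -> : expR (- (c * x)) = - c^-1 *: (expR (- (c * x)) * - c).
    by rewrite /GRing.scale/= mulrN mulrNN mulrCA mulVf ?mulr1// gt_eqF.
  exact: H.
have cE : continuous (fun x : R => expR (- (c * x))).
  move=> x; apply: continuous_comp; last exact: continuous_expR.
  by apply: cvgN; apply: cvgM; [exact: cvg_cst|exact: cvg_id].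
rewrite integral_itv_obnd_cbnd; last first.
  by apply/measurable_funTS/measurable_EFinP; exact: continuous_measurable_fun.
rewrite (@ge0_continuous_FTC2y R (fun x => expR (- (c * x))) (fun x => - c^-1 * expR (- (c * x))) 0 0)//.
- by rewrite mulr0 oppr0 expR0 mulr1 sub0e EFinN oppeK.
- exact: continuous_subspaceT.
- rewrite -(mulr0 (- c^-1)); apply: cvgM; first exact: cvg_cst.
  apply: (cvg_comp _ _ _ (@cvgr_expR R)).
  exact: gt0_cvgMry.
- apply: cvg_at_right_filter; apply: cvgM; first exact: cvg_cst.
  exact: (cE 0).
- by move=> x _; rewrite derive1E; have [_] := dE x.
Qed.

Lemma integral_if (i : interval R) (f : R -> R) :
  (\int[mu]_u (if u \in i then f u else 0%R)%:E = \int[mu]_(u in [set` i]) (f u)%:E)%E.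
Proof.
rewrite [RHS]integral_mkcond; apply: eq_integral => u _.
by rewrite patchE mem_setE; case: ifP.
Qed.

Lemma in_oc (b u : R) : (0 < u <= b) = (u \in `]0, b]).
Proof. by rewrite in_itv. Qed.

(** Extended by 0 to the whole line, so that reflections of the variable apply without tracking the
    domain. *)
Definition singular_part (d b u : R) : R := if 0 < u <= b then u `^ (d - 1) else 0.

Definition exponential_tail (c u : R) : R := if 0 < u then expR (- (c * u)) else 0.

Lemma measurable_gt0 : measurable_fun setT (fun u : R => 0 < u).
Proof. exact: measurable_fun_ltr. Qed.

Lemma measurable_oc b : measurable_fun setT (fun u : R => 0 < u <= b).
Proof. by apply: measurable_and; [exact: measurable_gt0|exact: measurable_fun_ler]. Qed.

Lemma measurable_singular_part d b : measurable_fun setT (singular_part d b).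
Proof. by apply: measurable_fun_ifT => //; exact: measurable_oc. Qed.

Lemma measurable_exponential_tail c : measurable_fun setT (exponential_tail c).
Proof.
apply: measurable_fun_ifT => //; first exact: measurable_gt0.
by apply: measurableT_comp => //; apply: measurable_funN; exact: measurable_funM.
Qed.

Lemma singular_part_ge0 d b u : 0 <= singular_part d b u.
Proof. by rewrite /singular_part; case: ifP => // _; exact: powR_ge0. Qed.

Lemma exponential_tail_ge0 c u : 0 <= exponential_tail c u.
Proof. by rewrite /exponential_tail; case: ifP => // _; exact: expR_ge0. Qed.

Lemma integral_singular_part d b : 0 < d -> 0 < b -> (\int[mu]_u (singular_part d b u)%:E = (b `^ d / d)%:E)%E.
Proof.
move=> d0 b0; under eq_integral do rewrite /singular_part in_oc.
by rewrite (integral_if `]0, b] (fun u => u `^ (d - 1))) integral_powR.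
Qed.

Lemma integral_exponential_tail c : 0 < c -> (\int[mu]_u (exponential_tail c u)%:E = (c^-1)%:E)%E.
Proof.
move=> c0; rewrite -(integral_expRN c0) -(integral_if `]0, +oo[ (fun u => expR (- (c * u)))).
by apply: eq_integral => u _; rewrite in_itv/= andbT.
Qed.

Lemma singular_part_integrable d b : 0 < d -> 0 < b -> mu.-integrable setT (EFin \o singular_part d b).
Proof.
move=> d0 b0; apply: (@ge0_integrable _ _ _ _ _ (b `^ d / d)).
- exact: measurable_singular_part.
- by move=> u; exact: singular_part_ge0.
- by rewrite integral_singular_part.
Qed.

Lemma exponential_tail_integrable c : 0 < c -> mu.-integrable setT (EFin \o exponential_tail c).
Proof.
move=> c0; apply: (@ge0_integrable _ _ _ _ _ c^-1).
- exact: measurable_exponential_tail.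
- by move=> u; exact: exponential_tail_ge0.
- by rewrite integral_exponential_tail.
Qed.

(** [Gamma] is the [fine] part of an integral and would be 0 if that integral were infinite, so
    integrability is proved along with the lower bound. For a <= 1 the factor x^(a-1) is at most 1
    beyond x = 1, which gives the majorant. *)
Lemma Gamma_gt0 a : 0 < a -> a <= 1 -> 0 < Gamma a.
Proof.
move=> a0 a1; pose f (x : R) := if x \in `]0, +oo[ then x `^ (a - 1) * expR (- x) else 0.
have -> : Gamma a = (\int[mu]_x f x)%R.
  by rewrite /Rintegral (integral_if `]0, +oo[ (fun x => x `^ (a - 1) * expR (- x))).
have f_bounds x : expR (-1) * singular_part a 1 x <= f x <= singular_part a 1 x + exponential_tail 1 x.
  rewrite /f in_itv/= andbT /singular_part /exponential_tail.
  case: ltP => x0 /=; last by rewrite mulr0 addr0 lexx.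
  have e0 := expR_ge0 (- x); have p0 := powR_ge0 x (a - 1).
  rewrite mul1r; have [x1|x1] := leP x 1.
    rewrite mulrC ler_wpM2l ?ler_expR ?lerN2//= -[leLHS]addr0 lerD//.
    by rewrite ler_piMr// expR_le1 oppr_le0 ltW.
  rewrite mulr0 add0r mulr_ge0//= ler_piMl//.
  by rewrite -[leRHS](powRr0 x) ler_powR ?(ltW x1)// subr_le0.
have si := singular_part_integrable a0 ltr01.
have fi : mu.-integrable setT (EFin \o f).
  have := integrableD measurableT si (exponential_tail_integrable ltr01).
  apply: le_integrable_EFin => [|x].
    rewrite /f; under eq_fun do rewrite in_itv/= andbT.
    apply: measurable_fun_ifT => //; first exact: measurable_gt0.
    apply: measurable_funM; first exact: measurable_powR.
    by apply: measurableT_comp => //; exact: measurable_funN.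
  have /andP[h1 h2] := f_bounds x; rewrite ger0_norm// (le_trans _ h1)//.
  by rewrite mulr_ge0 ?expR_ge0 ?singular_part_ge0.
apply: (@lt_le_trans _ _ (\int[mu]_x (expR (-1) * singular_part a 1 x))%R).
  by rewrite RintegralZl// /Rintegral integral_singular_part//= mulr_gt0 ?expR_gt0 ?divr_gt0 ?powR_gt0.
apply: le_Rintegral => // [|x _]; last by case/andP: (f_bounds x).
exact: (integrableZl measurableT (expR (-1)) si).
Qed.

End improper_integrals.

(** A continuous function is bounded on a segment, so unboundedness gives the discontinuity as
    well. *)
Lemma unbounded_discontinuous (R : realType) (f : R -> R) (b : R) : 0 < b ->
  (forall n : nat, exists2 t, - b <= t <= b & n%:R < `|f t|) -> discontinuous_unbounded f.
Proof.
move=> b0 fub.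
have nb : ~ [bounded f t | t in `[- b, b]].
  move=> [M [_ MP]]; pose K := M + 1.
  have [t tb Kt] := fub (Num.truncn K).+1.
  have fK : `|f t| <= K by apply: (MP K) => /=; rewrite ?in_itv ?ltrDl.
  have := lt_le_trans Kt fK; rewrite ltNge => /negP; apply.
  exact/ltW/truncnS_gt.
split; last by exists b.
move=> cf; apply: nb.
have cK : compact (f @` `[- b, b]%classic).
  apply: continuous_compact; last exact: segment_compact.
  exact: continuous_subspaceT.
have [M [Mr MP]] := compact_bounded cK.
by exists M; split => // K MK t tb; apply: (MP K MK); exists t.
Qed.

(** * Explosion of the kernel and unbounded sample paths *)

Section explosion.
Context {R : realType}.

(** Indices run below [m.+2]: then even y = 1 has a grid time strictly to its right, and all times
    stay in ]0, 2]. *)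
Definition grid_time (m i : nat) : R := i.+1%:R / m.+1%:R.

Lemma grid_time_bound m (i : 'I_m.+2) : - 2 <= grid_time m i <= 2.
Proof.
rewrite /grid_time ler_pdivlMr ?ltr0n// ler_pdivrMr ?ltr0n//; apply/andP; split.
  by rewrite (@le_trans _ _ 0)// mulNr oppr_le0 mulr_ge0.
by rewrite -natrM ler_nat; apply: leq_trans (ltn_ord i) _; rewrite mul2n -addnn addSn addnS !ltnS leq_addr.
Qed.

Lemma grid_time_above m (y : R) : 0 < y <= 1 ->
  exists i : 'I_m.+2, 0 < grid_time m i - y <= m.+1%:R^-1.
Proof.
move=> /andP[y0 y1].
have Ny0 : 0 <= m.+1%:R * y by rewrite mulr_ge0// ltW.
have /andP[h1 h2] := truncn_itv Ny0.
set k := Num.truncn _ in h1 h2.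
have km : (k < m.+2)%N.
  rewrite ltnS -(ler_nat R); apply: (le_trans h1).
  by rewrite ler_piMr.
exists (Ordinal km); rewrite /grid_time/=.
have N0 : 0 < m.+1%:R :> R by rewrite ltr0n.
have e : y = m.+1%:R * y / m.+1%:R by rewrite mulrAC divff ?mul1r// gt_eqF.
apply/andP; split.
  by rewrite subr_gt0 e ltr_pM2r ?invr_gt0.
rewrite [in leLHS]e -mulrBl -[leRHS]mul1r ler_pM2r ?invr_gt0//.
by rewrite lerBlDr -natr1 addrC lerD2l.
Qed.

(** For y > 0 the second half of the kernel vanishes; since t - y <= 1, tempering costs at most the
    factor exp(- lambda), and the negative power is at least u^(- d). *)
Lemma tflp_kernel_explosion (d lambda u y t : R) : 0 < lambda -> d < 0 -> 0 < y ->
  0 < t - y <= u^-1 -> 1 <= u -> expR (- lambda) * u `^ (- d) <= tflp_kernel d lambda t y.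
Proof.
move=> l0 d0 y0 /andP[ty tyu] u1.
have u0 : 0 < u by exact: lt_le_trans u1.
rewrite /tflp_kernel /pos_pow ty [0 < - y]ltNge oppr_le0 (ltW y0) mulr0 subr0.
have -> : pos_part (t - y) = t - y by rewrite /pos_part; apply/max_idPl/ltW.
apply: ler_pM; rewrite ?expR_ge0 ?powR_ge0//.
  rewrite ler_expR mulNr lerN2 ler_piMr ?(ltW l0)//.
  by rewrite (le_trans tyu)// invf_le1.
have -> : (t - y) `^ d = (t - y)^-1 `^ (- d).
  by rewrite -(powR_inv1 (ltW ty)) -powRrM mulN1r opprK.
apply: ge0_ler_powR; rewrite ?nnegrE ?oppr_ge0 ?invr_ge0 ?(ltW d0) ?(ltW u0) ?(ltW ty)//.
by rewrite -[leLHS]invrK lef_pV2 ?posrE ?invr_gt0.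
Qed.

Lemma powR_unbounded (p K : R) : 0 < p -> exists m : nat, K <= m.+1%:R `^ p.
Proof.
move=> p0; pose K' := Num.max K 0; exists (Num.truncn (K' `^ p^-1)).
apply: (@le_trans _ _ K'); first by rewrite le_max lexx.
have K0 : 0 <= K' by rewrite le_max lexx orbT.
rewrite [leLHS](_ : K' = (K' `^ p^-1) `^ p); last by rewrite -powRrM mulVf ?powRr1// gt_eqF.
by apply: ge0_ler_powR; rewrite ?nnegrE ?powR_ge0 ?(ltW p0)// ltW// truncnS_gt.
Qed.

Context d (T : measurableType d) (P : probability T R).
Variables (nu : {measure set (measurableTypeR R) -> \bar R}) (L : R -> T -> R).
Hypothesis hL : driving_levy P nu L.

(** For every level j some grid time has |S| > j with probability at least [kappa], a number that
    does not depend on j. These events decrease in j, so their intersection still has probability at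
    least [kappa]. *)
Lemma tflp_unbounded (lambda dd : R) (S : R -> T -> R) : 0 < lambda ->
  - 2^-1 < dd -> dd < 0 -> nu setT != 0%E -> symmetric_fdd P L ->
  is_tflp P L dd lambda S ->
  holds_with_positive_probability P (fun w => discontinuous_unbounded (S ^~ w)).
Proof.
move=> l0 d1 d0 nu0 hsym hS0.
have /choice[I /all_and2[hI hS]] : forall t, exists I0,
    is_wiener_integral P L (tflp_kernel dd lambda t) I0 /\
    S t = (fun w => (Gamma (1 + dd))^-1 * I0 w).
  by move=> t; have [I0 h1 h2] := hS0 t; exists I0.
have [hnu [L1 [L2 [[hL1 hL2] _ hind LE [_ hchar]]]]] := hL.
move: hI hsym hchar; rewrite LE => hI hsym hchar.
have nu00 : nu ((fun x : measurableTypeR R => x) @^-1` [set 0]) = 0%E by have [] := hnu.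
have mid : measurable_fun setT (fun x : measurableTypeR R => x : R) by exact: measurable_id.
have [eps [c [h0 [eps0 c0 h00 tl]]]] :=
  levy_tail_linear P mid (levy_measure_sqr_integrable hnu) nu00 nu0.
have tail h : 0 <= h <= h0 -> c * h <= fine (P [set w | eps < `|L1 h w|]).
  move=> /andP[hh0 hh]; apply: tl; first by rewrite hh0.
    exact: levy_measurable hL1 _ hh0.
  exact: driving_levy_exponent hchar _ hh0.
have G0 : 0 < Gamma (1 + dd) by apply: Gamma_gt0; lra.
pose g0 := (Gamma (1 + dd))^-1; have g00 : 0 < g0 by rewrite invr_gt0.
pose kappa := (1 - expR (- (c / 2))) / 4.
have kap0 : 0 < kappa by exact: kappa_gt0.
pose U (j : nat) := \bigcup_m \bigcup_(i in [set: 'I_m.+2]) [set w | j%:R < `|S (grid_time m i) w|].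
have mS t : measurable_fun setT (S t).
  by rewrite hS; apply: measurable_funM => //; have [] := hI t.
have mA j m (i : 'I_m.+2) : measurable [set w | j%:R < `|S (grid_time m i) w|].
  exact: measurable_norm_gt.
have mU1 j m : measurable (\bigcup_(i in [set: 'I_m.+2]) [set w | j%:R < `|S (grid_time m i) w|]).
  by apply: fin_bigcup_measurable => // i _; exact: mA.
have mU j : measurable (U j) by apply: bigcupT_measurable => m; exact: mU1.
have PU j : (kappa%:E <= P (U j))%E.
  (* Then [M * eps - 1 = j / g0], so exceeding this threshold with the Wiener integral means
     exceeding j with [S]. *)
  pose M := (j%:R / g0 + 1) / eps.
  have M0 : 0 < M by rewrite divr_gt0// ltr_wpDl// divr_ge0// ltW.
  have [m mK] := powR_unbounded (p := - dd) ((M + 1) / expR (- lambda)) ltac:(lra).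
  have hy (y : R) : 0 < y <= 1 ->
      exists i : 'I_m.+2, M + 1 <= tflp_kernel dd lambda (grid_time m i) y.
    move=> /[dup] /andP[y0 _] /(grid_time_above m)[i hi]; exists i.
    apply: le_trans (tflp_kernel_explosion l0 d0 y0 hi _); last by rewrite ler1n.
    by rewrite mulrC -ler_pdivrMr ?expR_gt0.
  have := wiener_exceed hL1 hL2 hind hsym eps0 c0 h00 tail M0
    (fun i : 'I_m.+2 => hI (grid_time m i)) hy.
  rewrite -/kappa => kP.
  set V := (\bigcup_i _) in kP.
  have VU : V `<=` U j.
    move=> w [i _ /= Iw]; exists m => //; exists i => //=; rewrite hS normrM gtr0_norm//.
    move: Iw; rewrite /M divfK ?gt_eqF// addrK ltr_pdivrMr// mulrC.
    by [].
  have mV : measurable V.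
    apply: fin_bigcup_measurable => // i _; apply: measurable_norm_gt.
    by have [] := hI (grid_time m i).
  apply: le_trans (le_measure P _ _ VU); rewrite ?inE//.
  apply: (@le_trans _ _ (fine (P V))%:E); first by rewrite lee_fin.
  by rewrite fineK// fin_num_measure.
pose E := \bigcap_j U j.
have mE : measurable E by apply: bigcapT_measurable.
exists E; split => //.
- have Ucvg : P \o U @ \oo --> P E.
    apply: nonincreasing_cvg_mu => //.
      by rewrite (le_lt_trans (probability_le1 _ _))// ltry.
    move=> j k jk; apply/subsetPset => w [m _ [i _ /= h]]; exists m => //; exists i => //=.
    by apply: le_lt_trans h; rewrite ler_nat.
  have : (kappa%:E <= P E)%E.
    by apply: cvge_ge Ucvg; apply: nearW => j; exact: PU.
  by apply: lt_le_trans; rewrite lte_fin.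
- move=> w Ew; apply: (@unbounded_discontinuous _ _ 2) => // n.
  have [m _ [i _ h]] := Ew n (Logic.I); exists (grid_time m i) => //; exact: grid_time_bound.
Qed.

End explosion.

(** * Integrals of second order random fields *)

Section integrated_field.
Local Open Scope ereal_scope.
Context d1 (X : measurableType d1) d2 (Z : measurableType d2) (R : realType).
Variables (m1 : {sigma_finite_measure set X -> \bar R}) (m2 : {sigma_finite_measure set Z -> \bar R}).
(** [a] bounds the second moments of the field. As [a >= 1], integrability of [k * a] gives that of
    [k], and no square root of a second moment has to appear. *)
Variables (k a : X -> R) (Y : X -> Z -> R).
Hypothesis mk : measurable_fun setT k.
Hypothesis ma : measurable_fun setT a.
Hypothesis a1 : forall x, (1 <= a x)%R.
Hypothesis ka : m1.-integrable setT (fun x => (k x * a x)%:E).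
Hypothesis mY : measurable_fun setT (fun p : X * Z => Y p.1 p.2).
Hypothesis Y2 : forall x, \int[m2]_z (Y x z ^+ 2)%:E <= (a x)%:E.

Let a0 x : (0 <= a x)%R. Proof. exact: le_trans (a1 x). Qed.

Lemma field_measurable x : measurable_fun setT (Y x).
Proof. exact: (measurableT_comp mY (pair1_measurable x)). Qed.

Lemma field_path_measurable z : measurable_fun setT (Y ^~ z).
Proof. exact: (measurableT_comp mY (pair2_measurable z)). Qed.

Lemma field_L2 x : L2fun m2 (Y x).
Proof. by split; [exact: field_measurable|exact: le_lt_trans (Y2 x) (ltry _)]. Qed.

Let Q z := \int[m1]_x (`|k x * Y x z|%R)%:E.
Let A z := \int[m1]_x (`|k x| * Y x z ^+ 2)%R%:E.
Definition integrated_field z : R := (\int[m1]_x (k x * Y x z))%R.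
Let J := integrated_field.

Let mk1 : measurable_fun setT (fun p : X * Z => k p.1).
Proof. exact: measurableT_comp. Qed.

Lemma field_majorant_measurable : measurable_fun setT Q.
Proof.
apply: (@measurable_fun_fubini_tonelli_G _ _ _ _ R m1 (fun p : X * Z => (`|k p.1 * Y p.1 p.2|%R)%:E)) => //.
by apply/measurable_EFinP; apply: measurableT_comp => //; exact: measurable_funM.
Qed.

Let mkY2 : measurable_fun setT (fun p : X * Z => (`|k p.1| * Y p.1 p.2 ^+ 2)%R%:E).
Proof.
apply/measurable_EFinP; apply: measurable_funM; first exact: measurableT_comp.
exact: measurable_funX.
Qed.

Let kY20 (p : X * Z) : 0 <= (`|k p.1| * Y p.1 p.2 ^+ 2)%R%:E.
Proof. by rewrite lee_fin mulr_ge0// sqr_ge0. Qed.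

Let mA : measurable_fun setT A.
Proof. exact: (@measurable_fun_fubini_tonelli_G _ _ _ _ R m1 _ mkY2 kY20). Qed.

Let kabs_int : m1.-integrable setT (fun x => (`|k x| * a x)%R%:E).
Proof.
have := integrable_abse ka; congr (_.-integrable _ _).
by apply/funext => x; rewrite /= normrM (ger0_norm (a0 x)).
Qed.

Let kabs_lty : \int[m1]_x (`|k x| * a x)%R%:E < +oo.
Proof. by rewrite -Rintegral_fineK// ltry. Qed.

Let kint : m1.-integrable setT (fun x => (`|k x|%R)%:E).
Proof.
apply: le_integrable_EFin kabs_int; first exact: measurableT_comp.
by move=> x; rewrite normr_id ler_peMr.
Qed.

Let N : R := (\int[m1]_x `|k x|)%R.

Let NE : N%:E = \int[m1]_x (`|k x|%R)%:E. Proof. exact: Rintegral_fineK. Qed.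

Let N0 : (0 <= N)%R. Proof. exact: Rintegral_ge0. Qed.

Let A_int : \int[m2]_z A z <= \int[m1]_x (`|k x| * a x)%R%:E.
Proof.
rewrite -(fubini_tonelli (fun p : X * Z => (`|k p.1| * Y p.1 p.2 ^+ 2)%R%:E))//=.
apply: ge0_le_integral => //=.
- by move=> x _; apply: integral_ge0 => z _; exact: (kY20 (x, z)).
- exact: (@measurable_fun_fubini_tonelli_F _ _ _ _ R m2 _ mkY2 kY20).
- by apply/measurable_EFinP; apply: measurable_funM => //; exact: measurableT_comp.
- move=> x _; under eq_integral do rewrite EFinM.
  rewrite ge0_integralZl_EFin//; last first.
    by apply/measurable_EFinP/measurable_funX; exact: field_measurable.
    by move=> z _; rewrite lee_fin sqr_ge0.
  by rewrite EFinM lee_wpmul2l ?lee_fin.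
Qed.

(** The inequality |y| <= c/2 + y^2/(2c), integrated against |k|; it holds in the extended reals,
    before anything is known to be finite. *)
Let AM_GM z (c : R) : (0 < c)%R -> Q z <= (c / 2 * N)%:E + ((2 * c)^-1)%:E * A z.
Proof.
move=> c0.
have mp := field_path_measurable z.
have mnk : measurable_fun setT (fun x => `|k x|%R) by exact: measurableT_comp.
have c2 : (0 <= (2 * c)^-1)%R by rewrite invr_ge0 mulr_ge0// ltW.
have c3 : (0 <= c / 2)%R by rewrite divr_ge0// ltW.
have mkY := measurable_funM mnk (measurable_funX 2 mp).
rewrite EFinM NE -ge0_integral_linear//; last by move=> x; rewrite mulr_ge0 ?sqr_ge0.
apply: ge0_le_integral_EFin => //.
- by apply: measurableT_comp => //; exact: measurable_funM.
- by apply: measurable_funD; exact: measurable_funM.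
- move=> x; rewrite normrM.
  have -> : (c / 2 * `|k x| + (2 * c)^-1 * (`|k x| * Y x z ^+ 2) =
     `|k x| * (c / 2 + (2 * c)^-1 * Y x z ^+ 2))%R by ring.
  rewrite ler_wpM2l// -subr_ge0 -(real_normK (num_real (Y x z))).
  have -> : (c / 2 + (2 * c)^-1 * `|Y x z| ^+ 2 - `|Y x z| = (2 * c)^-1 * (c - `|Y x z|) ^+ 2)%R.
    by field; rewrite gt_eqF.
  by rewrite mulr_ge0 ?sqr_ge0.
Qed.

Let A_ge0 z : 0 <= A z.
Proof. by apply: integral_ge0 => x _; exact: (kY20 (x, z)). Qed.

Let Q_ge0 z : 0 <= Q z. Proof. exact: integral_ge0. Qed.

(** Cauchy-Schwarz for the measure with density |k|, from the choice c = Q / (N + 1) above. The mass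
    N is increased by 1 to be a positive divisor. *)
Let Q_sqr z : Q z * Q z <= (N + 1)%:E * A z.
Proof.
have N1 : (0 < N + 1)%R by rewrite ltr_wpDl.
case: (A z) (A_ge0 z) (AM_GM z) => [al|_ _|//]; last by rewrite gt0_muley ?leey// lte_fin.
rewrite lee_fin => al0 QA.
have := QA 1%R ltr01; case: (Q z) (Q_ge0 z) QA => [q0|//|//].
rewrite lee_fin le_eqVlt => /predU1P[<-|q0p] QA _.
  by rewrite mule0 -EFinM lee_fin mulr_ge0// ltW.
have := QA (q0 / (N + 1))%R (divr_gt0 q0p N1).
rewrite -!EFinM -EFinD !lee_fin => h.
have h1 : (q0 / (N + 1) / 2 * N <= q0 / 2)%R.
  have -> : (q0 / (N + 1) / 2 * N = q0 / 2 * (N / (N + 1)))%R by ring.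
  by rewrite ler_piMr ?divr_ge0 ?(ltW q0p)// ler_pdivrMr// mul1r lerDl.
have h2 : (q0 / 2 <= (2 * (q0 / (N + 1)))^-1 * al)%R.
  have := lerD h h1; lra.
have : (q0 / 2 * (2 * q0) <= (2 * (q0 / (N + 1)))^-1 * al * (2 * q0))%R.
  by rewrite ler_pM2r// mulr_gt0.
have -> : ((2 * (q0 / (N + 1)))^-1 * al * (2 * q0) = (N + 1) * al)%R.
  by field; rewrite !gt_eqF.
by have -> : (q0 / 2 * (2 * q0) = q0 * q0)%R by field.
Qed.

(** Tonelli on positive and negative parts, so no path has to be integrable. *)
Lemma integrated_field_measurable : measurable_fun setT J.
Proof.
have h : J = fine \o (fun z => \int[m1]_x (k x * Y x z)%R%:E) by [].
rewrite h; apply: measurableT_comp; first exact: fine_measurable.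
pose f (p : X * Z) := (k p.1 * Y p.1 p.2)%:E.
have mf : measurable_fun setT f by apply/measurable_EFinP; exact: measurable_funM.
have -> : (fun z => \int[m1]_x (k x * Y x z)%R%:E) =
    (fun z => \int[m1]_x f^\+ (x, z)) \- (fun z => \int[m1]_x f^\- (x, z)).
  apply/funext => z; rewrite [LHS]integralE.
  by congr (_ - _); apply: eq_integral => x _; rewrite ?funeposE ?funenegE.
apply: emeasurable_funB.
- by apply: measurable_fun_fubini_tonelli_G => //; exact: measurable_funepos.
- by apply: measurable_fun_fubini_tonelli_G => //; exact: measurable_funeneg.
Qed.

Let kY_measurable z : measurable_fun setT (fun x => (k x * Y x z)%R).
Proof. by apply: measurable_funM => //; exact: field_path_measurable. Qed.

Let J_le z : (`|J z|%R)%:E <= Q z.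
Proof.
apply: (@le_trans _ _ `|\int[m1]_x (k x * Y x z)%:E|).
  rewrite /J /integrated_field /Rintegral; case: (\int[m1]_x _) => [r||] /=; rewrite ?lee_fin ?normr0 ?leey//.
exact: (le_abse_integral m1 measurableT ((measurable_EFinP _ _).2 (kY_measurable z))).
Qed.

Let Q2_fin : \int[m2]_z (Q z * Q z) < +oo.
Proof.
apply: (@le_lt_trans _ _ (\int[m2]_z ((N + 1)%:E * A z))).
  apply: ge0_le_integral => //.
  - by move=> z _; rewrite mule_ge0.
  - by apply: emeasurable_funM; exact: field_majorant_measurable.
  - exact: measurable_funeM.
rewrite ge0_integralZl_EFin// ?addr_ge0//.
apply: lte_mul_pinfty; rewrite ?lee_fin ?addr_ge0//.
exact: le_lt_trans A_int kabs_lty.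
Qed.

Lemma integrated_field_L2 : L2fun m2 J.
Proof.
split; first exact: integrated_field_measurable.
apply: le_lt_trans Q2_fin; apply: ge0_le_integral => //.
- by move=> z _; rewrite lee_fin sqr_ge0.
- by apply/measurable_EFinP/measurable_funX; exact: integrated_field_measurable.
- by apply: emeasurable_funM; exact: field_majorant_measurable.
- move=> z _; rewrite -(real_normK (num_real (J z))) expr2 EFinM.
  by apply: lee_pmul; rewrite ?lee_fin ?J_le.
Qed.

Lemma field_majorant_ae_finite : {ae m2, forall z, Q z < +oo}.
Proof.
have : m2.-integrable setT (fun z => Q z * Q z).
  apply/integrableP; split; first by apply: emeasurable_funM; exact: field_majorant_measurable.
  by under eq_integral do rewrite gee0_abs ?mule_ge0//.
move/integrable_ae => /(_ measurableT); apply: filterS => z /(_ I).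
by case: (Q z) (Q_ge0 z) => [r||] _; rewrite ?ltry// mulyy.
Qed.

Lemma field_majorant_integrable z : Q z < +oo -> m1.-integrable setT (fun x => (k x * Y x z)%:E).
Proof.
move=> Qz; apply/integrableP; split; first exact/measurable_EFinP.
exact: Qz.
Qed.

(** Fubini. Absolute integrability comes from |g Y| <= g^2 + Y^2, whose integral over z is at most G
    + a x, hence at most (1 + G) a x because a >= 1. *)
Lemma integrated_field_integral g : L2fun m2 g ->
  (\int[m2]_z (g z * J z) = \int[m1]_x (k x * \int[m2]_z (g z * Y x z)))%R.
Proof.
move=> Lg; have mg : measurable_fun setT g by case: Lg.
pose G := (\int[m2]_z g z ^+ 2)%R.
have GE : G%:E = \int[m2]_z (g z ^+ 2)%:E by apply: Rintegral_fineK; exact: L2_sqr_integrable.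
have G0 : (0 <= G)%R by apply: Rintegral_ge0 => z _; exact: sqr_ge0.
pose f (p : X * Z) := (k p.1 * (g p.2 * Y p.1 p.2))%:E.
have mf : measurable_fun setT f.
  apply/measurable_EFinP; apply: measurable_funM => //; apply: measurable_funM => //.
  exact: measurableT_comp.
have gY x : m2.-integrable setT (fun z => (g z * Y x z)%:E).
  by apply: L2_mul_integrable => //; exact: field_L2.
have inner x : \int[m2]_z f (x, z) = (k x * \int[m2]_z (g z * Y x z))%R%:E.
  rewrite /f/=; under eq_integral do rewrite EFinM.
  by rewrite integralZl// EFinM Rintegral_fineK.
have fi : (m1 \x m2).-integrable setT f.
  apply/(integrable12ltyP _ _ mf).
  apply: (@le_lt_trans _ _ (\int[m1]_x ((1 + G)%:E * (`|k x| * a x)%:E))).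
    apply: ge0_le_integral => //.
    - by move=> x _; exact: integral_ge0.
    - have mf' : measurable_fun setT (abse \o f) by exact: measurableT_comp.
      exact: (measurable_fun_fubini_tonelli_F (abse \o f) mf' (fun p => abse_ge0 (f p))).
    - by apply: measurable_funeM; exact: measurable_int kabs_int.
    move=> x _.
    have mYx := field_measurable x; have mg2 := measurable_funX 2 mg; have mY2 := measurable_funX 2 mYx.
    apply: (@le_trans _ _ (\int[m2]_z (`|k x| * g z ^+ 2 + `|k x| * Y x z ^+ 2)%R%:E)).
      apply: ge0_le_integral_EFin => //.
      - apply: measurableT_comp => //=.
        have mc : measurable_fun setT (fun _ : Z => k x) by exact: measurable_cst.
        exact: (measurable_funM mc (measurable_funM mg mYx)).
      - by apply: measurable_funD; exact: measurable_funM.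
      move=> z /=; rewrite !normrM -mulrDr ler_wpM2l//.
      have := sqr_ge0 (`|g z| - `|Y x z|)%R; have := sqr_ge0 (g z); have := sqr_ge0 (Y x z).
      rewrite sqrrB !real_normK ?num_real// -mulr_natr; nra.
    rewrite ge0_integral_linear//; [|by move=> z; exact: sqr_ge0..].
    rewrite -GE -muleDr ?ge0_adde_def ?inE ?lee_fin ?integral_ge0//; last by move=> z _; rewrite lee_fin sqr_ge0.
    apply: (@le_trans _ _ (`|k x|%:E * (G%:E + (a x)%:E))).
      by rewrite lee_wpmul2l ?lee_fin// leeD2l.
    rewrite -EFinD -!EFinM lee_fin mulrCA ler_wpM2l// mulrDl mul1r addrC lerD2l.
    by rewrite ler_peMr.
  rewrite ge0_integralZl_EFin// ?addr_ge0//.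
  - by apply: lte_mul_pinfty; rewrite ?lee_fin ?addr_ge0 ?kabs_lty.
  - by move=> x _; rewrite lee_fin mulr_ge0.
  - exact: measurable_int kabs_int.
have := Fubini fi.
under eq_integral do rewrite inner.
rewrite /Rintegral => ->; congr fine.
apply: ae_eq_integral => //.
- by apply/measurable_EFinP; apply: measurable_funM => //; exact: integrated_field_measurable.
- exact: (measurable_fubini_G fi).
apply: filterS field_majorant_ae_finite => z Qz _ /=.
rewrite /J /integrated_field EFinM Rintegral_fineK; last exact: field_majorant_integrable.
rewrite -integralZl//; last exact: field_majorant_integrable.
by apply: eq_integral => x _; rewrite /f/= -EFinM mulrCA.
Qed.

End integrated_field.

(** * Comparison of two fields with the same covariance *)

Section second_order_structure.
Local Open Scope ring_scope.
Context d1 (X : measurableType d1) d2 (Z : measurableType d2) d2' (Z' : measurableType d2') (R : realType).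
Variables (m1 : {sigma_finite_measure set X -> \bar R}).
Variables (m2 : {sigma_finite_measure set Z -> \bar R}) (m2' : {sigma_finite_measure set Z' -> \bar R}).
Variables (k a : X -> R) (Y : X -> Z -> R) (Y' : X -> Z' -> R).
Hypothesis mk : measurable_fun setT k.
Hypothesis ma : measurable_fun setT a.
Hypothesis a1 : forall x, 1 <= a x.
Hypothesis ka : m1.-integrable setT (fun x => (k x * a x)%:E).
Hypothesis mY : measurable_fun setT (fun p : X * Z => Y p.1 p.2).
Hypothesis Y2 : forall x, (\int[m2]_z (Y x z ^+ 2)%:E <= (a x)%:E)%E.
Hypothesis mY' : measurable_fun setT (fun p : X * Z' => Y' p.1 p.2).
Hypothesis Y2' : forall x, (\int[m2']_z (Y' x z ^+ 2)%:E <= (a x)%:E)%E.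
Hypothesis YY' : forall x y, \int[m2]_z (Y x z * Y y z) = \int[m2']_z (Y' x z * Y' y z).

Let J := integrated_field m1 k Y.
Let J' := integrated_field m1 k Y'.

(** The left side is a quadratic form in the Gram matrix of J and the Y x. The products of J with Y
    x are integrals of the covariance against k, and those of J with itself are integrals of the
    former, so the whole matrix is determined by the covariance. *)
Lemma integrated_field_isometry (s : seq (R * X)) :
  (\int[m2]_z ((J z - \sum_(p <- s) p.1 * Y p.2 z) ^+ 2)%:E =
   \int[m2']_z ((J' z - \sum_(p <- s) p.1 * Y' p.2 z) ^+ 2)%:E)%E.
Proof.
(* [None] indexes the integrated field itself, which puts it in one finite family with the values of
   the field. *)
pose F (o : option X) z := if o is Some x then Y x z else J z.
pose F' (o : option X) z := if o is Some x then Y' x z else J' z.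
pose s0 : seq (R * option X) := (1, None) :: [seq (- p.1, Some p.2) | p <- s].
have LF (p : R * option X) : L2fun m2 (F p.2).
  by case: p => b [x|]; [exact: field_L2 mY Y2 _|exact: integrated_field_L2 mk ma a1 ka mY Y2].
have LF' (p : R * option X) : L2fun m2' (F' p.2).
  by case: p => b [x|]; [exact: field_L2 mY' Y2' _|exact: integrated_field_L2 mk ma a1 ka mY' Y2'].
have JY x : \int[m2]_z (Y x z * J z) = \int[m2']_z (Y' x z * J' z).
  rewrite (integrated_field_integral mk ma a1 ka mY Y2 (LF (1, Some x))).
  rewrite (integrated_field_integral mk ma a1 ka mY' Y2' (LF' (1, Some x))).
  by congr (fine _); apply: eq_integral => y _; rewrite YY'.
have JJ : \int[m2]_z (J z * J z) = \int[m2']_z (J' z * J' z).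
  rewrite (integrated_field_integral mk ma a1 ka mY Y2 (LF (1, None))).
  rewrite (integrated_field_integral mk ma a1 ka mY' Y2' (LF' (1, None))).
  congr (fine _); apply: eq_integral => y _.
  under eq_Rintegral do rewrite mulrC.
  under [in RHS]eq_Rintegral do rewrite mulrC.
  by rewrite JY.
have FF (p q : R * option X) : \int[m2]_z (F p.2 z * F q.2 z) = \int[m2']_z (F' p.2 z * F' q.2 z).
  case: p q => b [x|] [b' [y|]] //=.
  under eq_Rintegral do rewrite mulrC.
  by under [RHS]eq_Rintegral do rewrite mulrC.
have E z : J z - \sum_(p <- s) p.1 * Y p.2 z = \sum_(p <- s0) p.1 * F p.2 z.
  rewrite big_cons big_map mul1r/= -sumrN; congr (_ + _).
  by apply: eq_bigr => p _; rewrite mulNr.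
have E' z : J' z - \sum_(p <- s) p.1 * Y' p.2 z = \sum_(p <- s0) p.1 * F' p.2 z.
  rewrite big_cons big_map mul1r/= -sumrN; congr (_ + _).
  by apply: eq_bigr => p _; rewrite mulNr.
under eq_integral do rewrite E.
under [RHS]eq_integral do rewrite E'.
rewrite (integral_sqr_sum s0 (fun p => p.1) LF) (integral_sqr_sum s0 (fun p => p.1) LF').
by congr EFin; apply: eq_bigr => p _; apply: eq_bigr => q _; rewrite FF.
Qed.

End second_order_structure.

(** * Second moments of a Levy process *)

Lemma same_law_integral d d' (T : measurableType d) (U : measurableType d') (R : realType)
    (P : {measure set T -> \bar R}) (X Y : T -> U) (g : U -> \bar R) :
  measurable_fun setT X -> measurable_fun setT Y ->
  (forall B, measurable B -> P (X @^-1` B) = P (Y @^-1` B)) ->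
  measurable_fun setT g -> (\int[P]_w g (X w) = \int[P]_w g (Y w))%E.
Proof.
move=> mX mY XY mg.
have ge0_case (f : U -> \bar R) : measurable_fun setT f -> (forall y, 0 <= f y)%E ->
    (\int[P]_w f (X w) = \int[P]_w f (Y w))%E.
  move=> mf f0.
  have := @ge0_integral_pushforward _ _ _ _ R X mX P setT f measurableT mf (fun y _ => f0 y).
  rewrite preimage_setT => <-.
  have := @ge0_integral_pushforward _ _ _ _ R Y mY P setT f measurableT mf (fun y _ => f0 y).
  rewrite preimage_setT => <-.
  by apply: eq_measure_integral => B mB _; exact: XY.
have split_parts (V : T -> U) : (\int[P]_w g (V w) = \int[P]_w g^\+ (V w) - \int[P]_w g^\- (V w))%E.
  rewrite integralE; congr (_ - _)%E; apply: eq_integral => w _; rewrite ?funeposE ?funenegE//.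
by rewrite !split_parts !ge0_case//; [exact: measurable_funeneg|exact: measurable_funepos].
Qed.

(** Cauchy's functional equation: nonnegativity makes v monotone, and t is squeezed between
    consecutive multiples of 1/(n+1). *)
Lemma nonneg_additive_linear (R : realType) (v : R -> R) :
  (forall t, 0 <= t -> 0 <= v t) ->
  (forall s t, 0 <= s -> 0 <= t -> v (s + t) = v s + v t) ->
  forall t, 0 <= t -> v t = t * v 1.
Proof.
move=> v0 vD t t0.
have vn n s : 0 <= s -> v (n%:R * s) = n%:R * v s.
  move=> s0; elim: n => [|n IH].
    by have := vD 0 0 (lexx _) (lexx _); rewrite addr0 !mul0r; lra.
  by rewrite -natr1 mulrDl mul1r vD ?mulr_ge0// IH mulrDl mul1r.
have vmono s u : 0 <= s -> s <= u -> v s <= v u.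
  by move=> s0 su; rewrite -(subrKC s u) vD ?subr_ge0// lerDl v0// subr_ge0.
have bound n : `|v t - t * v 1| <= v 1 / n.+1%:R.
  have n0 : 0 < n.+1%:R :> R by rewrite ltr0n.
  have nt0 : 0 <= n.+1%:R * t by rewrite mulr_ge0.
  have /andP[k1 k2] := truncn_itv nt0.
  set k := Num.truncn _ in k1 k2.
  have h1 := vmono _ _ (ler0n _ k) k1.
  have h2 := vmono _ _ nt0 (ltW k2).
  have h3 := vn k 1 ler01; have h4 := vn k.+1 1 ler01.
  rewrite !mulr1 in h3 h4; rewrite h3 vn// in h1; rewrite h4 vn// in h2.
  have v1 : 0 <= v 1 by exact: v0.
  rewrite -natr1 in h2 k2.
  have h5 := ler_wpM2r v1 k1; have h6 := ler_wpM2r v1 (ltW k2).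
  rewrite ler_pdivlMr// -[X in _ * X](gtr0_norm n0) -normrM ler_norml; apply/andP; split; nra.
apply/eqP; rewrite -subr_eq0 -normr_le0; apply/ler_addgt0Pr => e e0; rewrite add0r.
have [n hn] := ltr_add_invr (y := 0) (x := e / (v 1 + 1)) ltac:(rewrite divr_gt0 ?ltr_wpDl ?v0//).
rewrite add0r in hn.
have v1 : 0 < v 1 + 1 by rewrite ltr_wpDl ?v0.
apply: (le_trans (bound n)); apply: (@le_trans _ _ ((v 1 + 1) * (e / (v 1 + 1)))); last first.
  by rewrite mulrC divfK// gt_eqF.
by apply: ler_pM; rewrite ?v0 ?invr_ge0 ?lerDl// ltW.
Qed.

Section levy_second_order.
Context d (T : measurableType d) (R : realType) (P : probability T R) (X : R -> T -> R).
Hypothesis hX : levy_process P X.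
Hypothesis LX : forall t, 0 <= t -> L2fun P (X t).
Hypothesis X0 : forall t, 0 <= t -> (\int[P]_w (X t w)%:E = 0)%E.

Lemma levy_increments2_independent s t : 0 <= s -> s <= t ->
  independent_maps P (fun w => X s w - X 0 w) (fun w => X t w - X s w).
Proof.
move=> s0 st A B mA mB.
pose tm (i : nat) := if i is i'.+1 then (if i' is _.+1 then t else s) else 0.
have tmono : {homo tm : i j / (i <= j)%N >-> i <= j}.
  have t0 := le_trans s0 st.
  by move=> [|[|i]] [|[|j]] _ //=; rewrite lexx.
pose BB (i : 'I_2) := if val i == 0%N then A else B.
have mBB i : measurable (BB i) by rewrite /BB; case: ifP.
have := levy_indep hX (n := 2) (t := tm) (lexx _) tmono mBB.
rewrite big_ord_recl big_ord1/= /BB/= => <-; congr (P _).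
apply/seteqP; split=> w.
  by move=> [wA wB] i _; case: i => [[|[|//]]] /= ?.
by move=> h; split; [exact: (h ord0)|exact: (h ord_max)].
Qed.

Lemma levy_cross s t : 0 <= s -> s <= t ->
  (\int[P]_w (X s w * (X t w - X s w))%:E = 0)%E.
Proof.
move=> s0 st; have t0 := le_trans s0 st.
transitivity (\int[P]_w ((X s w - X 0 w) * (X t w - X s w))%:E)%E.
  apply: ae_eq_integral => //.
  - apply/measurable_EFinP; apply: measurable_funM; [|apply: measurable_funB];
      exact: (levy_measurable hX).
  - apply/measurable_EFinP; apply: measurable_funM; apply: measurable_funB;
      exact: (levy_measurable hX).
  - by apply: filterS (levy_start hX) => w h _; rewrite h subr0.
apply: independent_mul0.
- by apply: L2B; exact: LX.
- by apply: L2B; exact: LX.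
- under eq_integral do rewrite EFinB.
  by rewrite integralB// ?X0 ?sube0//; apply: L2_integrable; exact: LX.
- exact: levy_increments2_independent.
Qed.

Let v t := (\int[P]_w (X t w ^+ 2))%R.

Let v_ge0 t : 0 <= v t.
Proof. by apply: Rintegral_ge0 => w _; exact: sqr_ge0. Qed.

Let cross s t : 0 <= s -> s <= t -> (\int[P]_w (X s w * (X t w - X s w)))%R = 0.
Proof. by move=> s0 st; rewrite /Rintegral levy_cross. Qed.

Let sqr_integrable f : L2fun P f -> P.-integrable setT (EFin \o (fun w => f w ^+ 2)).
Proof. exact: L2_sqr_integrable. Qed.

Lemma levy_increment_variance s t : 0 <= s -> s <= t ->
  (\int[P]_w ((X t w - X s w) ^+ 2)%:E = \int[P]_w (X (t - s) w ^+ 2)%:E)%E.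
Proof.
move=> s0 st; have ts : 0 <= t - s by rewrite subr_ge0.
apply: (@same_law_integral _ _ _ _ _ _ (fun w => X t w - X s w) (X (t - s)) (fun y : R => (y ^+ 2)%:E)).
- by apply: measurable_funB; apply: (levy_measurable hX) => //; exact: le_trans st.
- exact: (levy_measurable hX).
- move=> B mB; apply: etrans (levy_stationary hX s0 ts mB).
  by rewrite subrKC.
- exact/measurable_EFinP/measurable_funX.
Qed.

Lemma levy_varianceD s t : 0 <= s -> 0 <= t -> v (s + t) = v s + v t.
Proof.
move=> s0 t0; have sst : s <= s + t by rewrite lerDl.
have LD : L2fun P (fun w => X (s + t) w - X s w) by apply: L2B; apply: LX => //; exact: addr_ge0.
have Ls := LX s0.
have E w : X (s + t) w ^+ 2 = X s w ^+ 2 + (2 * (X s w * (X (s + t) w - X s w)) + (X (s + t) w - X s w) ^+ 2).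
  by ring.
rewrite /v; under eq_Rintegral do rewrite E.
have i1 : P.-integrable setT (EFin \o (fun w => X s w * (X (s + t) w - X s w))) by exact: L2_mul_integrable.
have i2 : P.-integrable setT (EFin \o (fun w => 2 * (X s w * (X (s + t) w - X s w)))).
  by have := integrableZl measurableT 2 i1.
rewrite RintegralD//; last 2 first.
- exact: sqr_integrable.
- exact: (integrableD measurableT i2 (sqr_integrable LD)).
rewrite RintegralD//; last exact: sqr_integrable.
rewrite RintegralZl// cross// mulr0 add0r; congr (_ + _).
by rewrite /Rintegral levy_increment_variance// addrAC subrr add0r.
Qed.

Lemma levy_variance_linear t : 0 <= t -> (\int[P]_w (X t w ^+ 2) = t * \int[P]_w (X 1 w ^+ 2))%R.
Proof.
apply: (@nonneg_additive_linear _ v) => //; exact: levy_varianceD.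
Qed.

Lemma levy_covariance s t : 0 <= s -> 0 <= t ->
  (\int[P]_w (X s w * X t w) = Num.min s t * \int[P]_w (X 1 w ^+ 2))%R.
Proof.
wlog st : s t / s <= t => [hwlog|] s0 t0.
  have [st|/ltW ts] := leP s t; first by rewrite hwlog// (min_idPl st).
  under eq_Rintegral do rewrite mulrC.
  by rewrite hwlog// (min_idPl ts).
rewrite (min_idPl st) -levy_variance_linear//.
have E w : X s w * X t w = X s w ^+ 2 + X s w * (X t w - X s w) by ring.
under eq_Rintegral do rewrite E.
have Ls := LX s0.
rewrite RintegralD//; [|exact: sqr_integrable|]; last first.
  by apply: L2_mul_integrable => //; apply: L2B => //; exact: LX.
by rewrite cross// addr0.
Qed.

(** Fatou's lemma along u n increasing to t: the squared increments X t - X (u n) have expectation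
    (t - u n) E[X(1)^2], which tends to 0. *)
Lemma levy_no_fixed_jump t : 0 < t -> {ae P, forall w, lim (X s w @[s --> t^'-]) = X t w}.
Proof.
move=> t0; pose u n : R := t - t / n.+2%:R.
have ut n : u n < t by rewrite ltrBlDr ltrDl divr_gt0.
have u0 n : 0 <= u n.
  by rewrite subr_ge0 ler_pdivrMr ?ltr0n// ler_peMr ?(ltW t0)// ler1n.
have du n : t - u n = t / n.+2%:R by rewrite /u; ring.
have tn_cvg := @cvg_divn2 R t.
have u_cvg : u n @[n --> \oo] --> t.
  rewrite -[X in _ --> X](subr0 t); apply: cvgB => //; exact: cvg_cst.
have Xu w : X (u n) w @[n --> \oo] --> lim (X s w @[s --> t^'-]).
  have /cvg_at_leftP := levy_left_limit hX (w := w) t0.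
  by apply; split.
have mlim : measurable_fun setT (fun w => lim (X s w @[s --> t^'-])).
  apply: (@measurable_fun_cvg _ _ R setT (fun n w => X (u n) w)).
    by move=> n; exact: (levy_measurable hX).
  by move=> w _; exact: Xu.
have mXt := levy_measurable hX (ltW t0).
have mn n : measurable_fun setT (fun w => ((X t w - X (u n) w) ^+ 2)%:E).
  apply/measurable_EFinP/measurable_funX/measurable_funB => //.
  exact: (levy_measurable hX).
have F := @fatou _ _ _ P setT measurableT (fun n w => ((X t w - X (u n) w) ^+ 2)%:E) mn
  (fun n w _ => ltac:(rewrite lee_fin sqr_ge0//)).
have cv n : (\int[P]_w ((X t w - X (u n) w) ^+ 2)%:E = (t / n.+2%:R * v 1)%:E)%E.
  rewrite levy_increment_variance ?(ltW (ut n))// du.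
  have tn0 : 0 <= t / n.+2%:R by rewrite divr_ge0// ltW.
  rewrite -(levy_variance_linear tn0) Rintegral_fineK//.
  by apply: L2_sqr_integrable; exact: LX.
have lim0 : limn_einf (fun n => \int[P]_w ((X t w - X (u n) w) ^+ 2)%:E)%E = 0%E.
  apply: (fun h => (cvg_limn_einf_sup h).1); under eq_fun do rewrite cv.
  apply: cvg_EFin; first by apply: nearW.
  by rewrite -(mul0r (v 1)); apply: cvgM => //; exact: cvg_cst.
have point w : limn_einf (fun n => ((X t w - X (u n) w) ^+ 2)%:E)%E =
   ((X t w - lim (X s w @[s --> t^'-])) ^+ 2)%:E.
  apply: (fun h => (cvg_limn_einf_sup h).1); apply: cvg_EFin; first by apply: nearW.
  under eq_fun do rewrite expr2.
  by rewrite expr2; apply: cvgM; apply: cvgB => //; exact: cvg_cst.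
apply: filterS (sqr_integral_le0 (measurable_funB mXt mlim) _) => [w /eqP|].
  by rewrite subr_eq0 => /eqP ->.
by move: F; rewrite lim0; under eq_integral do rewrite point.
Qed.

End levy_second_order.

(** * Joint measurability and local boundedness of cadlag paths *)

Section cadlag_paths.
Context d (T : measurableType d) (R : realType) (X : R -> T -> R).
Hypothesis mX : forall t, 0 <= t -> measurable_fun setT (X t).
Hypothesis rX : forall w t, 0 <= t -> X s w @[s --> t^'+] --> X t w.
Hypothesis lX : forall w t, 0 < t -> cvg (X s w @[s --> t^'-]).

(** The first multiple of 1/(n+1) strictly to the right of p, so that right continuity applies along
    it. *)
Let r (n : nat) (p : R) : R := (Num.truncn (n.+1%:R * p)).+1%:R / n.+1%:R.

Let r_gt n p : p < r n p.
Proof. by rewrite /r ltr_pdivlMr// mulrC truncnS_gt. Qed.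

Let r_le n p : 0 <= p -> r n p <= p + n.+1%:R^-1.
Proof.
move=> p0; rewrite /r ler_pdivrMr// mulrDl mulVf ?pnatr_eq0// -natr1 lerD2r [p * _]mulrC.
by have /andP[] := truncn_itv (mulr_ge0 (ler0n R n.+1) p0).
Qed.

Let r_cvg p : 0 <= p -> r n p @[n --> \oo] --> p.
Proof.
move=> p0; apply: (@squeeze_cvgr _ _ _ _ (fun=> p) (fun n => p + n.+1%:R^-1)).
- by apply: nearW => n; rewrite (ltW (r_gt _ _)) r_le.
- exact: cvg_cst.
- rewrite -[X in _ --> X]addr0; apply: cvgD; first exact: cvg_cst.
  exact: cvg_harmonic.
Qed.

(** A pointwise limit of processes that are piecewise constant in time, each of which is a countable
    union of measurable rectangles. [Num.max] extends the time to the whole line. *)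
Lemma cadlag_joint_measurable :
  measurable_fun setT (fun z : measurableTypeR R * T => X (Num.max z.1 0) z.2).
Proof.
pose p (x : R) := Num.max x 0.
have p0 x : 0 <= p x by rewrite /p le_max lexx orbT.
apply: (@measurable_fun_cvg _ _ R setT (fun n (z : measurableTypeR R * T) => X (r n (p z.1)) z.2)); last first.
  move=> [x w] _ /=; have /cvg_at_rightP := @rX w _ (p0 x); apply; split.
    by move=> n; exact: r_gt.
  exact: r_cvg.
move=> n _ B mB; rewrite setTI.
have -> : (fun z : measurableTypeR R * T => X (r n (p z.1)) z.2) @^-1` B =
    \bigcup_k ([set x : measurableTypeR R | k%:R <= n.+1%:R * p x < k.+1%:R] `*` (X (k.+1%:R / n.+1%:R) @^-1` B)).
  apply/seteqP; split=> -[x w] /=.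
    move=> h; exists (Num.truncn (n.+1%:R * p x)) => //=; split=> //.
    by rewrite truncn_itv// mulr_ge0.
  by move=> [k _ /= [/truncn_def kx]]; rewrite /r kx.
apply: bigcupT_measurable => k; apply: measurableX.
  have mf : measurable_fun setT (fun x : R => n.+1%:R * p x).
    by apply: measurable_funM => //; exact: measurable_maxr.
  have := mf measurableT `[k%:R, k.+1%:R[%classic (measurable_itv _).
  rewrite setTI; congr measurable.
by rewrite -[X in measurable X]setTI; apply: mX.
Qed.

Lemma cadlag_bounded_at w (t : R) : 0 <= t ->
  exists M : R, \forall s \near t, 0 <= s -> `|X s w| <= M.
Proof.
move=> t0.
have right : exists M : R, \forall s \near t, t < s -> `|X s w| <= M.
  exists (`|X t w| + 1).
  have : \forall s \near t^'+, `|X s w| <= `|X t w| + 1.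
    by apply: (cvgr_norm_le (X t w)); [exact: rX|rewrite ltrDl].
  by rewrite near_withinE.
have left : exists M : R, \forall s \near t, 0 <= s -> s < t -> `|X s w| <= M.
  move: t0; rewrite le_eqVlt => /predU1P[t0|t0].
    by exists 0; near=> s => s0; rewrite -t0 ltNge s0.
  have /cvg_ex[/= l Xl] := @lX w _ t0.
  exists (`|l| + 1).
  have : \forall s \near t^'-, `|X s w| <= `|l| + 1.
    by apply: (cvgr_norm_le l); [exact: Xl|rewrite ltrDl].
  by rewrite near_withinE; apply: filterS => s h _.
have [M1 h1] := right; have [M2 h2] := left.
exists (Num.max (Num.max M1 M2) `|X t w|); apply: filterS2 h1 h2 => s h1 h2 s0.
have [st|ts|->] := ltgtP s t; last by rewrite le_max lexx orbT.
  by rewrite !le_max h2 ?orbT.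
by rewrite !le_max h1.
Unshelve. all: by end_near. Qed.

(** Compactness in its near-covering form, with the bound M tending to +oo, glues the local
    bounds. *)
Lemma cadlag_bounded w (K : R) : exists M : R, forall t : R, 0 <= t <= K -> `|X t w| <= M.
Proof.
have cK : compact (`[0, K]%classic : set R) := @segment_compact R 0 K.
have := (compact_near_coveringP _).1 cK R +oo (fun M t => 0 <= t -> `|X t w| <= M) _.
case=> [t /= |M [_ hM]].
  rewrite in_itv/= => /andP[t0 _]; have [M hM] := cadlag_bounded_at w t0.
  exists ([set s | 0 <= s -> `|X s w| <= M], [set M' | M <= M']) => /=.
    split => //; exact: nbhs_pinfty_ge (num_real M).
  by move=> [s M'] /= [h1 h2] s0; apply: le_trans (h1 s0) h2.
exists (M + 1) => t /andP[t0 tK]; apply: (hM (M + 1)) => //=; first by rewrite ltrDl.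
by rewrite in_itv/= t0.
Qed.

(** Measurability in w calls for a countable supremum: it runs over rational-type times, and right
    continuity carries the bound to all times. *)
Lemma cadlag_measurable_bound (K : R) : 0 <= K -> exists B : T -> R,
  measurable_fun setT B /\ forall w (t : R), 0 <= t <= K -> `|X t w| <= B w.
Proof.
(* The margin leaves room to the right of t = K, and the cap [K1] keeps the sampled times where the
   path is bounded. *)
move=> K0; pose K1 := K + 1; have K10 : 0 <= K1 by rewrite addr_ge0.
pose g (m : nat) : R := let nk := odflt (0, 0)%N (unpickle m) in
  Num.min (nk.2%:R / nk.1.+1%:R) K1.
have g0 m : 0 <= g m <= K1.
  by rewrite le_min K10 ge_min lexx orbT !andbT divr_ge0.
pose h m w := `|X (g m) w|.
have ub w : has_ubound (range (h ^~ w)).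
  have [M hM] := cadlag_bounded w K1.
  by exists M => _ [m _ <-]; apply: hM.
exists (fun w => sups (h ^~ w) 0%N); split.
  apply: measurable_fun_sups => [w _|m]; first exact: ub.
  by apply: measurableT_comp => //; apply: mX; have /andP[] := g0 m.
move=> w t /andP[t0 tK].
pose u n := Num.min (r n t) K1.
have ut n : t < u n by rewrite lt_min r_gt (le_lt_trans tK)// ltrDl.
have u_cvg : u n @[n --> \oo] --> t.
  apply: (@squeeze_cvgr _ _ _ _ (fun=> t) (fun n => r n t)).
  - by apply: nearW => n; rewrite (ltW (ut n)) ge_min lexx.
  - exact: cvg_cst.
  - exact: r_cvg.
have Xu : X (u n) w @[n --> \oo] --> X t w.
  by have /cvg_at_rightP := @rX w _ t0; apply; split.
have hu n : `|X (u n) w| <= sups (h ^~ w) 0%N.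
  pose m := pickle (n, (Num.truncn (n.+1%:R * t)).+1).
  have -> : `|X (u n) w| = h m w by rewrite /h /g /m pickleK.
  by apply: ub_le_sup; [exact/has_ubound_sdrop/ub|exists m].
have Xn : `|X (u n) w| @[n --> \oo] --> `|X t w| by exact: cvg_norm Xu.
rewrite -(cvg_lim (@Rhausdorff R) Xn).
by apply: limr_le; [exact: cvgP Xn|exact: nearW].
Qed.

End cadlag_paths.

(** * The tempered kernel *)

Section power_inequalities.
Context {R : realType}.
Implicit Types x y p c u : R.

(** For 0 < z <= x + y and p <= 1, (z / (x + y))^p >= z / (x + y); the two ratios add up to 1. *)
Lemma powR_subadditive x y p : 0 <= x -> 0 <= y -> 0 <= p <= 1 ->
  (x + y) `^ p <= x `^ p + y `^ p.
Proof.
move=> x0 y0 /andP[p0 p1].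
move: x0; rewrite le_eqVlt => /predU1P[<-|x0]; first by rewrite add0r lerDr powR_ge0.
move: y0; rewrite le_eqVlt => /predU1P[<-|y0]; first by rewrite addr0 lerDl powR_ge0.
have s0 : 0 < x + y by rewrite addr_gt0.
have part z : 0 < z -> z <= x + y -> (x + y) `^ p * (z / (x + y)) <= z `^ p.
  move=> z0 zs; have zs0 : 0 < z / (x + y) by rewrite divr_gt0.
  have {2}-> : z = (x + y) * (z / (x + y)) by rewrite mulrCA divff ?mulr1// gt_eqF.
  rewrite [leRHS]powRM ?(ltW s0) ?(ltW zs0)// ler_wpM2l ?powR_ge0//.
  by apply: ger1_powR => //; rewrite zs0 ler_pdivrMr// mul1r.
have -> : (x + y) `^ p = (x + y) `^ p * (x / (x + y)) + (x + y) `^ p * (y / (x + y)).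
  by rewrite -mulrDr -mulrDl divff ?mulr1// gt_eqF.
by apply: lerD; apply: part => //; rewrite ?lerDl ?lerDr ltW.
Qed.

Lemma linear_le_expR c u : 0 < c -> 0 <= u -> 1 + u <= (1 + c^-1) * expR (c * u).
Proof.
move=> c0 u0; apply: (@le_trans _ _ ((1 + c^-1) * (1 + c * u))).
  have -> : (1 + c^-1) * (1 + c * u) = 1 + u + (c * u + c^-1) by field; rewrite gt_eqF.
  by rewrite lerDl addr_ge0 ?mulr_ge0 ?invr_ge0// ltW.
by rewrite ler_wpM2l ?expR_ge1Dx// addr_ge0// invr_ge0 ltW.
Qed.

(** Half of the decay rate is spent on absorbing the linear factor. *)
Lemma linear_mul_expRN_le c u : 0 < c -> 0 <= u ->
  (1 + u) * expR (- (2 * c * u)) <= (1 + c^-1) * expR (- (c * u)).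
Proof.
move=> c0 u0.
have -> : - (2 * c * u) = - (c * u) - c * u by ring.
rewrite expRD mulrCA [leRHS]mulrC ler_wpM2l ?expR_ge0// expRN ler_pdivrMr ?expR_gt0//.
exact: linear_le_expR.
Qed.

End power_inequalities.

Section tempered_density.
Context {R : realType}.
Variables (d lam : R).
Hypothesis d0 : 0 < d.
Hypothesis d12 : d <= 2^-1.
Hypothesis lam0 : 0 < lam.
Implicit Types u h b : R.

Let d1 : d < 1. Proof. by apply: le_lt_trans d12 _; rewrite invf_lt1// ltr1n. Qed.

(* The derivative of u |-> expR (- lam * u) * u `^ d. *)
Definition tempered_density u : R :=
  if 0 < u then expR (- (lam * u)) * (d * u `^ (d - 1) - lam * u `^ d) else 0.
Let g' := tempered_density.

(** The singular part of the increment of the density, with integral of order h^d. Beyond u = 1 the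
    increment goes into the exponential tail. *)
Definition power_gap h u : R :=
  if 0 < u <= 1 then u `^ (d - 1) - (u + h) `^ (d - 1) else 0.

Let powRd u : 0 < u -> u * u `^ (d - 1) = u `^ d.
Proof. by move=> u0; rewrite mulr_powRB1// ltW. Qed.

Let powRd1_le1 u : 1 <= u -> u `^ (d - 1) <= 1.
Proof. by move=> u1; rewrite -[leRHS](powRr0 u) ler_powR// subr_le0 ltW. Qed.

Let powRd_le u : 1 <= u -> u `^ d <= u.
Proof. by move=> u1; apply: ler1_powR => //; exact: ltW. Qed.

Let powRd1_anti u v : 0 < u -> u <= v -> v `^ (d - 1) <= u `^ (d - 1).
Proof.
move=> u0 uv; have v0 := lt_le_trans u0 uv.
rewrite -(opprB 1 d) !powRN lef_pV2 ?posrE ?powR_gt0//.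
by apply: ge0_ler_powR; rewrite ?nnegrE ?subr_ge0 ?(ltW d1) ?(ltW u0) ?(ltW v0).
Qed.

Let expRN_le1 u : 0 <= u -> expR (- (lam * u)) <= 1.
Proof. by move=> u0; rewrite expR_le1 oppr_le0 mulr_ge0// ltW. Qed.

(** One constant for both bounds below: the first factor collects polynomial coefficients in lam,
    the second is the price of [linear_mul_expRN_le] at rate lam / 2. *)
Definition tempered_const : R := (1 + 2 * lam + lam ^+ 2) * (1 + (lam / 2)^-1).

Let half_ge0 : 0 <= 1 + (lam / 2)^-1.
Proof. by rewrite addr_ge0 ?invr_ge0 ?divr_ge0 ?ltW. Qed.

Lemma tempered_const_ge0 : 0 <= tempered_const.
Proof. by rewrite mulr_ge0// !addr_ge0 ?sqr_ge0 ?mulr_ge0 ?ltW. Qed.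

Let half_decay u : 0 <= u ->
  (1 + u) * expR (- (lam * u)) <= (1 + (lam / 2)^-1) * expR (- (lam / 2 * u)).
Proof.
move=> u0; have := @linear_mul_expRN_le R (lam / 2) u ltac:(by rewrite divr_gt0) u0.
by have -> : 2 * (lam / 2) * u = lam * u by field.
Qed.

(** Up to u = 1, u^d <= u^(d-1) and the exponential is dropped; beyond, u^(d-1) <= 1 and u^d <= u,
    and half of the exponential absorbs the linear growth. *)
Lemma tempered_density_le u :
  `|g' u| <= (d + lam) * singular_part d 1 u + tempered_const * exponential_tail (lam / 2) u.
Proof.
rewrite /g' /tempered_density /singular_part /exponential_tail.
have [u0|u0] := ltP 0 u; last by rewrite normr0 !mulr0 addr0.
have p1 := powR_ge0 u (d - 1); have p2 := powR_ge0 u d.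
have tri : `|d * u `^ (d - 1) - lam * u `^ d| <= d * u `^ (d - 1) + lam * u `^ d.
  by rewrite (le_trans (ler_normB _ _))// !ger0_norm ?mulr_ge0 ?(ltW d0) ?(ltW lam0).
rewrite normrM (gtr0_norm (expR_gt0 _)); have [u1|u1] := leP u 1 => /=.
  apply: (@le_trans _ _ ((d + lam) * u `^ (d - 1))); last by rewrite lerDl mulr_ge0 ?expR_ge0 ?tempered_const_ge0.
  apply: (@le_trans _ _ (1 * (d * u `^ (d - 1) + lam * u `^ d))).
    by apply: ler_pM; rewrite ?expR_ge0// expRN_le1// ltW.
  by rewrite mul1r mulrDl lerD2l ler_wpM2l ?(ltW lam0)// -powRd// ler_piMl.
rewrite mulr0 add0r.
have q1 := powRd1_le1 (ltW u1); have q2 := powRd_le (ltW u1).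
have h1 : `|d * u `^ (d - 1) - lam * u `^ d| <= (1 + lam) * (1 + u).
  rewrite (le_trans tri)//.
  have : d * u `^ (d - 1) <= 1 by rewrite mulr_ile1 ?(ltW d0) ?(ltW d1).
  have : lam * u `^ d <= lam * u by rewrite ler_wpM2l ?(ltW lam0).
  by have := lam0; nra.
rewrite mulrC (le_trans (ler_wpM2r (expR_ge0 _) h1))//.
apply: (@le_trans _ _ ((1 + lam) * ((1 + (lam / 2)^-1) * expR (- (lam / 2 * u))))).
  by rewrite -(mulrA (1 + lam) (1 + u)) ler_wpM2l ?addr_ge0 ?(ltW lam0)// half_decay// ltW.
rewrite /tempered_const mulrA ler_wpM2r ?expR_ge0// ler_wpM2r//.
by have := sqr_ge0 lam; have := lam0; lra.
Qed.

(** With v = u + h, factoring out exp(- lam u) leaves d D, the increment of the power d, and the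
    increment of the exponential. Only D = u^(d-1) - v^(d-1) is singular; the other two are at most
    h^d times a linear function of u. *)
Lemma tempered_density_increment_le u h : 0 < u -> 0 < h -> h <= 1 ->
  `|g' (u + h) - g' u| <= power_gap h u + h `^ d * (tempered_const * exponential_tail (lam / 2) u).
Proof.
move=> u0 h0 h1; rewrite /g' /tempered_density /power_gap /exponential_tail u0 addr_gt0//=.
set v := u + h; have v0 : 0 < v by rewrite addr_gt0.
have uv : u <= v by rewrite lerDl ltW.
have hv : h <= v by rewrite lerDr ltW.
have hd0 := powR_ge0 h d.
pose D := u `^ (d - 1) - v `^ (d - 1).
have D0 : 0 <= D by rewrite subr_ge0 powRd1_anti.
have E : expR (- (lam * v)) * (d * v `^ (d - 1) - lam * v `^ d) -
    expR (- (lam * u)) * (d * u `^ (d - 1) - lam * u `^ d) =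
  - (expR (- (lam * u)) * (d * D + lam * (v `^ d - u `^ d) +
     (1 - expR (- (lam * h))) * (d * v `^ (d - 1) - lam * v `^ d))).
  have -> : - (lam * v) = - (lam * u) + - (lam * h) by rewrite /v; ring.
  by rewrite expRD /D; ring.
rewrite E normrN normrM (gtr0_norm (expR_gt0 _)).
have b1 : `|1 - expR (- (lam * h))| <= lam * h.
  have := expR_ge1Dx (- (lam * h)); have := expRN_le1 (ltW h0).
  by rewrite ler_norml => a1 a2; have := mulr_gt0 lam0 h0 => a3; apply/andP; split; lra.
have b2 : 0 <= v `^ d - u `^ d <= h `^ d.
  rewrite subr_ge0 lerBlDl; apply/andP; split.
    by apply: ge0_ler_powR; rewrite ?nnegrE ?(ltW d0) ?(ltW u0) ?(ltW v0).
  by apply: powR_subadditive; rewrite ?(ltW u0) ?(ltW h0) ?(ltW d0) ?(ltW d1).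
have b3 : h * v `^ (d - 1) <= h `^ d.
  by rewrite -powRd// ler_wpM2l ?(ltW h0)// powRd1_anti.
have b4 : h * v `^ d <= h `^ d * (1 + u).
  have -> : h * v `^ d = (h * v `^ (d - 1)) * v by rewrite -(powRd v0); ring.
  by rewrite ler_pM ?mulr_ge0 ?powR_ge0 ?(ltW h0) ?(ltW v0)// /v addrC lerD2r.
have p1 := powR_ge0 v (d - 1); have p2 := powR_ge0 v d.
have tri : `|d * v `^ (d - 1) - lam * v `^ d| <= d * v `^ (d - 1) + lam * v `^ d.
  by rewrite (le_trans (ler_normB _ _))// !ger0_norm ?mulr_ge0 ?(ltW d0) ?(ltW lam0).
have b5 : `|(1 - expR (- (lam * h))) * (d * v `^ (d - 1) - lam * v `^ d)| <=
    h `^ d * ((lam + lam ^+ 2) * (1 + u)).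
  rewrite normrM (le_trans (ler_pM _ _ b1 tri))//.
  have -> : lam * h * (d * v `^ (d - 1) + lam * v `^ d) =
    lam * (d * (h * v `^ (d - 1))) + lam ^+ 2 * (h * v `^ d) by ring.
  have -> : h `^ d * ((lam + lam ^+ 2) * (1 + u)) =
    lam * (h `^ d * (1 + u)) + lam ^+ 2 * (h `^ d * (1 + u)) by ring.
  apply: lerD; rewrite ler_wpM2l ?sqr_ge0 ?(ltW lam0)//.
  apply: (@le_trans _ _ (1 * h `^ d)); last by rewrite mul1r ler_peMr// lerDl ltW.
  by rewrite ler_pM ?(ltW d0) ?(ltW d1)// mulr_ge0 ?(ltW h0).
have b6 : lam * (v `^ d - u `^ d) <= h `^ d * (lam * (1 + u)).
  case/andP: b2 => _ b2; rewrite mulrCA ler_wpM2l ?(ltW lam0)// (le_trans b2)// ler_peMr// lerDl ltW//.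
have sum_le : `|d * D + lam * (v `^ d - u `^ d) +
     (1 - expR (- (lam * h))) * (d * v `^ (d - 1) - lam * v `^ d)| <=
   d * D + h `^ d * ((2 * lam + lam ^+ 2) * (1 + u)).
  apply: (le_trans (ler_normD _ _)).
  have n1 : `|d * D + lam * (v `^ d - u `^ d)| = d * D + lam * (v `^ d - u `^ d).
    by rewrite ger0_norm// addr_ge0 ?mulr_ge0 ?(ltW d0) ?(ltW lam0)//; case/andP: b2.
  by rewrite n1; move: b5 b6; lra.
(* The bound for [d * D] is split into a part x kept as it is and a part y sent to the tail: x = D,
   y = 0 up to u = 1, and x = 0, y = 1 beyond. *)
have final (x y : R) : 0 <= y -> d * D <= x + h `^ d * (y * (1 + u)) -> 0 <= x -> y <= 1 ->
    expR (- (lam * u)) * (d * D + h `^ d * ((2 * lam + lam ^+ 2) * (1 + u))) <=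
    x + h `^ d * (tempered_const * expR (- (lam / 2 * u))).
  move=> y0 hD x0 y1.
  apply: (@le_trans _ _ (expR (- (lam * u)) * (x + h `^ d * ((1 + 2 * lam + lam ^+ 2) * (1 + u))))).
    rewrite ler_wpM2l ?expR_ge0//.
    apply: (@le_trans _ _ (x + h `^ d * (y * (1 + u)) + h `^ d * ((2 * lam + lam ^+ 2) * (1 + u)))).
      by rewrite lerD2r.
    rewrite -addrA lerD2l -mulrDr ler_wpM2l// -mulrDl ler_wpM2r ?addr_ge0 ?(ltW u0)//.
    by rewrite -addrA lerD2r.
  rewrite mulrDr; apply: lerD; first by rewrite ler_piMl// expRN_le1// ltW.
  rewrite mulrCA ler_wpM2l// mulrCA /tempered_const -[leRHS]mulrA.
  have lam2 : 0 <= 1 + 2 * lam + lam ^+ 2 by have := lam0; nra.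
  by rewrite ler_wpM2l// mulrC half_decay// ltW.
apply: (le_trans (ler_wpM2l (expR_ge0 _) sum_le)).
have [u1|u1] := leP u 1 => /=.
  by apply: (final D 0) => //; rewrite mul0r mulr0 addr0 ler_piMl// ltW.
apply: (final 0 1) => //; rewrite add0r mul1r.
(* For u > 1, D is at most v^(1-d) - u^(1-d) <= h^(1-d), and [d <= 1/2] with h <= 1 gives h^(1-d) <=
   h^d. *)
have D_le : D <= h `^ d.
  pose e := 1 - d; have e0 : 0 < e by rewrite subr_gt0.
  have -> : D = (v `^ e - u `^ e) / (u `^ e * v `^ e).
    rewrite /D -(opprB 1 d) -/e !powRN; field.
    by rewrite !gt_eqF// powR_gt0.
  have ue : 1 <= u `^ e by rewrite -[leLHS](powRr0 u) ler_powR ?ltW.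
  have ve : 1 <= v `^ e by rewrite -[leLHS](powRr0 v) ler_powR ?(ltW e0)// (le_trans _ uv)// ltW.
  have dv : v `^ e - u `^ e <= h `^ e.
    rewrite lerBlDl; apply: powR_subadditive; rewrite ?(ltW u0) ?(ltW h0) ?(ltW e0)//.
    by rewrite lerBlDr lerDl ltW.
  have dv0 : 0 <= v `^ e - u `^ e.
    by rewrite subr_ge0; apply: ge0_ler_powR; rewrite ?nnegrE ?(ltW e0) ?(ltW u0) ?(ltW v0).
  have uve : 1 <= u `^ e * v `^ e by rewrite mulr_ege1.
  rewrite ler_pdivrMr ?(lt_le_trans ltr01 uve)//.
  apply: (@le_trans _ _ (h `^ d * 1)); last by rewrite ler_wpM2l.
  rewrite mulr1 (le_trans dv)//; apply: ger_powR; first by rewrite h0.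
  by rewrite /e; have := d12; lra.
apply: (@le_trans _ _ (1 * h `^ d)).
  by rewrite ler_pM ?(ltW d0) ?(ltW d1).
by rewrite mul1r ler_peMr// lerDl ltW.
Qed.

End tempered_density.

Section tempered_integrals.
Context {R : realType}.
Variables (d lam : R).
Hypothesis d0 : 0 < d.
Hypothesis d12 : d <= 2^-1.
Hypothesis lam0 : 0 < lam.
Implicit Types u h b : R.
Let mu := @lebesgue_measure R.
Let g' : R -> R := tempered_density d lam.

Let d1 : d < 1. Proof. by apply: le_lt_trans d12 _; rewrite invf_lt1// ltr1n. Qed.

Lemma measurable_tempered_density : measurable_fun setT g'.
Proof.
apply: measurable_fun_ifT => //; first exact: measurable_gt0.
apply: measurable_funM.
  by apply: measurableT_comp => //; apply: measurable_funN; exact: measurable_funM.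
by apply: measurable_funB; apply: measurable_funM => //; exact: measurable_powR.
Qed.

Lemma measurable_power_gap h : measurable_fun setT (power_gap d h).
Proof.
apply: measurable_fun_ifT => //; first exact: measurable_oc.
apply: measurable_funB; first exact: measurable_powR.
apply: (@measurableT_comp _ _ _ _ _ _ (fun y : R => y `^ (d - 1)) _ (fun x : R => x + h)).
  exact: measurable_powR.
exact: measurable_funD.
Qed.

Lemma power_gap_ge0 h u : 0 < h -> 0 <= power_gap d h u.
Proof.
move=> h0; rewrite /power_gap; case: ifP => // /andP[u0 _]; rewrite subr_ge0.
rewrite -(opprB 1 d) !powRN lef_pV2 ?posrE ?powR_gt0 ?addr_gt0//.
by apply: ge0_ler_powR; rewrite ?nnegrE ?subr_ge0 ?(ltW d1) ?addr_ge0 ?(ltW u0) ?(ltW h0)// lerDl ltW.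
Qed.

(** The antiderivative (u^d - (u + h)^d) / d gives exactly (1 - (1 + h)^d + h^d) / d, and (1 + h)^d
    >= 1. *)
Lemma integral_power_gap_le h : 0 < h -> (\int[mu]_u (power_gap d h u)%:E <= (h `^ d / d)%:E)%E.
Proof.
move=> h0; under eq_integral do rewrite /power_gap in_oc.
rewrite (integral_if `]0, 1] (fun u => u `^ (d - 1) - (u + h) `^ (d - 1))).
pose F (u : R) := d^-1 * (u `^ d - (u + h) `^ d).
have dF (u : R) : 0 < u -> is_derive u 1 F (u `^ (d - 1) - (u + h) `^ (d - 1)).
  move=> u0; have uh0 : 0 < u + h by rewrite addr_gt0.
  have D1 := is_derive1_powR d u0.
  have Dh : is_derive u 1 (fun u : R => u + h) 1.
    by apply: is_derive_eq; rewrite addr0.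
  have D2 := @is_derive1_comp R (fun y => y `^ d) (fun u => u + h) u _ _ (is_derive1_powR d uh0) Dh.
  have H := is_deriveZ d^-1 (is_deriveB D1 D2).
  have -> : u `^ (d - 1) - (u + h) `^ (d - 1) = d^-1 *: (d * u `^ (d - 1) - d * (u + h) `^ (d - 1) * 1).
    by rewrite /GRing.scale/= mulr1 -mulrBr mulrA mulVf ?mul1r// gt_eqF.
  exact: H.
rewrite (@ge0_improper_FTC _ _ F 1)//.
- have h1 : 1 <= (1 + h) `^ d.
    by rewrite -[leLHS](powRr0 (1 + h)) ler_powR ?(ltW d0)// lerDl ltW.
  rewrite lee_fin /F powR1 add0r powR0 ?gt_eqF// sub0r -mulrBr mulrC ler_pM2r ?invr_gt0//; lra.
- move=> u u0; apply: cvgB; first exact: continuous_powR_gt0.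
  have uh0 : 0 < u + h by rewrite addr_gt0.
  apply: (@continuous_comp _ _ _ (fun u : R => u + h) (fun y : R => y `^ (d - 1))).
    by apply: cvgD; [exact: cvg_id|exact: cvg_cst].
  exact: continuous_powR_gt0.
- apply: cvgM; first exact: cvg_cst.
  apply: cvgB; first by rewrite powR0 ?gt_eqF//; exact: powR_cvg0.
  apply: cvg_at_right_filter.
  apply: (@continuous_comp _ _ _ (fun u : R => u + h) (fun y : R => y `^ d)).
    by apply: cvgD; [exact: cvg_id|exact: cvg_cst].
  by apply: continuous_powR_gt0; rewrite add0r.
- move=> u /andP[u0 u1]; have := power_gap_ge0 u h0.
  by rewrite /power_gap u0 u1.
Qed.

Lemma power_gap_integrable h : 0 < h -> mu.-integrable setT (EFin \o power_gap d h).
Proof.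
move=> h0; apply: (@ge0_integrable _ _ _ _ _ (h `^ d / d)).
- exact: measurable_power_gap.
- by move=> u; exact: power_gap_ge0.
- exact: integral_power_gap_le.
Qed.

(** The weight 1 + |u| is the growth of the second moment of the process; absorbing it lowers the
    decay rate from lam / 2 to lam / 4. *)
Lemma tempered_density_weighted_integrable :
  mu.-integrable setT (fun u => (g' u * (1 + `|u|))%:E).
Proof.
pose K := 2 * (d + lam); pose C := tempered_const lam * (1 + (lam / 4)^-1).
have := integrableD measurableT
  (integrableZl measurableT K (singular_part_integrable d0 ltr01))
  (integrableZl measurableT C (exponential_tail_integrable (c := lam / 4) ltac:(by rewrite divr_gt0))).
apply: le_integrable_EFin.
  apply: measurable_funM; first exact: measurable_tempered_density.
  by apply: measurable_funD => //; exact: measurableT_comp.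
move=> u; rewrite normrM [`|1 + _|]ger0_norm ?addr_ge0//.
apply: (le_trans (ler_wpM2r _ (tempered_density_le d0 d12 lam0 u))); first by rewrite addr_ge0.
rewrite mulrDl; apply: lerD.
  rewrite /singular_part; case: ifP => [/andP[u0 u1]|_]; last by rewrite !mulr0 mul0r.
  rewrite (gtr0_norm u0) /K mulrAC mulrC [leRHS]mulrC ler_wpM2l ?powR_ge0//.
  rewrite mulrC ler_wpM2r ?addr_ge0 ?(ltW d0) ?(ltW lam0)//.
  by rewrite -[2]/(1 + 1) lerD2l.
rewrite /exponential_tail; case: ifP => [u0|_]; last by rewrite !mulr0 mul0r.
rewrite (gtr0_norm u0) /C -(mulrA (tempered_const lam) (expR _)) -(mulrA (tempered_const lam) (1 + _)) ler_wpM2l ?tempered_const_ge0// mulrC.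
have := @linear_mul_expRN_le R (lam / 4) u ltac:(by rewrite divr_gt0) (ltW u0).
by have -> : 2 * (lam / 4) * u = lam / 2 * u by field.
Qed.

Lemma tempered_density_integrable : mu.-integrable setT (EFin \o g').
Proof.
apply: le_integrable_EFin (integrable_abse tempered_density_weighted_integrable).
  exact: measurable_tempered_density.
by move=> u; rewrite normrM ler_peMr// ger0_norm ?addr_ge0// lerDl.
Qed.

Lemma integral_tempered_density b : 0 < b ->
  (\int[mu]_u (if (u <= b)%R then g' u else 0%R)%:E = (expR (- (lam * b)) * b `^ d)%:E)%E.
Proof.
move=> b0; pose f u := expR (- (lam * u)) * (d * u `^ (d - 1) - lam * u `^ d).
have fE u : u \in `]0, b] -> f u = g' u.
  by rewrite in_itv/= /g' /tempered_density => /andP[->].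
transitivity (\int[mu]_u (if u \in `]0%R, b] then f u else 0%R)%:E)%E.
  apply: eq_integral => u _; rewrite in_itv/= /g' /tempered_density -/(f u).
  by case: (0 < u) => //=; case: ifP.
rewrite integral_if.
pose F u := expR (- (lam * u)) * u `^ d.
have -> : (F b)%:E = (F b - F 0)%:E by rewrite /F powR0 ?gt_eqF// mulr0 subr0.
apply: improper_FTC => //.
- move=> u u0.
  have D1 := is_derive1_powR d u0.
  have h : is_derive u 1 (fun u => - (lam * u)) (- lam).
    by apply: is_derive_eq; rewrite scaler1.
  have D2 := @is_derive1_comp R expR (fun u => - (lam * u)) u _ _ (is_derive_expR (- (lam * u))) h.
  have H := is_deriveM D2 D1.
  apply: (is_derive_eq H); rewrite /GRing.scale/= /f; ring.
- move=> u u0; apply: cvgM.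
    apply: continuous_comp; last exact: continuous_expR.
    by apply: cvgN; apply: cvgM; [exact: cvg_cst|exact: cvg_id].
  by apply: cvgB; apply: cvgM; [exact: cvg_cst|exact: continuous_powR_gt0|exact: cvg_cst|exact: continuous_powR_gt0].
- apply: cvgM; last by rewrite powR0 ?gt_eqF//; exact: powR_cvg0.
  apply: cvg_at_right_filter; apply: continuous_comp; last exact: continuous_expR.
  by apply: cvgN; apply: cvgM; [exact: cvg_cst|exact: cvg_id].
- have gi : mu.-integrable `]0, b] (EFin \o g').
    by apply: (integrableS measurableT _ _ tempered_density_integrable) => //; exact: measurable_itv.
  by apply: eq_integrable gi => // u /set_mem ub; rewrite /= fE.
Qed.

Definition path_kernel (t x : R) : R := g' (t - x) - g' (- x).

(* The indicator of ]0, x] if x >= 0, minus that of ]x, 0] if x < 0. *)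
Definition signed_step (x z : R) : R := (z <= x)%R%:R - (z <= 0)%R%:R.

Let primitive b := if 0 < b then expR (- (lam * b)) * b `^ d else 0.

Let shifted_integrable s : mu.-integrable setT (EFin \o (fun x => g' (s - x))).
Proof. exact: integrable_reflect tempered_density_integrable. Qed.

Let cut_integrable s z : mu.-integrable setT (EFin \o (fun x => (z <= x)%R%:R * g' (s - x))).
Proof.
have mg : measurable_fun setT (fun x : R => g' (s - x)).
  by have /integrableP[/measurable_EFinP] := shifted_integrable s.
have := integrable_abse (shifted_integrable s).
apply: le_integrable_EFin.
  by apply: measurable_funM => //; exact: measurable_ler_nat.
by move=> x; rewrite normrM; case: (z <= x); rewrite ?normr1 ?mul1r// normr0 mul0r.
Qed.

Let cut_integral s z : (\int[mu]_x ((z <= x)%R%:R * g' (s - x)))%R = primitive (s - z).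
Proof.
rewrite /Rintegral.
have ig : mu.-integrable setT (EFin \o (fun u => (u <= s - z)%R%:R * g' u)).
  have := integrable_abse tempered_density_integrable.
  apply: le_integrable_EFin.
    apply: measurable_funM; last exact: measurable_tempered_density.
    exact: measurable_ler_nat.
  by move=> x; rewrite normrM; case: (x <= _); rewrite ?normr1 ?mul1r// normr0 mul0r.
transitivity (fine (\int[mu]_x ((s - x <= s - z)%R%:R * g' (s - x))%:E)).
  by congr fine; apply: eq_integral => x _; rewrite lerD2l lerN2.
rewrite (integral_reflect s ig) /primitive.
have -> : (\int[mu]_u ((u <= s - z)%R%:R * g' u)%:E =
           \int[mu]_u (if (u <= s - z)%R then g' u else 0%R)%:E)%E.
  by apply: eq_integral => u _; case: ifP; rewrite ?mul1r ?mul0r.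
case: ifPn => [sz|]; first by rewrite integral_tempered_density.
rewrite -leNgt => sz; rewrite integral0_eq// => u _; case: ifP => // us.
by rewrite /g' /tempered_density ltNge (le_trans us sz).
Qed.

Lemma path_kernel_integrable t : mu.-integrable setT (EFin \o path_kernel t).
Proof.
have := integrableB measurableT (shifted_integrable t) (shifted_integrable 0).
by apply: eq_integrable => // x _; rewrite /path_kernel /= sub0r EFinB.
Qed.

Lemma integral_path_kernel t : (\int[mu]_x path_kernel t x)%R = 0.
Proof.
have -> : (\int[mu]_x path_kernel t x)%R = (\int[mu]_x (g' (t - x) - g' (0 - x)))%R.
  by apply: eq_Rintegral => x _; rewrite sub0r.
rewrite RintegralB//; try exact: shifted_integrable.
rewrite /Rintegral !(integral_reflect _ tempered_density_integrable).
by rewrite subrr.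
Qed.

(** Integrating g'(s - x) over x >= z gives the primitive at s - z, for s = t and s = 0. The
    constant part of [signed_step] contributes nothing because the kernel has integral 0. *)
Lemma path_kernel_represents t z :
  (\int[mu]_x (path_kernel t x * signed_step x z))%R = tflp_kernel d lam t z.
Proof.
have E x : path_kernel t x * signed_step x z =
   ((z <= x)%R%:R * g' (t - x) - (z <= x)%R%:R * g' (0 - x)) - (z <= 0)%R%:R * path_kernel t x.
  by rewrite /path_kernel /signed_step sub0r; ring.
under eq_Rintegral do rewrite E.
have iB := integrableB measurableT (cut_integrable t z) (cut_integrable 0 z).
rewrite RintegralB//; last 1 first.
- have := integrableZl measurableT (z <= 0)%R%:R (path_kernel_integrable t).
  exact.
rewrite RintegralB//; try exact: cut_integrable.
rewrite !cut_integral RintegralZl//; last exact: path_kernel_integrable.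
rewrite integral_path_kernel mulr0 subr0 /tflp_kernel sub0r.
have P x : primitive x = expR (- lam * pos_part x) * pos_pow x d.
  rewrite /primitive /pos_pow; case: ifPn => [x0|_]; last by rewrite mulr0.
  by rewrite /pos_part (max_idPl (ltW x0)) mulNr.
by rewrite !P.
Qed.

(** The weight is moved along with the shift: 1 + |x| <= (1 + |s|)(1 + |s - x|). *)
Lemma path_kernel_weighted_integrable t :
  mu.-integrable setT (fun x => (path_kernel t x * (1 + `|x|))%:E).
Proof.
have W s : mu.-integrable setT (fun x => (g' (s - x) * (1 + `|x|))%:E).
  have w0 := integrable_reflect s tempered_density_weighted_integrable.
  have w1 := integrableZl measurableT (1 + `|s|) (integrable_abse w0).
  apply: (le_integrable_EFin _ _ w1).
    apply: measurable_funM.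
      by have /integrableP[/measurable_EFinP] := shifted_integrable s.
    by apply: measurable_funD => //; exact: measurableT_comp.
  move=> x /=; rewrite !normrM (ger0_norm (addr_ge0 ler01 (normr_ge0 x))).
  rewrite (ger0_norm (addr_ge0 ler01 (normr_ge0 (s - x)))) mulrCA ler_wpM2l//.
  have h : `|x| <= `|s| + `|s - x| by rewrite -{1}(subKr s x) (le_trans (ler_normB _ _)).
  rewrite mulrDl mul1r mulrDr mulr1; have := mulr_ge0 (normr_ge0 s) (normr_ge0 (s - x)); lra.
have := integrableB measurableT (W t) (W 0).
by apply: eq_integrable => // x _; rewrite /path_kernel /= sub0r -EFinB mulrBl.
Qed.

End tempered_integrals.

(** * Hoelder estimate for the integral of a fixed path *)

Section path_integral_holder.
Context {R : realType}.
Variables (d lam : R).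
Hypothesis d0 : 0 < d.
Hypothesis d12 : d <= 2^-1.
Hypothesis lam0 : 0 < lam.
Let mu := @lebesgue_measure R.
Let g' : R -> R := tempered_density d lam.
Let tc := tempered_const lam.

Let tc0 : 0 <= tc. Proof. exact: tempered_const_ge0. Qed.

Let d1 : d < 1. Proof. by apply: le_lt_trans d12 _; rewrite invf_lt1// ltr1n. Qed.

(** It dominates, up to a factor depending on T, every tail shifted by t with |t| <= T; it does not
    itself depend on T, so one norm of the path serves all time intervals. *)
Definition path_weight (x : R) : R := expR (- (lam / 2 * `|x|)).

Lemma path_weight_ge0 x : 0 <= path_weight x. Proof. exact: expR_ge0. Qed.

Lemma measurable_path_weight : measurable_fun setT path_weight.
Proof.
apply: measurableT_comp => //; apply: measurable_funN.
by apply: measurable_funM.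
Qed.

(** [f] stands for one path of the process. The singular pieces look back by at most 1 from a time
    in [- T, T], hence the interval on which the bound B is required. *)
Variables (T B : R) (f : R -> R).
Hypothesis T0 : 0 <= T.
Hypothesis mf : measurable_fun setT f.
Hypothesis fB : forall x, - (T + 1) <= x <= T -> `|f x| <= B.
Hypothesis fi : mu.-integrable setT (fun x => (path_weight x * f x)%:E).

Let B0 : 0 <= B.
Proof. by apply: le_trans (fB (x := 0) _) => //; rewrite T0 oppr_le0 addr_ge0. Qed.

Let Q := (\int[mu]_x `|path_weight x * f x|)%R.

Let E := expR (3 * lam * T / 2).

(** The summands come from the piece between s and t, from the power gap, and from the tail. *)
Definition holder_const : R := (d + lam + tc) / d + d^-1 + tc * E.

Let tail_le t x : `|t| <= T -> exponential_tail (lam / 2) (t - x) <= E * path_weight x.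
Proof.
rewrite ler_norml => /andP[t1 t2]; rewrite /exponential_tail; case: ifP => [|_]; last first.
  by rewrite mulr_ge0 ?expR_ge0.
rewrite subr_gt0 => xt; rewrite /E /path_weight -expRD ler_expR.
(* For x < t and |t| <= T, t - x >= |x| - 3 T whatever the sign of x. *)
have -> : 3 * lam * T / 2 - lam / 2 * `|x| = - (lam / 2 * (`|x| - 3 * T)) by field.
rewrite lerN2 ler_wpM2l ?divr_ge0 ?(ltW lam0)//.
by have [x0|x0] := leP 0 x; rewrite ?(ger0_norm x0) ?(ltr0_norm x0); lra.
Qed.

Let pwf (x : R) : `|path_weight x * f x| = path_weight x * `|f x|.
Proof. by rewrite normrM (ger0_norm (path_weight_ge0 x)). Qed.

Let ABS : mu.-integrable setT (fun x => (`|path_weight x * f x|)%:E).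
Proof. exact: (integrable_abse fi). Qed.

Let weight_f_integrable (K : R) : mu.-integrable setT (EFin \o (fun x => K * `|path_weight x * f x|)).
Proof. exact: (integrableZl measurableT K ABS). Qed.

Let singular_integrable b (K : R) t : 0 < b -> mu.-integrable setT (EFin \o (fun x => K * singular_part d b (t - x))).
Proof.
move=> b_gt0; have si := singular_part_integrable d0 b_gt0.
exact: (integrableZl measurableT K (integrable_reflect t si)).
Qed.

Let gap_integrable h (K : R) t : 0 < h -> mu.-integrable setT (EFin \o (fun x => K * power_gap d h (t - x))).
Proof.
move=> h0; have si := power_gap_integrable d0 d12 h0.
exact: (integrableZl measurableT K (integrable_reflect t si)).
Qed.

Let singular_f t x : `|t| <= T -> singular_part d 1 (t - x) * `|f x| <= B * singular_part d 1 (t - x).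
Proof.
rewrite ler_norml => /andP[t1 t2]; rewrite mulrC.
have := singular_part_ge0 d 1 (t - x); rewrite /singular_part; case: ifP => [/andP[x1 x2] p0|_ _].
  by rewrite ler_wpM2r// fB//; apply/andP; split; lra.
by rewrite !mulr0.
Qed.

Let density_measurable t : measurable_fun setT (fun x : R => g' (t - x)).
Proof.
have := integrable_reflect t (tempered_density_integrable d0 d12 lam0).
by move=> /integrableP[/measurable_EFinP].
Qed.

Lemma density_path_integrable t : `|t| <= T ->
  mu.-integrable setT (EFin \o (fun x => g' (t - x) * f x)).
Proof.
move=> tT.
have := integrableD measurableT (singular_integrable ((d + lam) * B) t ltr01) (weight_f_integrable (tc * E)).
apply: le_integrable_EFin.
  by apply: measurable_funM; [exact: density_measurable|exact: mf].
move=> x /=; rewrite normrM.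
apply: (le_trans (ler_wpM2r (normr_ge0 _) (tempered_density_le d0 d12 lam0 _))).
rewrite mulrDl; apply: lerD.
  by rewrite -!mulrA ler_wpM2l ?addr_ge0 ?(ltW d0) ?(ltW lam0)// singular_f.
rewrite pwf -/tc -(mulrA tc E) -(mulrA tc (exponential_tail _ _)) ler_wpM2l// mulrA.
by rewrite ler_wpM2r// tail_le.
Qed.

(** For x < s both densities are present and their increment is bounded by gap and tail. For s <= x
    < t only the density at t - x is nonzero, with argument at most t - s, so it falls under the
    singular part cut at t - s. *)
Let increment_le s t x : `|s| <= T -> `|t| <= T -> s < t -> t - s <= 1 ->
  `|(g' (t - x) - g' (s - x)) * f x| <=
  (d + lam + tc) * B * singular_part d (t - s) (t - x) +
  (B * power_gap d (t - s) (s - x) + (t - s) `^ d * (tc * E) * `|path_weight x * f x|).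
Proof.
move=> sT tT st h1; have h0 : 0 < t - s by rewrite subr_gt0.
have c0 : 0 <= d + lam + tc by rewrite !addr_ge0 ?(ltW d0) ?(ltW lam0).
have p1 : 0 <= (d + lam + tc) * B * singular_part d (t - s) (t - x).
  by rewrite !mulr_ge0// singular_part_ge0.
have p2 : 0 <= B * power_gap d (t - s) (s - x) by rewrite mulr_ge0// power_gap_ge0.
have p3 : 0 <= (t - s) `^ d * (tc * E) * `|path_weight x * f x|.
  apply: mulr_ge0 => //; apply: mulr_ge0; first exact: powR_ge0.
  by rewrite mulr_ge0 ?expR_ge0.
have /andP[s1 s2] : - T <= s <= T by rewrite -ler_norml.
have /andP[t1 t2] : - T <= t <= T by rewrite -ler_norml.
rewrite normrM; have [xs|sx] := ltP x s.
  rewrite -[leLHS]add0r; apply: lerD => //.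
  have u0 : 0 < s - x by rewrite subr_gt0.
  have := tempered_density_increment_le d0 d12 lam0 u0 h0 h1.
  have -> : s - x + (t - s) = t - x by ring.
  move=> H; apply: (le_trans (ler_wpM2r (normr_ge0 (f x)) H)); rewrite mulrDl; apply: lerD.
    have := power_gap_ge0 d12 (s - x) h0; rewrite mulrC.
    rewrite /power_gap; case: ifP => [/andP[x1 x2] q0|_ _]; last by rewrite !mulr0.
    by rewrite ler_wpM2r// fB//; apply/andP; split; lra.
  rewrite pwf -/tc -!(mulrA (_ `^ d)) ler_wpM2l ?powR_ge0//.
  rewrite -(mulrA tc E) -(mulrA tc (exponential_tail _ _)) ler_wpM2l// mulrA.
  by rewrite ler_wpM2r// tail_le.
have gs : g' (s - x) = 0 by rewrite /g' /tempered_density ltNge subr_le0 sx.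
rewrite gs subr0 -[leLHS]addr0; apply: lerD; last exact: addr_ge0.
have [xt|tx] := ltP x t; last first.
  by rewrite /g' /tempered_density ltNge subr_le0 tx/= normr0 mul0r.
have u0 : 0 < t - x by rewrite subr_gt0.
have u1 : t - x <= t - s by rewrite lerD2l lerN2.
have xB : `|f x| <= B by apply: fB; apply/andP; split; lra.
have := tempered_density_le d0 d12 lam0 (t - x).
rewrite /singular_part /exponential_tail u0 u1 (le_trans u1 h1)/= => H.
(* As t - x <= 1, the exponential tail is at most 1 and merges into the singular power. *)
have one_le : 1 <= (t - x) `^ (d - 1).
  rewrite -[leLHS](powRr0 (t - x)); apply: ger_powR; first by rewrite u0 (le_trans u1).
  by rewrite subr_le0 ltW.
have e1 : expR (- (lam / 2 * (t - x))) <= (t - x) `^ (d - 1).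
  apply: le_trans one_le; rewrite expR_le1 oppr_le0 !mulr_ge0 ?invr_ge0 ?(ltW lam0) ?(ltW u0)//.
rewrite mulrAC; apply: ler_pM => //.
by apply: (le_trans H); rewrite [leRHS]mulrDl lerD2l ler_wpM2l.
Qed.

Let kernel_diff s t : `|s| <= T -> `|t| <= T ->
  (\int[mu]_x (path_kernel d lam t x * f x) - \int[mu]_x (path_kernel d lam s x * f x))%R =
  (\int[mu]_x ((g' (t - x) - g' (s - x)) * f x))%R.
Proof.
move=> sT tT.
have k_int r : `|r| <= T -> mu.-integrable setT (EFin \o (fun x => path_kernel d lam r x * f x)).
  move=> rT; have z0 : `|0 : R| <= T by rewrite normr0.
  have := integrableB measurableT (density_path_integrable rT) (density_path_integrable z0).
  by apply: eq_integrable => // x _; rewrite /path_kernel /= sub0r -EFinB mulrBl.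
rewrite -RintegralB//; [|exact: k_int|exact: k_int].
by apply: eq_Rintegral => x _; rewrite /path_kernel /g'; ring.
Qed.

Lemma path_integral_holder s t : `|s| <= T -> `|t| <= T -> s < t -> t - s <= 1 ->
  `|\int[mu]_x (path_kernel d lam t x * f x) - \int[mu]_x (path_kernel d lam s x * f x)|
  <= holder_const * (B + Q) * (t - s) `^ d.
Proof.
move=> sT tT st h1; have h0 : 0 < t - s by rewrite subr_gt0.
rewrite kernel_diff//.
have Di : mu.-integrable setT (EFin \o (fun x => (g' (t - x) - g' (s - x)) * f x)).
  have := integrableB measurableT (density_path_integrable tT) (density_path_integrable sT).
  by apply: eq_integrable => // x _; rewrite /= -EFinB mulrBl.
apply: (le_trans (le_normr_Rintegral measurableT Di)).
have i1 := singular_integrable ((d + lam + tc) * B) t h0.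
have i2 := gap_integrable B s h0.
have i3 := weight_f_integrable ((t - s) `^ d * (tc * E)).
have i23 := integrableD measurableT i2 i3.
have i123 := integrableD measurableT i1 i23.
apply: (@le_trans _ _ (\int[mu]_x ((d + lam + tc) * B * singular_part d (t - s) (t - x) +
  (B * power_gap d (t - s) (s - x) + (t - s) `^ d * (tc * E) * `|path_weight x * f x|)))%R).
  apply: le_Rintegral => //; first exact: (integrable_abse Di).
  by move=> x _; exact: increment_le.
rewrite RintegralD// RintegralD//.
have sI : (\int[mu]_x ((d + lam + tc) * B * singular_part d (t - s) (t - x)))%R = (d + lam + tc) * B * ((t - s) `^ d / d).
  have si := singular_part_integrable d0 h0.
  rewrite RintegralZl//; last exact: integrable_reflect si.
  by rewrite /Rintegral (integral_reflect t si) integral_singular_part.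
have gI : (\int[mu]_x (B * power_gap d (t - s) (s - x)))%R <= B * ((t - s) `^ d / d).
  have si := power_gap_integrable d0 d12 h0.
  rewrite RintegralZl//; last exact: integrable_reflect si.
  rewrite ler_wpM2l// /Rintegral (integral_reflect s si) -lee_fin fineK.
    exact: integral_power_gap_le.
  by apply: integrable_fin_num.
have wI := RintegralZl ((t - s) `^ d * (tc * E)) measurableT ABS.
rewrite sI wI.
rewrite -/Q.
have Q0 : 0 <= Q by apply: Rintegral_ge0.
have hd := powR_ge0 (t - s) d.
have c1 : 0 <= (d + lam + tc) / d by rewrite divr_ge0 ?addr_ge0 ?(ltW d0) ?(ltW lam0).
have c2 : 0 <= d^-1 by rewrite invr_ge0 ltW.
have c3 : 0 <= tc * E by rewrite mulr_ge0 ?expR_ge0.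
apply: (@le_trans _ _ ((d + lam + tc) * B * ((t - s) `^ d / d) + (B * ((t - s) `^ d / d) + (t - s) `^ d * (tc * E) * Q))).
  by rewrite lerD2l lerD2r.
have -> : (d + lam + tc) * B * ((t - s) `^ d / d) + (B * ((t - s) `^ d / d) + (t - s) `^ d * (tc * E) * Q) =
  (((d + lam + tc) / d + d^-1) * B + tc * E * Q) * (t - s) `^ d by ring.
rewrite ler_wpM2r// /holder_const.
have -> : ((d + lam + tc) / d + d^-1 + tc * E) * (B + Q) =
  ((d + lam + tc) / d + d^-1) * B + tc * E * Q + (tc * E * B + ((d + lam + tc) / d + d^-1) * Q) by ring.
by rewrite lerDl addr_ge0// mulr_ge0// addr_ge0.
Qed.

End path_integral_holder.

(** * The path integral *)

(** The Lebesgue measure of the overlap of the interval from 0 to x with that from 0 to y: the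
    covariance of the two-sided process, up to the variance at time 1. *)
Definition second_moment_overlap (R : realType) (x y : R) : R :=
  if (0 <= x) && (0 <= y) then Num.min x y
  else if (x < 0) && (y < 0) then Num.min (- x) (- y) else 0.

Lemma second_moment_overlap_diag (R : realType) (x : R) : second_moment_overlap x x = `|x|.
Proof.
rewrite /second_moment_overlap; have [x0|x0] := leP 0 x => /=.
  by rewrite minxx ger0_norm.
by rewrite minxx ltr0_norm.
Qed.

Section signed_steps.
Context {R : realType}.
Let mu := @lebesgue_measure R.
Implicit Types x y z : R.

Lemma integral_oc a b : a <= b -> (\int[mu]_z ((a < z <= b)%R%:R : R)%:E = (b - a)%:E)%E.
Proof.
move=> ab; transitivity (\int[mu]_z (\1_(`]a, b]%classic : set R) z)%:E)%E.
  by apply: eq_integral => z _; rewrite indicE mem_setE in_itv.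
rewrite integral_indic// ?setIT//.
transitivity (mu `]a, b]%classic) => //.
rewrite /mu lebesgue_measure_itv/= lte_fin; case: ltP => // ba.
by have -> : a = b by [apply/eqP; rewrite eq_le ab ba]; rewrite subrr.
Qed.

Lemma signed_stepM x y z : signed_step x z * signed_step y z =
  if (0 <= x) && (0 <= y) then (0 < z <= Num.min x y)%R%:R
  else if (x < 0) && (y < 0) then (Num.max x y < z <= 0)%R%:R else 0.
Proof.
rewrite /signed_step le_min gt_max.
have [x0|x0] := leP 0 x; have [y0|y0] := leP 0 y => /=; have [z0|z0] := leP z 0;
  rewrite /= ?(le_trans z0 x0) ?(le_trans z0 y0) ?subrr ?mul0r ?mulr0// ?subr0 ?andbF ?andbT.
- by case: (z <= x); case: (z <= y); rewrite /= ?mulr1 ?mulr0 ?mul0r.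
- by rewrite [z <= y]leNgt (lt_trans y0 z0) mulr0.
- by rewrite [z <= x]leNgt (lt_trans x0 z0) mul0r.
- by rewrite !leNgt; case: (x < z); case: (y < z); rewrite /= ?subrr ?sub0r ?mulr0 ?mul0r ?mulrNN ?mulr1.
- by rewrite [z <= x]leNgt (lt_trans x0 z0) mul0r.
Qed.

Lemma integral_signed_stepM x y :
  (\int[mu]_z (signed_step x z * signed_step y z)%:E = (second_moment_overlap x y)%:E)%E.
Proof.
under eq_integral do rewrite signed_stepM.
rewrite /second_moment_overlap; case: ifP => [/andP[x0 y0]|_].
  by rewrite integral_oc ?subr0// le_min x0.
case: ifP => [/andP[x0 y0]|_]; last by rewrite integral0_eq.
by rewrite integral_oc ?sub0r ?oppr_max// ge_max !ltW.
Qed.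

Lemma measurable_signed_step :
  measurable_fun setT (fun p : measurableTypeR R * measurableTypeR R => signed_step p.1 p.2).
Proof.
by apply: measurable_funB; exact: measurable_ler_nat.
Qed.

End signed_steps.

Section two_sided_path.
Context d (T : measurableType d) (R : realType) (P : probability T R).
Variables (nu : {measure set (measurableTypeR R) -> \bar R}) (L1 L2 : R -> T -> R).
Hypothesis hnu : levy_measure nu.
Hypothesis hL1 : levy_process P L1.
Hypothesis hL2 : levy_process P L2.
Hypothesis hlaw : same_fdd P `[0, +oo[ L1 L2.
Hypothesis hind : independent_processes P `[0, +oo[ L1 L2.
Hypothesis hexp : forall t, 0 <= t -> has_levy_exponent P nu (fun x => x) t (L1 t).
Let mu := @lebesgue_measure R.

(* A modification of two_sided L1 L2 without left limits. *)
Definition two_sided_path (x : R) (w : T) : R := if 0 <= x then L1 x w else - L2 (- x) w.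
Let W := two_sided_path.

Let mid : measurable_fun setT (fun x : measurableTypeR R => x : R).
Proof. exact: measurable_id. Qed.

Let L1_L2 t : 0 <= t -> L2fun P (L1 t).
Proof.
move=> t0; apply: (charfun_L2 mid (levy_measure_sqr_integrable hnu) t0); last exact: hexp.
exact: levy_measurable hL1 _ t0.
Qed.

Let L1_mean t : 0 <= t -> (\int[P]_w (L1 t w)%:E = 0)%E.
Proof.
move=> t0; apply: (charfun_mean0 mid (levy_measure_sqr_integrable hnu) t0); last exact: hexp.
exact: levy_measurable hL1 _ t0.
Qed.

Lemma same_fdd_law t B : 0 <= t -> measurable B -> P (L1 t @^-1` B) = P (L2 t @^-1` B).
Proof.
move=> t0 mB; pose C : set (1.-tuple (measurableTypeR R)) := [set z | B (tnth z ord0)].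
have mC : measurable C.
  rewrite -[X in measurable X]setTI.
  exact: (measurable_tnth (ord0 : 'I_1)).
have D0 (i : 'I_1) : `[0, +oo[%classic ((fun _ : 'I_1 => t) i) by rewrite /= in_itv/= t0.
have := hlaw D0 mC.
have E (X : R -> T -> R) : (fun w => [tuple X t w | i < 1]) @^-1` C = X t @^-1` B.
  by apply/seteqP; split=> w; rewrite /preimage/C/= tnth_mktuple.
by rewrite !E.
Qed.

Let L2_law_integral t (g : R -> \bar R) : 0 <= t -> measurable_fun setT g ->
  (\int[P]_w g (L2 t w) = \int[P]_w g (L1 t w))%E.
Proof.
move=> t0; apply: same_law_integral.
- exact: levy_measurable hL2 _ t0.
- exact: levy_measurable hL1 _ t0.
- by move=> B mB; apply/esym; exact: same_fdd_law.
Qed.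

Let sqr_law t : 0 <= t -> (\int[P]_w (L2 t w ^+ 2)%:E = \int[P]_w (L1 t w ^+ 2)%:E)%E.
Proof.
move=> t0; apply: (L2_law_integral (g := fun y => (y ^+ 2)%:E)) => //.
exact/measurable_EFinP/measurable_funX.
Qed.

Let L2_L2 t : 0 <= t -> L2fun P (L2 t).
Proof.
move=> t0; split; first exact: levy_measurable hL2 _ t0.
by rewrite sqr_law//; have [] := L1_L2 t0.
Qed.

Let L2_mean t : 0 <= t -> (\int[P]_w (L2 t w)%:E = 0)%E.
Proof.
by move=> t0; rewrite (L2_law_integral (g := EFin)) ?L1_mean//; exact/measurable_EFinP.
Qed.

Definition unit_variance : R := (\int[P]_w (L1 1 w ^+ 2))%R.

Lemma unit_variance_ge0 : 0 <= unit_variance.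
Proof. by apply: Rintegral_ge0 => w _; exact: sqr_ge0. Qed.

Let L2_unit_variance : (\int[P]_w (L2 1 w ^+ 2))%R = unit_variance.
Proof. by rewrite /unit_variance /Rintegral sqr_law. Qed.

Let independent_values s t : 0 <= s -> 0 <= t -> independent_maps P (L1 s) (L2 t).
Proof.
move=> s0 t0 A B mA mB; apply: hind.
- by rewrite -[X in sigma_process _ _ X]setTI; apply: (process_measurable (D := `[0, +oo[%classic)) => //; rewrite /= in_itv/= s0.
- by rewrite -[X in sigma_process _ _ X]setTI; apply: (process_measurable (D := `[0, +oo[%classic)) => //; rewrite /= in_itv/= t0.
Qed.

Lemma two_sided_path_L2 x : L2fun P (W x).
Proof.
rewrite /W /two_sided_path; have [x0|x0] := leP 0 x; first exact: L1_L2.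
by apply: L2N; apply: L2_L2; rewrite oppr_ge0 ltW.
Qed.

Let cross s t : 0 <= s -> 0 <= t -> (\int[P]_w (L1 s w * L2 t w))%R = 0.
Proof.
move=> s0 t0; rewrite /Rintegral.
by rewrite (independent_mul0 (L1_L2 s0) (L2_L2 t0) (L2_mean t0) (independent_values s0 t0)).
Qed.

Let opp_cross s t : 0 <= s -> 0 <= t -> (\int[P]_w (- (L1 s w * L2 t w)))%R = 0.
Proof.
move=> s0 t0; under eq_Rintegral do rewrite -mulN1r.
rewrite RintegralZl// ?cross ?mulr0//.
by apply: L2_mul_integrable; [exact: L1_L2|exact: L2_L2].
Qed.

Lemma two_sided_path_covariance x y :
  (\int[P]_w (W x w * W y w))%R = second_moment_overlap x y * unit_variance.
Proof.
rewrite /W /two_sided_path /second_moment_overlap.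
have [x0|x0] := leP 0 x; have [y0|y0] := leP 0 y => /=.
- exact: levy_covariance.
- by under eq_Rintegral do rewrite mulrN; rewrite mul0r opp_cross// oppr_ge0 ltW.
- by under eq_Rintegral do rewrite mulNr mulrC; rewrite mul0r opp_cross// oppr_ge0 ltW.
- under eq_Rintegral do rewrite mulrNN.
  by rewrite (levy_covariance hL2 L2_L2 L2_mean) ?L2_unit_variance// oppr_ge0 ltW.
Qed.

(** Only negative x matter, where the left limit of [L2] at - x is almost surely its value, in the
    absence of fixed jumps. *)
Lemma two_sided_path_ae x : {ae P, forall w, two_sided L1 L2 x w = W x w}.
Proof.
rewrite /two_sided /W /two_sided_path; have [x0|x0] := leP 0 x; first exact: aeW.
have x0' : 0 < - x by rewrite oppr_gt0.
by apply: filterS (levy_no_fixed_jump hL2 L2_L2 L2_mean x0') => w ->.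
Qed.

Lemma measurable_two_sided_path :
  measurable_fun setT (fun p : measurableTypeR R * T => W p.1 p.2).
Proof.
have -> : (fun p : measurableTypeR R * T => W p.1 p.2) =
    (fun p => if 0 <= p.1 then L1 (Num.max p.1 0) p.2 else - L2 (Num.max (- p.1) 0) p.2).
  apply/funext => p; rewrite /W /two_sided_path; have [//|x0] := leP 0 p.1.
  by rewrite max_l// oppr_ge0 ltW.
have m1 := cadlag_joint_measurable (levy_measurable hL1) (levy_right_continuous hL1).
have m2 := cadlag_joint_measurable (levy_measurable hL2) (levy_right_continuous hL2).
have mfst : measurable_fun setT (fun p : measurableTypeR R * T => p.1 : R) by exact: measurable_fst.
apply: measurable_fun_ifT => //.
  by apply: measurable_fun_ler => //; exact: measurable_cst.
apply: measurable_funN.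
have mneg : measurable_fun setT (fun p : measurableTypeR R * T => (- p.1, p.2) : measurableTypeR R * T).
  by apply: measurable_fun_pair; [exact: measurable_funN|exact: measurable_snd].
exact: (measurableT_comp m2 mneg).
Qed.

Lemma two_sided_path_bound K : 0 <= K -> exists B : T -> R,
  measurable_fun setT B /\ forall w x, - K <= x <= K -> `|W x w| <= B w.
Proof.
move=> K0.
have [B1 [m1 b1]] := cadlag_measurable_bound (levy_measurable hL1)
  (levy_right_continuous hL1) (levy_left_limit hL1) K0.
have [B2 [m2 b2]] := cadlag_measurable_bound (levy_measurable hL2)
  (levy_right_continuous hL2) (levy_left_limit hL2) K0.
exists (fun w => B1 w + B2 w); split; first exact: measurable_funD.
have p1 w : 0 <= B1 w by apply: le_trans (b1 w 0 _); rewrite ?lexx.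
have p2 w : 0 <= B2 w by apply: le_trans (b2 w 0 _); rewrite ?lexx.
move=> w x /andP[x1 x2]; rewrite /W /two_sided_path; have [x0|x0] := leP 0 x.
  by rewrite (le_trans (b1 w x _)) ?x0// lerDl.
by rewrite normrN (le_trans (b2 w (- x) _)) ?lerDr// oppr_ge0 (ltW x0)/= lerNl.
Qed.

End two_sided_path.

Lemma path_weight_integrable (R : realType) (lam : R) : 0 < lam ->
  (@lebesgue_measure R).-integrable setT (fun x => (path_weight lam x * (1 + `|x|))%:E).
Proof.
move=> lam0; pose mu := @lebesgue_measure R.
pose c := lam / 4; have c0 : 0 < c by rewrite divr_gt0.
pose D := 1 + c^-1; have D0 : 0 <= D by rewrite addr_ge0 ?invr_ge0 ?(ltW c0).
have ti := exponential_tail_integrable c0.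
have t1 := integrable_reflect 0 ti.
(* [exponential_tail] vanishes at 0, so the half x >= 0 is covered by the tail at 1 + x; the shift
   costs the factor [expR c]. *)
have t2 := integrable_reflect 0 (integrable_reflect 1 ti).
have := integrableD measurableT (integrableZl measurableT (D * expR c) t2) (integrableZl measurableT D t1).
apply: le_integrable_EFin.
  apply: measurable_funM; first exact: measurable_path_weight.
  by apply: measurable_funD => //; exact: measurableT_comp.
move=> x /=; rewrite ger0_norm; last by rewrite mulr_ge0 ?path_weight_ge0// addr_ge0.
apply: (@le_trans _ _ (D * expR (- (c * `|x|)))).
  have := @linear_mul_expRN_le R c `|x| c0 (normr_ge0 x).
  have -> : 2 * c * `|x| = lam / 2 * `|x| by rewrite /c; field.
  by rewrite mulrC.
have e0 := expR_ge0 c.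
rewrite -(mulrA D (expR c)) -mulrDr ler_wpM2l//.
have p1 := exponential_tail_ge0 c (1 - (0 - x)); have p2 := exponential_tail_ge0 c (0 - x).
have [x0|x0] := leP 0 x.
  rewrite (ger0_norm x0) -[leLHS]addr0 lerD//.
  rewrite /exponential_tail sub0r opprK ltr_pwDl// -expRD ler_expR; lra.
rewrite (ltr0_norm x0) -[leLHS]add0r lerD//; first exact: mulr_ge0.
by rewrite /exponential_tail sub0r oppr_gt0 x0.
Qed.

(** * The path integral as a Hoelder continuous modification *)

Section tempered_path.
Context d (T : measurableType d) (R : realType) (P : probability T R).
Variables (nu : {measure set (measurableTypeR R) -> \bar R}) (L1 L2 : R -> T -> R).
Hypothesis hnu : levy_measure nu.
Hypothesis hL1 : levy_process P L1.
Hypothesis hL2 : levy_process P L2.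
Hypothesis hlaw : same_fdd P `[0, +oo[ L1 L2.
Hypothesis hind : independent_processes P `[0, +oo[ L1 L2.
Hypothesis hexp : forall t, 0 <= t -> has_levy_exponent P nu (fun x => x) t (L1 t).
Variables (a lam : R).
Hypothesis a0 : 0 < a.
Hypothesis a12 : a <= 2^-1.
Hypothesis lam0 : 0 < lam.
Let mu := @lebesgue_measure R.
Let W := two_sided_path L1 L2.
Let L := two_sided L1 L2.
Let v := unit_variance P L1.

Let v0 : 0 <= v. Proof. exact: unit_variance_ge0. Qed.

(** The second moment of [W x] is v |x|; the added constants give a bound that is at least 1, as
    required of [a] in the general lemmas on integrated fields. *)
Let second_moment (x : R) : R := (v + 1) * (1 + `|x|).

Let second_moment_ge1 x : 1 <= second_moment x.
Proof.
rewrite /second_moment; have := normr_ge0 x; have := v0; nra.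
Qed.

Let measurable_second_moment : measurable_fun setT (second_moment : measurableTypeR R -> R).
Proof. by apply: measurable_funM => //; apply: measurable_funD => //; exact: measurableT_comp. Qed.

Let mW := measurable_two_sided_path hL1 hL2.

Let W2 x : (\int[P]_w (W x w ^+ 2)%:E <= (second_moment x)%:E)%E.
Proof.
rewrite -(Rintegral_fineK (L2_sqr_integrable (two_sided_path_L2 hnu hL1 hL2 hlaw hexp x))) lee_fin.
under eq_Rintegral do rewrite expr2.
rewrite (two_sided_path_covariance hnu hL1 hL2 hlaw hind hexp) second_moment_overlap_diag -/v.
by rewrite /second_moment; have := normr_ge0 x; have := v0; nra.
Qed.

Let q (x z : R) : R := Num.sqrt v * signed_step x z.

Let mq : measurable_fun setT (fun p : measurableTypeR R * measurableTypeR R => q p.1 p.2).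
Proof. by apply: measurable_funM => //; exact: measurable_signed_step. Qed.

Let qM x y : (\int[mu]_z (q x z * q y z)%:E = (v * second_moment_overlap x y)%:E)%E.
Proof.
have mss x' : measurable_fun setT (signed_step x' : measurableTypeR R -> R).
  exact: (measurableT_comp measurable_signed_step (pair1_measurable x')).
have E z : q x z * q y z = v * (signed_step x z * signed_step y z).
  by rewrite /q mulrACA -expr2 sqr_sqrtr.
under eq_integral do rewrite E EFinM.
rewrite integralZl ?integral_signed_stepM//.
apply/integrableP; split; first by apply/measurable_EFinP; exact: measurable_funM.
have Ls x' : L2fun mu (signed_step x').
  split; first exact: mss.
  by under eq_integral do rewrite expr2; rewrite integral_signed_stepM ltry.
by have /integrableP[] := L2_mul_integrable (Ls x) (Ls y).
Qed.

Let q2 x : (\int[mu]_z (q x z ^+ 2)%:E <= (second_moment x)%:E)%E.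
Proof.
under eq_integral do rewrite expr2.
rewrite qM second_moment_overlap_diag lee_fin.
by rewrite /second_moment; have := normr_ge0 x; have := v0; nra.
Qed.

Let Wq x y : (\int[P]_w (W x w * W y w) = \int[mu]_z (q x z * q y z))%R.
Proof.
rewrite (two_sided_path_covariance hnu hL1 hL2 hlaw hind hexp) /Rintegral qM/=.
by rewrite mulrC.
Qed.

Let k (t : R) : measurableTypeR R -> R := path_kernel a lam t.

Let mk t : measurable_fun setT (k t).
Proof.
have /integrableP[/measurable_EFinP] := path_kernel_integrable a0 a12 lam0 t.
exact.
Qed.

Let ki t : mu.-integrable setT (fun x => (k t x * second_moment x)%:E).
Proof.
have := integrableZl measurableT (v + 1) (path_kernel_weighted_integrable a0 a12 lam0 t).
by apply: eq_integrable => // x _; rewrite -EFinM /second_moment mulrCA.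
Qed.

Definition path_integral (t : R) (w : T) : R := (\int[mu]_x (path_kernel a lam t x * W x w))%R.
Let J := path_integral.

Lemma path_integral_measurable t : measurable_fun setT (J t).
Proof. exact: (integrated_field_measurable mu (mk t) mW). Qed.

(** A step integral rewritten as a weighted sum of values of the process, the form taken by
    [integrated_field_isometry]. *)
Let endpoints (phi : @step R) : seq (R * R) :=
  flatten [seq [:: (p.1.1, p.2); (- p.1.1, p.1.2)] | p <- phi].

Let sum_endpoints (phi : @step R) (F : R -> R) :
  \sum_(p <- endpoints phi) p.1 * F p.2 = \sum_(p <- phi) p.1.1 * (F p.2 - F p.1.2).
Proof.
rewrite /endpoints big_flatten big_map; apply: eq_bigr => p _.
by rewrite !big_cons big_nil /= addr0 mulNr mulrBr.
Qed.

Let step_integral_ae (phi : @step R) :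
  {ae P, forall w, step_integral L phi w = \sum_(p <- endpoints phi) p.1 * W p.2 w}.
Proof.
suff: {ae P, forall w, step_integral L phi w = \sum_(p <- phi) p.1.1 * (W p.2 w - W p.1.2 w)}.
  by apply: filterS => w ->; rewrite (sum_endpoints phi (W ^~ w)).
rewrite /step_integral; elim: phi => [|p phi IH]; first by apply: aeW => w; rewrite !big_nil.
have e1 := two_sided_path_ae hnu hL1 hL2 hlaw hexp p.1.2.
have e2 := two_sided_path_ae hnu hL1 hL2 hlaw hexp p.2.
apply: filterS3 IH e1 e2 => w h h1 h2.
by rewrite !big_cons h /L h1 h2.
Qed.

Let isometry t (phi : @step R) : wf_step phi ->
  (\int[P]_w ((J t w - step_integral L phi w) ^+ 2)%:E =
   v%:E * \int[mu]_z ((tflp_kernel a lam t z - step_fun phi z) ^+ 2)%:E)%E.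
Proof.
move=> wf; have mS := step_integral_measurable hL1 hL2 phi.
have mW1 x : measurable_fun setT (W x) by exact: (field_measurable mW).
transitivity (\int[P]_w ((J t w - \sum_(p <- endpoints phi) p.1 * W p.2 w) ^+ 2)%:E)%E.
  apply: ae_eq_integral => //.
  - by apply/measurable_EFinP/measurable_funX/measurable_funB => //; exact: path_integral_measurable.
  - apply/measurable_EFinP/measurable_funX/measurable_funB; first exact: path_integral_measurable.
    by apply: measurable_sum => p; exact: measurable_funM.
  - by apply: filterS (step_integral_ae phi) => w -> _.
rewrite (integrated_field_isometry (mk t) measurable_second_moment second_moment_ge1 (ki t) mW W2 mq q2 Wq).
have E (z : R) : (integrated_field mu (k t) q z - \sum_(p <- endpoints phi) p.1 * q p.2 z) ^+ 2 =
    v * (tflp_kernel a lam t z - step_fun phi z) ^+ 2.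
  have -> : integrated_field mu (k t) q z = Num.sqrt v * tflp_kernel a lam t z.
    rewrite -(path_kernel_represents a0 a12 lam0) /integrated_field.
    under eq_Rintegral do rewrite /q mulrCA.
    rewrite RintegralZl//.
    have := path_kernel_integrable a0 a12 lam0 t => /integrable_abse.
    apply: le_integrable_EFin.
      apply: measurable_funM; first exact: mk.
      exact: (measurableT_comp measurable_signed_step (pair2_measurable z)).
    move=> x; rewrite normrM /signed_step.
    by case: (z <= x); case: (z <= 0); rewrite /= ?subrr ?subr0 ?sub0r ?normrN ?normr0 ?normr1 ?mulr0 ?mulr1.
  rewrite (step_funE _ wf).
  have -> : \sum_(p <- endpoints phi) p.1 * q p.2 z =
      Num.sqrt v * \sum_(p <- phi) p.1.1 * ((z <= p.2)%R%:R - (z <= p.1.2)%R%:R).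
    rewrite (sum_endpoints phi (fun x => q x z)) mulr_sumr; apply: eq_bigr => p _.
    by rewrite /q /signed_step; ring.
  by rewrite -mulrBr exprMn sqr_sqrtr.
transitivity (\int[mu]_z (v * (tflp_kernel a lam t z - step_fun phi z) ^+ 2)%:E)%E.
  by apply: eq_integral => z _; rewrite E.
have mtk : measurable_fun setT (tflp_kernel a lam t).
  rewrite (_ : tflp_kernel a lam t = integrated_field mu (k t) (signed_step : measurableTypeR R -> measurableTypeR R -> R)).
    exact: (integrated_field_measurable mu (mk t) measurable_signed_step).
  by apply/funext => z; rewrite -(path_kernel_represents a0 a12 lam0).
under eq_integral do rewrite EFinM.
rewrite ge0_integralZl_EFin//.
- by move=> z _; rewrite lee_fin sqr_ge0.
- apply/measurable_EFinP/measurable_funX/measurable_funB; first exact: mtk.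
  exact: measurable_step_fun.
Qed.

(** By the isometry, the step integrals that approximate [I] converge to [J t] too. The bound (I -
    J)^2 <= 2 (I - S)^2 + 2 (J - S)^2 then makes the L^2 distance zero. *)
Lemma wiener_integral_path t I : is_wiener_integral P L (tflp_kernel a lam t) I ->
  {ae P, forall w, I w = J t w}.
Proof.
move=> [_ mI [phi [wf cK cI]]].
have mJ := path_integral_measurable t.
have mS n := step_integral_measurable hL1 hL2 (phi n).
have cJ : (\int[P]_w ((J t w - step_integral L (phi n) w) ^+ 2)%:E @[n --> \oo] --> 0)%E.
  under eq_fun do rewrite (isometry _ (wf _)).
  by rewrite -(mule0 v%:E); apply: cvgeZl.
have le n : (\int[P]_w ((I w - J t w) ^+ 2)%:E <=
    2%:E * (\int[P]_w ((I w - step_integral L (phi n) w) ^+ 2)%:E +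
            \int[P]_w ((J t w - step_integral L (phi n) w) ^+ 2)%:E))%E.
  have m1' := measurable_funX 2 (measurable_funB mI (mS n)).
  have m2' := measurable_funX 2 (measurable_funB mJ (mS n)).
  rewrite muleDr ?ge0_adde_def ?inE ?integral_ge0//; [|by move=> w _; rewrite lee_fin sqr_ge0..].
  rewrite -ge0_integral_linear//; [|by move=> w; exact: sqr_ge0..].
  apply: ge0_le_integral_EFin.
  - exact: measurable_funX 2 (measurable_funB mI mJ).
  - by apply: measurable_funD; exact: measurable_funM.
  - by move=> w; exact: sqr_ge0.
  - move=> w.
    by have := sqr_ge0 (I w + J t w - 2 * step_integral L (phi n) w); nra.
have z0 : (\int[P]_w ((I w - J t w) ^+ 2)%:E <= 0)%E.
  have cvg0 : (2%:E * (\int[P]_w ((I w - step_integral L (phi n) w) ^+ 2)%:E +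
            \int[P]_w ((J t w - step_integral L (phi n) w) ^+ 2)%:E) @[n --> \oo] --> 2%:E * (0 + 0))%E.
    by apply: cvgeZl => //; apply: cvgeD => //; move: cI; rewrite unlock.
  rewrite adde0 mule0 in cvg0.
  by apply: (cvge_ge _ cvg0); apply: nearW => n; exact: le.
apply: filterS (sqr_integral_le0 (measurable_funB mI mJ) z0) => w /eqP.
by rewrite subr_eq0 => /eqP.
Qed.

Definition weighted_path_norm (w : T) : \bar R := (\int[mu]_x (`|path_weight lam x * W x w|%R)%:E)%E.
Let Q := weighted_path_norm.

Let mpw : measurable_fun setT (path_weight lam : measurableTypeR R -> R).
Proof. exact: measurable_path_weight. Qed.

Let mQ : measurable_fun setT Q.
Proof. exact: (field_majorant_measurable mu mpw mW). Qed.

Let pwi : mu.-integrable setT (fun x => (path_weight lam x * second_moment x)%:E).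
Proof.
have := integrableZl measurableT (v + 1) (path_weight_integrable lam0).
by apply: eq_integrable => // x _; rewrite -EFinM /second_moment mulrCA.
Qed.

Let Q_ae : {ae P, forall w, (Q w < +oo)%E}.
Proof.
exact: (field_majorant_ae_finite mpw measurable_second_moment second_moment_ge1 pwi mW W2).
Qed.

(* The set where the weighted norm is infinite is negligible but need not be
   empty; the path integral is set to 0 there. *)
Definition holder_version (t : R) (w : T) : R :=
  (Gamma (1 + a))^-1 * (if (Q w < +oo)%E then J t w else 0).

Lemma holder_version_modification S : is_tflp P L a lam S -> is_modification P holder_version S.
Proof.
move=> hS t; split.
  apply: measurable_funM => //; apply: measurable_fun_ifT => //; last exact: path_integral_measurable.
  exact: measurable_fun_lte.
have [I hI ->] := hS t.
apply: filterS2 (wiener_integral_path hI) Q_ae => w -> Qw.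
by rewrite /holder_version Qw.
Qed.

(** The radius is the constant 1 and all randomness goes into [C], built from the bound of the path
    on [- (K + 1), K + 1] and its weighted norm. The summand 1 keeps [C] positive; where the
    weighted norm is infinite, [fine] turns it into 0 and the version vanishes. The bound holds for
    every w, so the event is the whole space. *)
Lemma holder_version_holder : locally_holder P a holder_version.
Proof.
move=> K K0; have K1 : 0 <= K + 1 by rewrite addr_ge0// ltW.
have [B [mB hB]] := two_sided_path_bound hL1 hL2 K1.
have B0 w : 0 <= B w by apply: le_trans (hB w 0 _); rewrite ?oppr_le0 ?K1.
have hc0 : 0 <= holder_const a lam K.
  rewrite /holder_const; have tc := tempered_const_ge0 lam0.
  apply: addr_ge0; last exact: mulr_ge0 tc (expR_ge0 _).
  apply: addr_ge0; last by rewrite invr_ge0 ltW.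
  by rewrite divr_ge0 ?(ltW a0)// addr_ge0// addr_ge0 ?(ltW a0) ?(ltW lam0).
pose C w := 1 + `|(Gamma (1 + a))^-1| * (holder_const a lam K * (B w + fine (Q w))).
have C0 w : 0 < C w.
  have Q0 : (0 <= Q w)%E by exact: integral_ge0.
  by rewrite ltr_pwDl// mulr_ge0// mulr_ge0// addr_ge0// fine_ge0.
have mC : measurable_fun setT C.
  apply: measurable_funD => //; apply: measurable_funM => //; apply: measurable_funM => //.
  by apply: measurable_funD => //; apply: measurableT_comp => //; exact: fine_measurable.
exists (mfun_Sub (mem_set (@measurable_cst _ _ _ _ setT (1 : R)))), (mfun_Sub (mem_set mC)) => /=.
have bound w s t : `|s| <= K -> `|t| <= K -> s < t -> t - s < 1 ->
    `|holder_version t w - holder_version s w| <= C w * (t - s) `^ a.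
  move=> sK tK st h1; rewrite /holder_version -mulrBr normrM.
  have ha := powR_ge0 (t - s) a.
  case Qw : (Q w < +oo)%E; last first.
    rewrite subr0 normr0 mulr0.
    exact: mulr_ge0 (ltW (C0 w)) ha.
  have fi : mu.-integrable setT (fun x => (path_weight lam x * W x w)%:E).
    exact: (field_majorant_integrable mpw mW Qw).
  have mWw : measurable_fun setT (W ^~ w : R -> R) by exact: (field_path_measurable mW).
  have fB x : - (K + 1) <= x <= K -> `|W x w| <= B w.
    by move=> /andP[x1 x2]; apply: hB; rewrite x1/= (le_trans x2)// lerDl.
  have := path_integral_holder a0 a12 lam0 (ltW K0) mWw fB fi sK tK st (ltW h1).
  rewrite -/(J t w) -/(J s w) => H.
  apply: (le_trans (ler_wpM2l (normr_ge0 _) H)).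
  by rewrite mulrA ler_wpM2r// lerDr.
have ET : [set w | (ereal_sup (holder_quotients (holder_version ^~ w) a K 1) <= (C w)%:E)%E] = setT.
  apply/seteqP; split=> // w _ /=; apply: ge_ereal_sup => _ [s [t [/andP[st0 st1] sK tK ->]]].
  have sa : 0 < `|s - t| `^ a by rewrite powR_gt0.
  rewrite lee_fin ler_pdivrMr//; have [st|ts|E] := ltgtP s t.
  - move: st0 st1; rewrite distrC gtr0_norm ?subr_gt0// => st0 st1.
    exact: bound.
  - move: st0 st1; rewrite gtr0_norm ?subr_gt0// => st0 st1.
    by rewrite distrC; exact: bound.
  - by move: st0; rewrite E subrr normr0 ltxx.
split.
- by apply: aeW.
- exact: C0.
- by rewrite ET.
- by rewrite ET probability_setT.
Qed.

End tempered_path.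

Theorem theorem2p6 (R : realType) (disp : measure_display)
    (Omega : measurableType disp) (P : probability Omega R)
    (nu : {measure set (measurableTypeR R) -> \bar R})
    (L : R -> Omega -> R) (hL : driving_levy P nu L)
    (lambda : R) (hlambda : 0 < lambda) :
  (forall (d : R) (S : R -> Omega -> R),
     0 < d -> d <= 2^-1 -> is_tflp P L d lambda S ->
     exists S' : R -> Omega -> R,
       is_modification P S' S /\ locally_holder P d S')
  /\
  (forall (d : R) (S : R -> Omega -> R),
     - 2^-1 < d -> d < 0 -> nu setT != 0%E -> symmetric_fdd P L ->
     is_tflp P L d lambda S ->
     holds_with_positive_probability P
       (fun w => discontinuous_unbounded (S ^~ w))).
Proof.
split=> d S; last by move=> d1 d2 nu0 hsym; exact: tflp_unbounded hL _ _ _ hlambda d1 d2 nu0 hsym.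
move=> d0 d12; have [hnu [L1 [L2 [[hL1 hL2] hlaw hind LE [_ hchar]]]]] := hL.
rewrite LE in hchar * => hS.
have hexp t : 0 <= t -> has_levy_exponent P nu (fun x => x) t (L1 t).
  exact: driving_levy_exponent hchar t.
exists (holder_version L1 L2 d lambda); split.
  exact: (holder_version_modification hnu hL1 hL2 hlaw hind hexp).
by apply: holder_version_holder.
Qed.
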